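(* Let $\Gamma$ be a $Gr'(1/6)$-labelled graph whose components are finite, labelled by a finite set $\mathcal S$, and assume that $G(\Gamma)$ is infinite. Then there exists an infinite order element $g\in G(\Gamma)$ such that $\langle g\rangle$ is strongly contracting in $\mathrm{Cay}(G(\Gamma),\mathcal S)$.
   Context: Graphical small cancellation. An $\mathcal S$-labelled graph $\Gamma$ is a directed graph with edges labelled by elements of $\mathcal S$; paths may traverse edges backwards, reading inverse labels. The labelling is assumed reduced: no vertex has two outgoing edges with the same label, and no vertex has two incoming edges with the same label. $G(\Gamma)=\langle\mathcal S\mid\mathcal R\rangle$, where $\mathcal R$ is the set of words read on simple cycles of $\Gamma$. A piece is a labelled path graph $p$ with two label-preserving maps $\phi_1,\phi_2\colon p\to\Gamma$ such that no label-preserving automorphism $\psi$ of $\Gamma$ has $\phi_2=\psi\circ\phi_1$. $\Gamma$ is $Gr'(1/6)$-labelled if every piece $p$ contained in a simple cycle $c$ has $|p|<|c|/6$ (with $|\cdot|$ the number of edges). Contraction. Cayley graphs carry the graph metric. A subset $Y$ (here the vertex set $\langle g\rangle$) is strongly contracting if there is a constant $C$ such that, for all $x,x'$, $d(x,x')\le d(x,Y)$ implies $\mathrm{diam}(\pi(x)\cup\pi(x'))\le C$. Here $\pi(x)=\{y\in Y:d(x,y)=d(x,Y)\}$. *)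

(* Defs.v *)
From Stdlib Require Import List ZArith PeanoNat.
Import ListNotations.
Set Implicit Arguments.

(* A letter (s, true) is the generator s, (s, false) is s^{-1}. *)
Definition letter (S : Type) := (S * bool)%type.
Definition word (S : Type) := list (letter S).
Definition inv_letter {S : Type} (a : letter S) : letter S := (fst a, negb (snd a)).
Definition inv_word {S : Type} (w : word S) : word S := rev (map inv_letter w).

Record LGraph (S : Type) := {
  V : Type;
  E : Type;
  src : E -> V;
  tgt : E -> V;
  lab : E -> S
}.
Arguments V {S}. Arguments E {S}. Arguments src {S}. Arguments tgt {S}. Arguments lab {S}.

Section Graph.
Variable S : Type.
Variable Γ : LGraph S.

Definition reduced : Prop :=
  (forall e1 e2 : E Γ, src Γ e1 = src Γ e2 -> lab Γ e1 = lab Γ e2 -> e1 = e2) /\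
  (forall e1 e2 : E Γ, tgt Γ e1 = tgt Γ e2 -> lab Γ e1 = lab Γ e2 -> e1 = e2).

Definition step := (E Γ * bool)%type.
Definition step_src (st : step) : V Γ :=
  if snd st then src Γ (fst st) else tgt Γ (fst st).
Definition step_tgt (st : step) : V Γ :=
  if snd st then tgt Γ (fst st) else src Γ (fst st).
Definition step_label (st : step) : letter S := (lab Γ (fst st), snd st).

Fixpoint valid (v : V Γ) (p : list step) : Prop :=
  match p with
  | [] => True
  | st :: p' => step_src st = v /\ valid (step_tgt st) p'
  end.

Fixpoint path_end (v : V Γ) (p : list step) : V Γ :=
  match p with
  | [] => v
  | st :: p' => path_end (step_tgt st) p'
  end.

Definition label_of (p : list step) : word S := map step_label p.

Definition simple_cycle (v : V Γ) (p : list step) : Prop :=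
  p <> [] /\ valid v p /\ path_end v p = v /\
  NoDup (map step_tgt p) /\ NoDup (map fst p).

Definition relator (w : word S) : Prop :=
  exists v p, simple_cycle v p /\ w = label_of p.

Definition bij {A : Type} (f : A -> A) : Prop :=
  exists g : A -> A, (forall x, g (f x) = x) /\ (forall y, f (g y) = y).

Definition lp_aut (fV : V Γ -> V Γ) (fE : E Γ -> E Γ) : Prop :=
  bij fV /\ bij fE /\
  forall e, src Γ (fE e) = fV (src Γ e) /\ tgt Γ (fE e) = fV (tgt Γ e) /\
            lab Γ (fE e) = lab Γ e.

(** Pieces.  A label-preserving map of a labelled path graph p into Γ is the
    same as a path (v, steps) in Γ whose sequence of (label, orientation)
    equals that of p.  So a piece is a pair of paths in Γ reading the same
    oriented labels, not related by a label-preserving automorphism. *)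
Definition piece (v1 : V Γ) (p1 : list step) (v2 : V Γ) (p2 : list step) : Prop :=
  valid v1 p1 /\ valid v2 p2 /\ label_of p1 = label_of p2 /\
  ~ (exists fV fE, lp_aut fV fE /\ fV v1 = v2 /\ map fE (map fst p1) = map fst p2).

(** Gr'(1/6): every piece which is a subpath of a simple cycle c has
    |p| < |c|/6.  (Every rotation and the reversal of a simple cycle is a
    simple cycle, so "subpath" may be taken to mean "initial segment".) *)
Definition Gr'16 : Prop :=
  forall v c, simple_cycle v c ->
  forall p1 v2 p2, piece v p1 v2 p2 ->
  (exists c', c = p1 ++ c') -> 6 * length p1 < length c.

Definition connected (v u : V Γ) : Prop :=
  exists p, valid v p /\ path_end v p = u.

Definition finite_components : Prop :=
  forall v, exists l : list (V Γ), forall u, connected v u -> In u l.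

(* equality in G(Γ) of the elements represented by two words: the
   congruence generated by free cancellation and the relators *)
Inductive geq : word S -> word S -> Prop :=
| geq_refl w : geq w w
| geq_sym u w : geq u w -> geq w u
| geq_trans u v w : geq u v -> geq v w -> geq u w
| geq_free u a w : geq (u ++ a :: inv_letter a :: w) (u ++ w)
| geq_rel u r w : relator r -> geq (u ++ r ++ w) (u ++ w).

Definition group_infinite : Prop :=
  ~ exists l : list (word S), forall w, exists w', In w' l /\ geq w w'.

Definition gpow (g : word S) (k : Z) : word S :=
  match k with
  | Z0 => []
  | Zpos n => concat (repeat g (Pos.to_nat n))
  | Zneg n => concat (repeat (inv_word g) (Pos.to_nat n))
  end.

Definition infinite_order (g : word S) : Prop :=
  forall k : Z, k <> 0%Z -> ~ geq (gpow g k) [].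

(** Graph metric of Cay(G(Γ), S): d(x,y) = n iff n is the least length of a
    word w over S^{±1} with x w = y in G(Γ). *)
Definition is_dist (x y : word S) (n : nat) : Prop :=
  (exists w, length w = n /\ geq (x ++ w) y) /\
  (forall w, geq (x ++ w) y -> n <= length w).

Definition is_dist_cyc (g x : word S) (n : nat) : Prop :=
  (exists k, is_dist x (gpow g k) n) /\
  (forall k m, is_dist x (gpow g k) m -> n <= m).

Definition in_proj (g x y : word S) : Prop :=
  exists k n, geq y (gpow g k) /\ is_dist_cyc g x n /\ is_dist x y n.

Definition strongly_contracting (g : word S) : Prop :=
  exists C : nat, forall x x' (dY dxx' : nat),
    is_dist_cyc g x dY -> is_dist x x' dxx' -> dxx' <= dY ->
    forall y y', (in_proj g x y \/ in_proj g x' y) ->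
                 (in_proj g x y' \/ in_proj g x' y') ->
    forall n, is_dist y y' n -> n <= C.

End Graph.

(* Main.v *)
From Stdlib Require Import List Permutation ZArith Classical.
From mathcomp Require Import all_boot all_fingroup.
From mathcomp Require Import zify.
Require Import Defs.

Set Implicit Arguments. Unset Strict Implicit. Unset Printing Implicit Defensive.

(* The group is studied through van Kampen diagrams, encoded as planar maps on a finite set of darts: [phi]
   turns around faces, the involution [eps] reverses edges and [eps * phi] turns around vertices. In a diagram
   with the fewest edges an arc between two inner faces is a piece, hence shorter than a sixth of either face,
   and no face meets itself. Distributing curvature from faces to vertices shows that, along a polygon whose sides are freely
   reduced and cover at most half of any relator, all but boundedly many boundary faces are flat: they have
   exactly four interior arcs and one arc on the boundary.
   Suppose that all powers of g are such sides, that their overlaps with relators are bounded and that chains of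
   consecutive flat faces along them have bounded length. Then a quadrangle formed by a power of g, two shortest paths
   to <g> and a geodesic no longer than one of them cannot have a long side on <g>: this is strong contraction.
   If simple cycles have bounded length, such a g is found by the pigeonhole principle on a long geodesic.
   Otherwise g = q r, with q a shortest word on a cycle that is not a piece, and r a long word on a far longer
   cycle. The boundary arc of a flat face is longer than a third of it, so along a power of g it contains the
   whole of q; being also shorter than r, no two such arcs are consecutive. *)

(** * Planar maps *)

(** No topology is involved: Euler's formula is an inequality between numbers of cycles of
    permutations, and every surgery on a diagram is a product with transpositions, whose effect on
    that inequality can be computed. Pieces control only arcs between distinct faces, so a face
    folded onto itself needs an induction of its own: the region it encloses would be a disc with
    one corner, which curvature forbids. With the constant 1/6, a face without boundary arc has at
    least seven arcs, and one with a single boundary arc of at most half its length has at least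
    four more; equality in the second case makes the face flat and fixes the combinatorics along a
    side. Unbounded cycles obstruct the pigeonhole argument, since relators may then follow a
    geodesic arbitrarily far. Finiteness of the components enters there: a word that is not a piece
    is read in one component only, up to automorphism, so the cycles near it have bounded length;
    conversely a component with a very long cycle has no short one. Words q and r taken from such
    different scales can share a relator only in a controlled way. *)

Lemma leq_imset_card_factor (T U W : finType) (f : T -> U) (g : T -> W) (A : {set T}) :
  {in A &, forall x y, f x = f y -> g x = g y} -> #|g @: A| <= #|f @: A|.
Proof.
move=> fg; case: (set_0Vmem A) => [->|[x0 x0A]]; first by rewrite !imset0 !cards0.
pose h u := g (odflt x0 [pick x in A | f x == u]).
suff -> : g @: A = h @: (f @: A) by apply: leq_imset_card.
rewrite -imset_comp; apply: eq_in_imset => x xA; rewrite /h /=.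
case: pickP => [y /andP[yA /eqP fyx]|/(_ x)]; last by rewrite xA eqxx.
exact: fg.
Qed.

Section Planar.
Variable T : finType.
Implicit Types (a b : {perm T}) (x y z : T).

Definition link a b : rel T := connect (fun x y => (a x == y) || (b x == y)).
Definition comp a b x : {set T} := [set y | link a b x y].
Definition ncc a b : nat := #|comp a b @: [set: T]|.
(** Euler's formula for hypermaps: the counts are faces, edges and vertices, and the defect is twice
    the genus. As the genus is never negative ([genus_ge0]), the inequality means genus zero. *)
Definition planar a b :=
  #|T| + 2 * ncc a b <= #|porbits a| + #|porbits b| + #|porbits (b * a)%g|.

Lemma link_refl a b x : link a b x x. Proof. exact: connect0. Qed.

Lemma link_trans a b y x z : link a b x y -> link a b y z -> link a b x z.
Proof. exact: connect_trans. Qed.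

Lemma link1l a b x : link a b x (a x).
Proof. by apply: connect1; rewrite eqxx. Qed.

Lemma link1r a b x : link a b x (b x).
Proof. by apply: connect1; rewrite eqxx orbT. Qed.

Lemma link_iterl a b n x : link a b x (iter n a x).
Proof. by elim: n => [|n IH] /=; [exact: link_refl|exact: link_trans IH (link1l _ _ _)]. Qed.

Lemma link_iterr a b n x : link a b x (iter n b x).
Proof. by elim: n => [|n IH] /=; [exact: link_refl|exact: link_trans IH (link1r _ _ _)]. Qed.

Lemma perm_iterK a x : exists n, iter n a (a x) = x.
Proof.
exists (#[a]%g).-1; rewrite -iterSr prednK ?order_gt0 // -permX.
by rewrite expg_order perm1.
Qed.

(** A permutation of a finite set returns to its starting point, so a step can be undone by going on
    forwards. *)
Lemma link_sym a b x y : link a b x y = link a b y x.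
Proof.
suff H : forall u v, link a b u v -> link a b v u by apply/idP/idP; apply: H.
move=> u v /connectP[p]; elim: p u => [|w p IH] u /= => [_ ->|]; first exact: link_refl.
case/andP=> /orP[]/eqP <- pp ev; apply: link_trans (IH _ pp ev) _.
  by have [m em] := perm_iterK a u; rewrite -{2}em; apply: link_iterl.
by have [m em] := perm_iterK b u; rewrite -{2}em; apply: link_iterr.
Qed.

Lemma link_porbitl a b x y : y \in porbit a x -> link a b x y.
Proof. by move=> /porbitP[n ->]; rewrite permX; apply: link_iterl. Qed.

Lemma link_porbitr a b x y : y \in porbit b x -> link a b x y.
Proof. by move=> /porbitP[n ->]; rewrite permX; apply: link_iterr. Qed.

Lemma link_porbitM a b x y : y \in porbit (b * a)%g x -> link a b x y.
Proof.
move=> /porbitP[n ->]; rewrite permX; elim: n => [|n IH] /=; first exact: link_refl.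
apply: link_trans IH _; rewrite permM.
exact: link_trans (link1r _ _ _) (link1l _ _ _).
Qed.

Lemma link_sub a b a' b' :
  (forall z, link a' b' z (a z)) -> (forall z, link a' b' z (b z)) ->
  forall x y, link a b x y -> link a' b' x y.
Proof. by move=> ha hb; apply: connect_sub => u v /orP[]/eqP <-; [exact: ha|exact: hb]. Qed.

Lemma comp_eq a b x y : (comp a b x == comp a b y) = link a b x y.
Proof.
apply/eqP/idP => [/setP/(_ y)|h]; first by rewrite !inE link_refl.
apply/setP => z; rewrite !inE; apply/idP/idP; apply: link_trans => //.
by rewrite link_sym.
Qed.

Lemma ncc_mono a b a' b' :
  (forall z, link a' b' z (a z)) -> (forall z, link a' b' z (b z)) ->
  ncc a' b' <= ncc a b.
Proof.
move=> ha hb; rewrite /ncc; apply: leq_imset_card_factor => x y _ _ /eqP; rewrite comp_eq => h.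
by apply/eqP; rewrite comp_eq; apply: (link_sub ha hb).
Qed.

(* The hypotheses say that the two maps differ by joining x and y. *)
Lemma ncc_add1 a b a' b' x y :
  (forall z, link a' b' z (a z) \/ [\/ link a' b' z x /\ link a' b' (a z) y | link a' b' z y /\ link a' b' (a z) x]) ->
  (forall z, link a' b' z (b z) \/ [\/ link a' b' z x /\ link a' b' (b z) y | link a' b' z y /\ link a' b' (b z) x]) ->
  ncc a' b' <= (ncc a b).+1.
Proof.
move=> ha hb; rewrite /ncc.
set A := [set z | ~~ link a' b' z y].
(* Two darts outside the class of [y] whose old link is lost would both lie in the class of [x],
   where they are linked anyway; so only the class of [y] can be additional. *)
have key u v : link a b u v -> link a' b' u v \/
   (link a' b' u x \/ link a' b' u y) /\ (link a' b' v x \/ link a' b' v y).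
  case/connectP=> p; elim: p u => [|w p IH] u /= => [_ ->|]; first by left; exact: link_refl.
  case/andP=> e pp ev; have {pp ev} := IH _ pp ev.
  have : link a' b' u w \/ [\/ link a' b' u x /\ link a' b' w y | link a' b' u y /\ link a' b' w x].
    by case/orP: e => /eqP <-.
  case=> [uw [wv|[wxy vxy]]|uw wv].
  - by left; apply: link_trans uw wv.
  - by right; split=> //; case: wxy => h; [left|right]; apply: link_trans uw h.
  - right; split; first by case: uw => [] [-> _]; [left|right].
    case: wv => [wv|[_]] //; rewrite link_sym in wv.
    by case: uw => [] [_ h]; [right|left]; apply: link_trans wv h.
have sub : comp a' b' @: [set: T] \subset comp a' b' y |: (comp a' b' @: A).
  apply/subsetP => _ /imsetP[z _ ->]; rewrite !inE comp_eq.
  by case: (boolP (link a' b' z y)) => //= zy; apply/imsetP; exists z; rewrite ?inE.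
apply: leq_trans (subset_leq_card sub) _.
apply: leq_trans (leq_card_setU _ _) _; rewrite cards1 add1n ltnS.
apply: leq_trans (_ : #|comp a b @: A| <= _); last by apply/subset_leq_card/imsetS/subsetT.
apply: leq_imset_card_factor => u v; rewrite !inE => nu nv /eqP; rewrite comp_eq => /key h.
apply/eqP; rewrite comp_eq; case: h => // -[[hu|hu] [hv|hv]]; rewrite ?hu ?hv // in nu nv *.
by apply: link_trans hu _; rewrite link_sym.
Qed.

(** After the merger the class of [y] is represented by [x], so the darts that were not linked to
    [y] still meet every component. *)
Lemma ncc_merge a b a' b' x y :
  (forall z, link a' b' z (a z)) -> (forall z, link a' b' z (b z)) ->
  link a' b' x y -> ~~ link a b x y -> (ncc a' b').+1 <= ncc a b.
Proof.
move=> ha hb xy nxy; set A := [set z | ~~ link a b z y].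
have n1 : comp a b y \notin comp a b @: A.
  apply/imsetP => -[z]; rewrite inE => nz /eqP; rewrite comp_eq link_sym => h.
  by rewrite h in nz.
have sub : comp a b y |: (comp a b @: A) \subset comp a b @: [set: T].
  by rewrite subUset imsetS ?subsetT // sub1set imset_f.
apply: leq_trans (subset_leq_card sub); rewrite cardsU1 n1 add1n ltnS.
apply: leq_trans (_ : #|comp a' b' @: A| <= _); last first.
  apply: leq_imset_card_factor => u v _ _ /eqP; rewrite comp_eq => h.
  by apply/eqP; rewrite comp_eq; apply: (link_sub ha hb).
apply/subset_leq_card/subsetP => _ /imsetP[z _ ->].
case: (boolP (link a b z y)) => zy; last by apply: imset_f; rewrite inE.
have -> : comp a' b' z = comp a' b' x.
  apply/eqP; rewrite comp_eq link_sym; apply: link_trans xy _.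
  by apply: (link_sub ha hb); rewrite link_sym.
by apply: imset_f; rewrite inE.
Qed.

Lemma porbits_split a x y : x != y -> y \in porbit a x ->
  #|porbits (tperm x y * a)%g| = #|porbits a|.+1.
Proof.
move=> nxy yx; have /= := porbits_mul_tperm a x y; rewrite porbit_sym yx nxy /= addn0 addn1.
exact.
Qed.

Lemma porbits_merge a x y : y \notin porbit a x ->
  (#|porbits (tperm x y * a)%g|).+1 = #|porbits a|.
Proof.
move=> yx; have /= := porbits_mul_tperm a x y.
have nxy : x != y by apply: contraNneq yx => <-; apply: porbit_id.
by rewrite porbit_sym yx nxy /= addn1 addn2 => -[].
Qed.

Lemma porbits_tperm_le a x y : #|porbits a| <= (#|porbits (tperm x y * a)%g|).+1.
Proof.
have /= := porbits_mul_tperm a x y; move: #|porbits a| #|porbits _| => p q.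
have [->|_] := eqVneq x y; first by rewrite porbit_id /=; lia.
by case: (_ \notin _) => /=; lia.
Qed.

(* If the move disconnects u from v, then multiplying by (u v) splits a cycle of c, which pays for the new component. *)
Lemma ncc_tperm_bound a b a' b' (c c' : {perm T}) u v :
  (forall z, link a' b' z (a z) \/ [\/ link a' b' z u /\ link a' b' (a z) v | link a' b' z v /\ link a' b' (a z) u]) ->
  (forall z, link a' b' z (b z) \/ [\/ link a' b' z u /\ link a' b' (b z) v | link a' b' z v /\ link a' b' (b z) u]) ->
  c' = (tperm u v * c)%g -> (v \in porbit c' u -> link a' b' u v) ->
  2 * ncc a' b' + #|porbits c| <= 2 * ncc a b + #|porbits c'|.+1.
Proof.
move=> ha hb ec hl; case: (boolP (link a' b' u v)) => uv.
  have vu : link a' b' v u by rewrite link_sym.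
  have h : ncc a' b' <= ncc a b.
    apply: ncc_mono => z; [case: (ha z)|case: (hb z)] => // -[] [h1 h2];
      apply: link_trans h1 _; (apply: link_trans; last by rewrite link_sym; exact: h2); done.
  have := porbits_tperm_le c u v; rewrite -ec; move: #|_| #|_| => p q; lia.
have h := ncc_add1 ha hb.
have nu : v \notin porbit c' u by apply: contra uv.
have := porbits_merge nu; rewrite ec mulgA tperm2 mul1g -ec; move: #|_| #|_| => p q; lia.
Qed.
End Planar.

(** * Surgery on planar maps *)

Section Moves.
Variable T : finType.
Implicit Types (a b : {perm T}) (x y z : T).

Definition nch a b := #|porbits a| + #|porbits b| + #|porbits (b * a)%g|.

(** The genus does not grow: the cycle gained by [a] makes up for one possibly lost in the product,
    where the transposition reappears conjugated by [b]; if a component falls apart, the product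
    gains a cycle as well. *)
Lemma split_defect a b x y : x != y -> y \in porbit a x ->
  nch a b + 2 * ncc (tperm x y * a)%g b <= nch (tperm x y * a)%g b + 2 * ncc a b.
Proof.
move=> nxy yx; rewrite /nch porbits_split //.
have ec : (b * (tperm x y * a) = tperm (b^-1 x) (b^-1 y) * (b * a))%g.
  by rewrite -tpermJ /conjg invgK !mulgA mulgKV.
set a' := (tperm x y * a)%g.
have l z : link a' b z (b^-1%g z).
  by rewrite link_sym -{2}(permKV b z); exact: link1r.
have := @ncc_tperm_bound T a b a' b _ _ _ _ _ _ ec.
have h1 z : link a' b z (a z) \/
    (link a' b z (b^-1%g x) /\ link a' b (a z) (b^-1%g y) \/
     link a' b z (b^-1%g y) /\ link a' b (a z) (b^-1%g x)).
  have [->|nx] := eqVneq z x.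
    right; left; split=> //; apply: link_trans (l y).
    by rewrite link_sym -[in a x](tpermR x y) -permM; exact: link1l.
  have [->|ny] := eqVneq z y.
    right; right; split=> //; apply: link_trans (l x).
    by rewrite link_sym -[in a y](tpermL x y) -permM; exact: link1l.
  left; have -> : a z = a' z by rewrite permM tpermD // eq_sym.
  exact: link1l.
move=> /(_ h1 (fun z => or_introl (link1r _ _ z)) (@link_porbitM _ _ _ _ _)).
move: #|porbits a| #|porbits b| #|porbits (b * a)%g| #|porbits (b * a')%g| => *; lia.
Qed.

Lemma planar_split a b x y : x != y -> y \in porbit a x ->
  planar a b -> planar (tperm x y * a)%g b.
Proof. move=> nxy yx; have := split_defect b nxy yx; rewrite /nch /planar; lia. Qed.

Lemma planar_splitr a b x y : x != y -> y \in porbit b x ->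
  planar a b -> planar a (tperm x y * b)%g.
Proof.
move=> nxy yx; rewrite /planar (porbits_split nxy yx).
set b' := (tperm x y * b)%g.
have ec : (b' * a = tperm x y * (b * a))%g by rewrite mulgA.
have := @ncc_tperm_bound T a b a b' _ _ _ _ _ _ ec.
have h1 z : link a b' z (b z) \/
    (link a b' z x /\ link a b' (b z) y \/ link a b' z y /\ link a b' (b z) x).
  have [->|nx] := eqVneq z x.
    right; left; split; first exact: link_refl.
    by rewrite link_sym -[in b x](tpermR x y) -permM; exact: link1r.
  have [->|ny] := eqVneq z y.
    right; right; split; first exact: link_refl.
    by rewrite link_sym -[in b y](tpermL x y) -permM; exact: link1r.
  left; have -> : b z = b' z by rewrite permM tpermD // eq_sym.
  exact: link1r.
move=> /(_ (fun z => or_introl (link1l _ _ z)) h1 (@link_porbitM _ _ _ _ _)).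
move: #|porbits a| #|porbits b| #|porbits (b * a)%g| #|porbits (b' * a)%g| => *; lia.
Qed.

Lemma porbits1 : #|porbits (1%g : {perm T})| = #|T|.
Proof.
rewrite /porbits card_imset ?cardsT // => x y exy.
have : y \in porbit 1%g x by rewrite exy porbit_id.
by case/porbitP => n; rewrite expg1n perm1.
Qed.

Lemma ncc1 b : ncc 1%g b = #|porbits b|.
Proof.
suff e : comp 1%g b =1 porbit b.
  rewrite /ncc (eq_imset _ e) /porbits; apply: eq_card => X.
  by apply/imsetP/imsetP => -[x _ ->]; exists x.
move=> x; apply/setP => y; rewrite inE; apply/idP/idP; last exact: link_porbitr.
case/connectP=> p; elim: p x => [|w p IH] x /= => [_ ->|]; first exact: porbit_id.
case/andP=> e pp ev; have {pp ev} := IH _ pp ev.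
case/orP: e => /eqP; rewrite ?perm1 => <- //.
by have := porbit_perm b 1 x; rewrite expg1 => ->.
Qed.

(* Every map can be cut down to isolated darts by splits, which never increase the genus. *)
Lemma genus_ge0 a b : nch a b <= #|T| + 2 * ncc a b.
Proof.
have [m] := ubnP (#|T| - #|porbits a|); elim: m a => // m IH a ltm.
have [fx|/forallPn[x nx]] := boolP [forall x, a x == x].
  have -> : a = 1%g by apply/permP => x; rewrite perm1; apply/eqP/(forallP fx).
  by rewrite /nch mulg1 porbits1 ncc1; lia.
have nxy : x != a x by rewrite eq_sym.
have yx : a x \in porbit a x by apply: (mem_porbit a 1 x).
have h := split_defect b nxy yx; have e := porbits_split nxy yx.
have le : #|porbits (tperm x (a x) * a)%g| <= #|T|.
  exact: leq_imset_card.
have := IH (tperm x (a x) * a)%g; rewrite e in le *.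
by move=> /(_ ltac:(lia)); lia.
Qed.

(** Short-circuits [x]: its predecessor is sent to its successor and [x] stays behind as a fixed
    point. *)
Definition rem a x : {perm T} := (tperm x (a^-1 x) * a)%g.

Lemma remE a x z : rem a x z = if z == x then x else if a z == x then a x else a z.
Proof.
rewrite permM; have [->|nzx] := eqVneq z x; first by rewrite tpermL permKV.
have [e|ne] := eqVneq (a z) x.
  by have -> : (a^-1 x = z)%g; [rewrite -e permK|rewrite tpermR].
rewrite tpermD // eq_sym //; apply: contraNneq ne => ->; by rewrite permKV.
Qed.

Lemma planar_rem a b x : planar a b -> planar (rem a x) b.
Proof.
rewrite /rem; have [<-|ne] := eqVneq x (a^-1%g x); first by rewrite tperm1 mul1g.
apply: planar_split => //.
by rewrite porbit_sym; apply/porbitP; exists 1; rewrite expg1 permKV.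
Qed.

(** Face permutation after deletion of the edge of [x]: exchanging the images of its two darts joins
    their faces, or cuts a common face in two, and then both darts are short-circuited. *)
Definition dela a b x : {perm T} := rem (rem (tperm x (b x) * a)%g x) (b x).
Definition delb b x : {perm T} := (tperm x (b x) * b)%g.

Lemma delbE b x z : b (b x) = x -> delb b x z = if (z == x) || (z == b x) then z else b z.
Proof.
move=> bb; rewrite permM; case: (eqVneq z x) => [->|nx] /=; first by rewrite tpermL.
by case: (eqVneq z (b x)) => [->|ny]; [rewrite tpermR|rewrite tpermD // eq_sym].
Qed.

(** The transposition commutes with [b] and multiplies both factors, so it cancels in the product:
    until the two darts are dropped the vertices are untouched, and only faces, edges and components
    are compared. *)
Lemma planar_del a b x : b x != x -> b (b x) = x ->
  planar a b -> planar (dela a b x) (delb b x).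
Proof.
move=> nx bb pl; do 2!apply: planar_rem; move: pl; rewrite /planar /delb.
have nx' : x != b x by rewrite eq_sym.
have bx : b x \in porbit b x by apply: (mem_porbit b 1 x).
rewrite (porbits_split nx' bx).
set t := tperm x (b x).
have tb : (t * b = b * t)%g.
  by rewrite conjgC /t tpermJ bb tpermC.
have ecc : (t * b * (t * a) = b * a)%g by rewrite tb -mulgA (mulgA t) tperm2 mul1g.
rewrite ecc; set a' := (t * a)%g; set b' := (t * b)%g.
have := @ncc_tperm_bound T a b a' b' a a' x (b x) _ _ erefl (@link_porbitl _ _ _ _ _).
have h1 z : link a' b' z (a z) \/
    (link a' b' z x /\ link a' b' (a z) (b x) \/ link a' b' z (b x) /\ link a' b' (a z) x).
  have [->|nzx] := eqVneq z x.
    right; left; split; first exact: link_refl.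
    by rewrite link_sym -[in a x](tpermR x (b x)) -permM; exact: link1l.
  have [->|ny] := eqVneq z (b x).
    right; right; split; first exact: link_refl.
    by rewrite link_sym -[in a (b x)](tpermL x (b x)) -permM; exact: link1l.
  left; have -> : a z = a' z by rewrite permM tpermD // eq_sym.
  exact: link1l.
have h2 z : link a' b' z (b z) \/
    (link a' b' z x /\ link a' b' (b z) (b x) \/ link a' b' z (b x) /\ link a' b' (b z) x).
  have [->|nzx] := eqVneq z x; first by right; left; split; exact: link_refl.
  have [->|ny] := eqVneq z (b x); first by right; right; rewrite bb; split; exact: link_refl.
  left; have -> : b z = b' z by rewrite permM tpermD // eq_sym.
  exact: link1r.
move=> /(_ h1 h2).
move: #|porbits a| #|porbits b| #|porbits a'| #|porbits (b * a)%g| => *; lia.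
Qed.

Lemma planar_remr a b x : planar a b -> planar a (rem b x).
Proof.
rewrite /rem; have [<-|ne] := eqVneq x (b^-1%g x); first by rewrite tperm1 mul1g.
apply: planar_splitr => //.
by rewrite porbit_sym; apply/porbitP; exists 1; rewrite expg1 permKV.
Qed.

(** The darts outside [K] are dropped one at a time. [P] is left abstract so that the lemma serves
    both permutations of a map. *)
Lemma rem_restrict (P : {perm T} -> Prop) (K : {set T}) a :
  (forall c x, P c -> P (rem c x)) -> (forall x, (a x \in K) = (x \in K)) -> P a ->
  exists c, [/\ P c, {in K, c =1 a} & forall x, x \notin K -> c x = x].
Proof.
move=> Prem Ka Pa.
suff [c [Pc Kc fc]] : exists c, [/\ P c, {in K, c =1 a} & forall x, x \in enum (~: K) -> c x = x].
  by exists c; split=> // x nx; apply: fc; rewrite mem_enum inE.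
have : {subset enum (~: K) <= ~: K} by move=> x; rewrite mem_enum.
elim: (enum _) => [|x s IH] sub; first by exists a.
have [|c [Pc Kc fc]] := IH; first by move=> z zs; apply: sub; rewrite inE zs orbT.
exists (rem c x); have nx : x \notin K by have := sub x (mem_head _ _); rewrite inE.
split; first exact: Prem.
  move=> z zK; rewrite remE Kc //.
  by rewrite !ifN //; apply: contraNneq nx => <-; rewrite ?Ka.
move=> z; rewrite inE remE; case: (eqVneq z x) => [->|nzx] //= zs.
by rewrite fc // (negPf nzx).
Qed.

Lemma planar_restrict (K : {set T}) a b :
  (forall x, (a x \in K) = (x \in K)) -> (forall x, (b x \in K) = (x \in K)) ->
  planar a b -> exists a' b', [/\ planar a' b', {in K, a' =1 a}, {in K, b' =1 b} &
    forall x, x \notin K -> a' x = x /\ b' x = x].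
Proof.
move=> Ka Kb pl.
have [|a' [pl' a'K a'N]] := rem_restrict (P := fun c => planar c b) _ Ka pl; first by move=> *; apply: planar_rem.
have [|b' [pl'' b'K b'N]] := rem_restrict (P := planar a') _ Kb pl'; first by move=> *; apply: planar_remr.
by exists a', b'; split=> // x nx; rewrite a'N ?b'N.
Qed.

Lemma porbit_fixed a x : a x = x -> porbit a x = [set x].
Proof.
move=> fx; apply/setP => y; rewrite inE; apply/idP/eqP => [/porbitP[n ->]|->].
  by rewrite permX; elim: n => //= n ->.
exact: porbit_id.
Qed.

Lemma porbits_merge_fixed a x y : x != y -> a y = y ->
  (#|porbits (tperm x y * a)%g|).+1 = #|porbits a|.
Proof.
by move=> nxy fy; apply: porbits_merge; rewrite porbit_sym (porbit_fixed fy) inE.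
Qed.

(** The isolated dart [y] was a cycle of [a], a cycle of the product and a component. Two cycles are
    lost, and the lost component counts twice. *)
Lemma planar_attach a b x y : x != y -> a y = y -> b y = y ->
  planar a b -> planar (tperm x y * a)%g b.
Proof.
move=> nxy ay by_; rewrite /planar.
have e1 := porbits_merge_fixed nxy ay.
have ec : (b * (tperm x y * a) = tperm (b^-1 x) y * (b * a))%g.
  have {2}-> : y = (b^-1)%g y by rewrite -{2}by_ permK.
  by rewrite -tpermJ /conjg invgK !mulgA mulgKV.
have e2 : (#|porbits (b * (tperm x y * a))%g|).+1 = #|porbits (b * a)%g|.
  rewrite ec; apply: porbits_merge_fixed; last by rewrite permM by_.
  by apply: contraNneq nxy => e; rewrite -(permKV b x) e by_.
set a' := (tperm x y * a)%g in e1 e2 *.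
have a'x : a' x = y by rewrite permM tpermL.
have a'y : a' y = a x by rewrite permM tpermR.
have e3 : (ncc a' b).+1 <= ncc a b.
  apply: (@ncc_merge _ _ _ _ _ x y) => [z|z||]; last 1 first.
  - rewrite link_sym; apply/negP => /connectP[p]; elim: p => [_ /= e|z p IH] /=.
      by rewrite e eqxx in nxy.
    by rewrite ay by_ orbb => /andP[/eqP <-]; exact: IH.
  - have [->|nx] := eqVneq z x.
      by apply: link_trans (link1l _ _ _) _; rewrite a'x -a'y; exact: link1l.
    have [->|ny] := eqVneq z y; first by rewrite ay; exact: link_refl.
    have -> : a z = a' z by rewrite permM tpermD // eq_sym.
    exact: link1l.
  - exact: link1r.
  - by rewrite -a'x; exact: link1l.
by move: e1 e2 e3; move: #|porbits a| #|porbits b| #|porbits (b * a)%g| #|porbits a'| #|porbits (b * a')%g| (ncc _ _) (ncc _ _) => *; lia.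
Qed.

(** The cycle lost by [b] is regained by the product, where [y] follows [x] and the transposition
    splits their common cycle. *)
Lemma planar_join a b x y : x != y -> b x = x -> b y = y -> a x = y ->
  planar a b -> planar a (tperm x y * b)%g.
Proof.
move=> nxy bx by_ axy; rewrite /planar -mulgA.
have e1 := porbits_merge_fixed nxy by_.
have e2 : #|porbits (tperm x y * (b * a))%g| = #|porbits (b * a)%g|.+1.
  by apply: porbits_split => //; apply/porbitP; exists 1; rewrite expg1 permM bx axy.
have e3 : ncc a (tperm x y * b)%g <= ncc a b.
  apply: ncc_mono => z; first exact: link1l.
  have [->|nx] := eqVneq z x; first by rewrite bx; exact: link_refl.
  have [->|ny] := eqVneq z y; first by rewrite by_; exact: link_refl.
  have -> : b z = (tperm x y * b)%g z by rewrite permM tpermD // eq_sym.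
  exact: link1r.
rewrite e2; move: e1 e3; move: #|porbits a| #|porbits b| #|porbits (b * a)%g| #|porbits _| (ncc _ _) (ncc _ _) => *; lia.
Qed.
End Moves.

Lemma sum_porbit (T : finType) (s : {perm T}) x (F : T -> nat) :
  \sum_(y in porbit s x) F y = \sum_(0 <= i < #|porbit s x|) F (iter i s x).
Proof.
rewrite (eq_bigl (mem (traject s x #|porbit s x|))); last by move=> y; rewrite porbit_traject.
rewrite -big_uniq ?uniq_traject_porbit //=.
elim: #|_| => [|n IH]; first by rewrite big_nil big_geq.
by rewrite trajectSr big_rcons /= IH big_nat_recr // addnC.
Qed.

Lemma sum_porbits (T : finType) (s : {perm T}) (F : T -> nat) :
  \sum_x F x = \sum_(X in porbits s) \sum_(y in X) F y.
Proof.
rewrite (partition_big (porbit s) (mem (porbits s))) /=; last by move=> x _; apply: imset_f.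
apply: eq_bigr => X /imsetP[x _ ->]; apply: eq_bigl => y.
by rewrite eq_porbit_mem.
Qed.

Lemma porbit_perm1 (T : finType) (s : {perm T}) x : porbit s (s x) = porbit s x.
Proof. by have := porbit_perm s 1 x; rewrite expg1. Qed.

Lemma sum_porbit_shift (T : finType) (s : {perm T}) x (F : T -> nat) :
  \sum_(y in porbit s x) F (s y) = \sum_(y in porbit s x) F y.
Proof.
rewrite [RHS](reindex_inj (@perm_inj _ s)) /=; apply: eq_bigl => y.
by rewrite -!eq_porbit_mem porbit_perm1.
Qed.

(** * Curvature *)

Section Vertex.
Variables (T : finType) (nu : {perm T}) (O Q : {set T}).
Hypothesis QO : Q \subset O.

(* Gauss-Bonnet in units where a vertex or a face counts 12 and a dart -6: each corner transfers its cost from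
   its face to its vertex, so that a face of cost at least 12 and an inner vertex of degree at least 3 become
   nonpositively curved. *)
Definition corner_cost y : nat :=
  let p := (nu^-1)%g y in
  if y \in O then 0 else
  if (nu y == p) && (p \notin Q) then 0 else
  if (p \in O) && (nu y \in O) then 6 else
  if (p \in O) || (nu y \in O) then 3 else 2.

(** Such a boundary vertex has curvature to spare, so there are few of them. Elsewhere two
    neighbouring boundary faces share an arc, which is what links flat faces into chains. *)
Definition crowded y : bool :=
  [&& y \in O, 4 <= #|porbit nu y|, nu y \notin O & nu (nu y) \notin O].

Variable d : T.
Hypothesis fixQ : nu d = d -> d \in Q.

Let k := #|porbit nu d|.

Let card_iter i : #|porbit nu (iter i nu d)| = k.
Proof. by elim: i => //= i IH; rewrite porbit_perm1. Qed.

Let crowdedE i : crowded (iter i nu d) =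
  [&& iter i nu d \in O, 4 <= k, iter i.+1 nu d \notin O & iter i.+2 nu d \notin O].
Proof. by rewrite /crowded card_iter. Qed.

Let F y := corner_cost y + crowded y.

Let sumF : \sum_(y in porbit nu d) F y = \sum_(0 <= i < k) F (iter i nu d).
Proof. exact: sum_porbit. Qed.

Let uniq_small : uniq (traject nu d k). Proof. exact: uniq_traject_porbit. Qed.

Lemma vertex_small : k <= 4 ->
  12 + \sum_(y in porbit nu d) F y <= 6 * k + 6 * \sum_(y in porbit nu d) (y \in Q).
Proof.
move=> k4; rewrite sumF sum_porbit -/k.
have kd : iter k nu d = d by apply: iter_porbit.
have QOP y : y \in Q -> y \in O by move/(subsetP QO).
have k0 : 0 < k by rewrite /k (cardD1 d) porbit_id.
have un := uniq_small.
have inv y z : nu y = z -> (nu^-1)%g z = y by move=> <-; rewrite permK.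
have c0 := crowdedE 0; have c1 := crowdedE 1; have c2 := crowdedE 2; have c3 := crowdedE 3.
rewrite /= in c0 c1 c2 c3.
case ek : k k4 k0 kd un c0 c1 c2 c3 => [|[|[|[|[|//]]]]] //= _ _ kd un c0 c1 c2 c3.
(* Degree one: the tip of a spur must be marked, and the mark pays the missing 6. *)
- rewrite !big_nat1 /= /F /corner_cost /crowded.
  have dQ : d \in Q by apply: fixQ.
  by rewrite (QOP _ dQ) dQ /= -/k ek.
- rewrite !big_nat_recr //= !big_geq // /F /corner_cost c0 c1 ?ek /=.
  rewrite (inv _ _ kd) (inv d (nu d)) // kd eqxx /=.
  have := QOP d; have := QOP (nu d); clear.
  case: (d \in O); case: (d \in Q); case: (nu d \in O); case: (nu d \in Q); rewrite ?eqxx ?andbF //=;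
    by [move/(_ isT)|move=> _ /(_ isT)].
- rewrite !big_nat_recr //= !big_geq // /F /corner_cost c0 c1 c2 ?ek /=.
  rewrite (inv _ _ kd) (inv d (nu d)) // (inv (nu d) (nu (nu d))) // kd.
  have [e1 e2 e3] : [/\ nu d != nu (nu d), nu (nu d) != d & d != nu d].
    by move: un; rewrite !inE !negb_or -!andbA => /and4P[h1 h2 h3 _]; rewrite eq_sym in h2; split.
  rewrite (negPf e1) (negPf e2) (negPf e3) /=; move: e1 e2 e3 => _ _ _.
  by case: (d \in O); case: (nu d \in O); case: (nu (nu d) \in O).
- rewrite !big_nat_recr //= !big_geq // /F /corner_cost c0 c1 c2 c3 ?ek /=.
  rewrite (inv _ _ kd) (inv d (nu d)) // (inv (nu d) (nu (nu d))) // (inv (nu (nu d)) (nu (nu (nu d)))) // kd.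
  have [e1 e2 e3 e4] : [/\ nu d != nu (nu (nu d)), nu (nu d) != d, nu (nu (nu d)) != nu d & d != nu (nu d)].
    move: un; rewrite !inE !negb_or -!andbA => /and5P[h1 h2 h3 h4 /andP[h5 _]].
    by split=> //; rewrite eq_sym.
  rewrite (negPf e1) (negPf e2) (negPf e3) (negPf e4) /=; move: e1 e2 e3 e4 => _ _ _ _.
  by case: (d \in O); case: (nu d \in O); case: (nu (nu d) \in O); case: (nu (nu (nu d)) \in O).
Qed.

(** With [i] inner and [o] outer corners the charge is at most [2 * k] plus three times the smaller
    of [i] and [o], hence at most [7 * k / 2]; the remaining [5 * k / 2] exceeds 12 from degree five
    on. *)
Lemma vertex_large : 5 <= k -> 12 + \sum_(y in porbit nu d) F y <= 6 * k.
Proof.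
move=> k5.
pose o := \sum_(y in porbit nu d) (y \in O).
pose i := \sum_(y in porbit nu d) (y \notin O).
pose B := \sum_(y in porbit nu d) ((y \notin O) && ((nu^-1)%g y \in O) && (nu y \in O)).
pose C := \sum_(y in porbit nu d) crowded y.
have eo : o + i = k.
  rewrite /k -sum1_card -big_split /=; apply: eq_bigr => y _; by case: (y \in O).
have or : \sum_(y in porbit nu d) (nu y \in O) = o by rewrite (sum_porbit_shift nu d (fun y => (y \in O) : nat)).
have ol : \sum_(y in porbit nu d) ((nu^-1)%g y \in O) = o.
  rewrite -(sum_porbit_shift nu d (fun y => ((nu^-1)%g y \in O) : nat)).
  by apply: eq_bigr => y _; rewrite permK.
have ir : \sum_(y in porbit nu d) (nu y \notin O) = i by rewrite (sum_porbit_shift nu d (fun y => (y \notin O) : nat)).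
have Bi : B <= i by apply: leq_sum => y _; case: (y \notin O) => //=; apply: leq_b1.
have Bo : B <= o by rewrite -or; apply: leq_sum => y _; case: (nu y \in O); rewrite ?andbF ?andbT //; apply: leq_b1.
have Co : C <= o by apply: leq_sum => y _; rewrite /crowded; case: (y \in O) => //=; apply: leq_b1.
have Ci : C <= i by rewrite -ir; apply: leq_sum => y _; rewrite /crowded; case: (nu y \notin O); rewrite ?andbF //; apply: leq_b1.
have : \sum_(y in porbit nu d) F y <= 2 * i + o + o + 2 * B + C.
  rewrite -{1}ol -or !big_distrr /= -!big_split /=; apply: leq_sum => y _.
  rewrite /F leq_add2r /corner_cost.
  by case: (y \in O) => //=; case: ifP => //= _; case: ((nu^-1)%g y \in O); case: (nu y \in O).
move: k5; rewrite -eo; clear -Bi Bo Co Ci; move: o i B C Bi Bo Co Ci => o i B C *; lia.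
Qed.

Lemma vertex_bound :
  12 + \sum_(y in porbit nu d) F y <= 6 * k + 6 * \sum_(y in porbit nu d) (y \in Q).
Proof.
have [k4|k5] := leqP k 4; first exact: vertex_small.
by apply: leq_trans (vertex_large k5) _; apply: leq_addr.
Qed.
End Vertex.

Lemma sum_mull (I : finType) (P : pred I) (F : I -> nat) c :
  \sum_(i | P i) c * F i = c * \sum_(i | P i) F i.
Proof. by rewrite big_distrr. Qed.

Section Curvature.
Variables (T : finType) (phi eps : {perm T}) (o : T) (Q : {set T}).

Definition outer : {set T} := porbit phi o.
Definition ext x := eps x \in outer.
(** The arc through [x] continues: the vertex after [x] has degree two and carries no mark. *)
Definition smooth x := (phi (eps (phi x)) == eps x) && (eps x \notin Q).
(** The charge of the corner between [x] and [phi x], rewritten in terms of the face so that it can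
    be summed along its darts; [cost_corner] identifies the two forms. *)
Definition cost x : nat :=
  if smooth x then 0 else if ext x && ext (phi x) then 6 else
  if ext x || ext (phi x) then 3 else 2.

Hypothesis epsK : forall x, eps (eps x) = x.
Hypothesis dead : forall x, eps x = x -> phi x = x.

Lemma outer_phi x : (phi x \in outer) = (x \in outer).
Proof. by rewrite /outer -!eq_porbit_mem porbit_perm1. Qed.

Lemma live_eps x : (eps (eps x) != eps x) = (eps x != x).
Proof. by rewrite epsK eq_sym. Qed.

Lemma live_phi x : (eps (phi x) != phi x) = (eps x != x).
Proof.
congr negb; apply/eqP/eqP => [e|e]; last by rewrite (dead e) e.
by have e1 := perm_inj (dead e); rewrite -e1 e.
Qed.

Lemma live_outer x : eps o != o -> x \in outer -> eps x != x.
Proof.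
move=> lo /porbitP[n ->]; rewrite permX; elim: n => //= n IH.
by rewrite live_phi.
Qed.

Lemma cost_corner x : x \notin outer ->
  cost x = corner_cost (eps * phi)%g outer Q (phi x).
Proof.
move=> nx; rewrite /corner_cost outer_phi (negPf nx) /cost /smooth /ext !permM outer_phi.
suff -> : ((eps * phi)^-1)%g (phi x) = eps x by [].
by apply: (@perm_inj _ (eps * phi)%g); rewrite permKV permM epsK.
Qed.

Hypothesis pl : planar phi eps.
Hypothesis live_o : eps o != o.
Hypothesis QO : Q \subset outer.
Hypothesis inner_spur : forall x, eps x != x -> x \notin outer -> phi x != eps x.
Hypothesis outer_spur : forall x, x \in outer -> phi (eps x) = x -> x \in Q.

Variable w : T -> nat.
Hypothesis face : forall x, eps x != x -> x \notin outer ->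
  48 + \sum_(y in porbit phi x) w y <= 4 * \sum_(y in porbit phi x) cost y.

Notation nu := (eps * phi)%g.
Notation live x := (eps x != x).

Lemma live_porbit_phi x y : y \in porbit phi x -> live y = live x.
Proof. by move=> /porbitP[n ->]; rewrite permX; elim: n => //= n IH; rewrite live_phi. Qed.

Lemma live_porbit_nu x y : y \in porbit nu x -> live y = live x.
Proof.
by move=> /porbitP[n ->]; rewrite permX; elim: n => //= n IH; rewrite permM live_phi live_eps.
Qed.

Lemma outer_porbit x y : y \in porbit phi x -> (y \in outer) = (x \in outer).
Proof. by move=> /porbitP[n ->]; rewrite permX; elim: n => //= n IH; rewrite outer_phi. Qed.

Lemma fixed_porbit (s : {perm T}) x : s x = x -> porbit s x = [set x].
Proof.
move=> fx; apply/setP => y; rewrite inE; apply/idP/eqP => [/porbitP[n ->]|->].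
  by rewrite permX; elim: n => //= n ->.
exact: porbit_id.
Qed.

Let L := #|[set x | live x]|.
Let D := #|[set x | ~~ live x]|.

Let sum_live c : \sum_x (if live x then c else 0) = c * L.
Proof. by rewrite -big_mkcond /= sum_nat_const /L cardsE mulnC. Qed.

Let sum_dead c : \sum_x (if live x then 0 else c) = c * D.
Proof.
rewrite (eq_bigr (fun x => if ~~ live x then c else 0)); last by move=> x _; case: ifP.
by rewrite -big_mkcond /= sum_nat_const /D cardsE mulnC.
Qed.

Let vertices : 12 * #|porbits nu| + \sum_x (if live x then corner_cost nu outer Q x + crowded nu outer x else 0)
  <= 6 * L + 12 * D + 6 * #|Q|.
Proof.
have -> : 6 * L + 12 * D + 6 * #|Q| =
    \sum_x ((if live x then 6 else 0) + (if live x then 0 else 12) + (if x \in Q then 6 else 0)).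
  rewrite !big_split /= sum_live sum_dead; congr (_ + _).
  by rewrite -big_mkcond sum_nat_const mulnC.
rewrite !(sum_porbits nu) mulnC -sum_nat_const -big_split /=.
apply: leq_sum => X /imsetP[x _ ->].
have [lx|dx] := boolP (live x); last first.
  have fx : nu x = x by move/negPn/eqP: dx => dx; rewrite permM dx dead.
  by rewrite fixed_porbit // !big_set1 /= (negPf dx); lia.
rewrite !big_split /= /=.
rewrite [X in _ <= _ + X](eq_bigr (fun y => 6 * (y \in Q))); last by move=> y _; case: ifP.
rewrite sum_mull.
rewrite (eq_bigr (fun y => corner_cost nu outer Q y + crowded nu outer y)); last first.
  by move=> y /live_porbit_nu ->; rewrite lx.
rewrite [X in _ <= X + _ + _](eq_bigr (fun=> 6)); last first.
  by move=> y /live_porbit_nu ->; rewrite lx.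
rewrite [X in _ <= _ + X + _](eq_bigr (fun=> 0)); last first.
  by move=> y /live_porbit_nu ->; rewrite lx.
rewrite sum_nat_const big1_eq addn0 [#|_| * 6]mulnC.
refine (vertex_bound QO _) => fx.
have [xO|nxO] := boolP (x \in outer); first by apply: outer_spur => //; rewrite -permM.
have := @inner_spur (eps x); rewrite live_eps epsK -[phi (eps x)]permM fx eqxx.
by move=> /(_ lx) h; case: (negP (h _)); last by [];
   apply: contra nxO; rewrite -outer_phi -permM fx.
Qed.

Let edges : 12 * #|porbits eps| <= 6 * L + 12 * D.
Proof.
rewrite -sum_live -sum_dead -big_split /= (sum_porbits eps) mulnC -sum_nat_const.
apply: leq_sum => X /imsetP[x _ ->].
have [lx|dx] := boolP (live x); last first.
  by rewrite fixed_porbit ?big_set1 ?(negPf dx) //; apply/eqP; rewrite -[_ == _]negbK.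
have ex : eps x \in porbit eps x by apply: (mem_porbit eps 1 x).
rewrite (bigD1 x) ?porbit_id //= (bigD1 (eps x)) /=; last by rewrite ex.
by rewrite live_eps lx; lia.
Qed.

Let faces : 48 * #|porbits phi| + \sum_(x | live x && (x \notin outer)) w x
   <= 4 * (\sum_(x | live x && (x \notin outer)) cost x) + 48 * D + 48.
Proof.
have -> : 4 * (\sum_(x | live x && (x \notin outer)) cost x) + 48 * D + 48 =
  \sum_x ((if live x && (x \notin outer) then 4 * cost x else 0) + (if live x then 0 else 48) + (if x == o then 48 else 0)).
  rewrite !big_split /= sum_dead -big_mkcond; congr (_ + _ + _).
    by rewrite -sum_mull big_mkcond.
  by rewrite (bigD1 o) //= eqxx big1 // => x /negPf ->.
rewrite big_mkcond !(sum_porbits phi) mulnC -sum_nat_const -big_split /=.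
apply: leq_sum => X /imsetP[x _ ->].
have [lx|dx] := boolP (live x); last first.
  have fx : phi x = x by apply: dead; apply/eqP; rewrite -[_ == _]negbK.
  by rewrite fixed_porbit // !big_set1 (negPf dx) /=; lia.
have [xO|nxO] := boolP (x \in outer).
  rewrite big1; last by move=> y /outer_porbit ->; rewrite xO andbF.
  have ox : o \in porbit phi x by rewrite porbit_sym.
  by rewrite (bigD1 o) //= eqxx; lia.
rewrite (eq_bigr w); last by move=> y yx; rewrite (live_porbit_phi yx) (outer_porbit yx) lx nxO.
apply: leq_trans (face lx nxO) _; rewrite -sum_mull; apply: leq_sum => y yx.
by rewrite (live_porbit_phi yx) (outer_porbit yx) lx nxO -addnA leq_addr.
Qed.

(** Every dead dart is a component by itself, and the live dart [o] lies in yet another one. *)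
Let components : D.+1 <= ncc phi eps.
Proof.
pose A := o |: [set x | ~~ live x].
have -> : D.+1 = #|A| by rewrite cardsU1 inE live_o.
have fixd x : ~~ live x -> forall y, link phi eps x y -> y = x.
  move=> /negPn/eqP dx y /connectP[p]; elim: p => [_ ->|z p IH] //= /andP[].
  rewrite (dead dx) dx orbb => /eqP <- ; exact: IH.
rewrite -(@card_in_imset _ _ (comp phi eps) A).
  by apply/subset_leq_card/imsetS/subsetT.
move=> x y; rewrite !inE => hx hy /eqP; rewrite comp_eq => h.
case/orP: hx => [/eqP ex|dx]; last by rewrite (fixd _ dx _ h).
case/orP: hy => [/eqP ey|dy]; first by rewrite ex ey.
by rewrite link_sym in h; rewrite (fixd _ dy _ h).
Qed.

(** Euler's formula times 48. The counts of vertices and edges are multiplied by 4, and that of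
    faces carries this factor already, so that one unit of excess cost can pay for the weights [w]
    of a face. The outer face takes 48 of the 96 of a sphere. *)
Theorem curvature_bound :
  \sum_(x | live x && (x \notin outer)) w x + 4 * (\sum_x crowded nu outer x) + 48 <= 24 * #|Q|.
Proof.
have v := vertices; have e := edges; have f := faces; have c := components.
have n : #|T| = L + D.
  by rewrite -(cardsC [set x | live x]); congr (_ + _); apply: eq_card => x; rewrite !inE.
have cr : \sum_x crowded nu outer x = \sum_x (if live x then crowded nu outer x : nat else 0).
  apply: eq_bigr => x _; case: ifP => // /negbT dx; rewrite /crowded.
  by case: (boolP (x \in outer)) => // /(live_outer live_o); rewrite (negPf dx).
have cc : \sum_(x | live x && (x \notin outer)) cost x =
          \sum_x (if live x then corner_cost nu outer Q x else 0).
  rewrite [RHS](reindex_inj (@perm_inj _ phi)) /= big_mkcond; apply: eq_bigr => x _.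
  rewrite live_phi; case: (boolP (live x)) => //= _.
  have [xO|nx] := boolP (x \in outer); last by rewrite /= cost_corner.
  by rewrite /corner_cost outer_phi xO.
have sp : \sum_x (if live x then corner_cost nu outer Q x + crowded nu outer x else 0) =
    \sum_(x | live x && (x \notin outer)) cost x + \sum_x crowded nu outer x.
  by rewrite cr cc -big_split /=; apply: eq_bigr => x _; case: ifP.
move: pl v; rewrite /planar n sp; move: e f c; clear.
move: #|porbits phi| #|porbits eps| #|porbits (eps * phi)%g| (ncc _ _) => F E V N.
move: (\sum_(_ | _) cost _) (\sum_(_ | _) w _) (\sum__ crowded _ _ _) => a b c; lia.
Qed.
End Curvature.

(** * Arcs of a face as runs of smooth darts *)

Section Runs.
Variables (T : finType) (phi : {perm T}) (sm : pred T) (x : T).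
Notation X := (porbit phi x).
Notation n := #|porbit phi x|.

Definition run_len z := find (predC sm) (traject phi z #|porbit phi z|).
Definition run_end z := iter (run_len z) phi z.

Lemma porbit_iter z k : iter k phi z \in porbit phi z.
Proof. by rewrite -permX mem_porbit. Qed.

Lemma run_lenP z : (exists2 y, y \in porbit phi z & ~~ sm y) ->
  [/\ run_len z < #|porbit phi z|, ~~ sm (run_end z) & forall i, i < run_len z -> sm (iter i phi z)].
Proof.
case=> y yz ny.
have hs : has (predC sm) (traject phi z #|porbit phi z|).
  by apply/hasP; exists y; rewrite -?porbit_traject.
have lt : run_len z < #|porbit phi z| by move: hs; rewrite has_find size_traject.
split=> //.
  by have := nth_find z hs; rewrite nth_traject.
move=> i lti; have := before_find z lti; rewrite nth_traject; last exact: ltn_trans lt.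
by move/negbFE.
Qed.

Lemma run_len_ge z a : a < #|porbit phi z| -> (forall i, i < a -> sm (iter i phi z)) -> a <= run_len z.
Proof.
move=> lta h; rewrite leqNgt; apply/negP => lt.
have hs : has (predC sm) (traject phi z #|porbit phi z|).
  by rewrite has_find size_traject; apply: ltn_trans lt _.
have := nth_find z hs; rewrite nth_traject; last exact: ltn_trans lt _.
by rewrite /= h.
Qed.

Lemma run_len0 z : ~~ sm z -> run_len z = 0.
Proof.
move=> nz; rewrite /run_len; have : 0 < #|porbit phi z| by rewrite (cardD1 z) porbit_id.
by case: #|_| => //= k _; rewrite nz.
Qed.

Hypothesis break : exists2 y, y \in X & ~~ sm y.

Let breakz z : z \in X -> exists2 y, y \in porbit phi z & ~~ sm y.
Proof. by rewrite -eq_porbit_mem => /eqP ->. Qed.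

Variable P : pred T.
Hypothesis smP : forall z, z \in X -> sm z -> P (phi z) = P z.

Lemma run_end_mem z : z \in X -> run_end z \in X.
Proof. by rewrite -!eq_porbit_mem => /eqP <-; rewrite eq_porbit_mem porbit_iter. Qed.

Lemma run_end_pred z : z \in X -> P (run_end z) = P z.
Proof.
move=> zX; have [_ _] := run_lenP (breakz zX); rewrite /run_end.
elim: (run_len z) => //= k IH h; rewrite smP ?IH //; last exact: h.
  by move=> i ik; apply: h; apply: ltnW.
by move: zX; rewrite -!eq_porbit_mem => /eqP <-; rewrite eq_porbit_mem porbit_iter.
Qed.

(** Darts with the same run end are told apart by their distance to it, so they number at most one
    more than the largest distance. *)
Lemma run_sum (B : T -> nat) :
  (forall z, z \in X -> P z -> 6 * (run_len z).+1 <= B (run_end z)) ->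
  6 * (\sum_(z in X) P z) <= \sum_(y in X | P y && ~~ sm y) B y.
Proof.
move=> hB.
have -> : 6 * (\sum_(z in X) P z) = \sum_(z in X | P z) 6.
  by rewrite -big_mkcondr /= sum1_card sum_nat_const mulnC.
rewrite (partition_big run_end (fun y => (y \in X) && (P y && ~~ sm y))) /=; last first.
  move=> z /andP[zX Pz]; have [_ -> _] := run_lenP (breakz zX).
  by rewrite run_end_mem // run_end_pred // Pz.
apply: leq_sum => y /and3P[yX Py ny].
rewrite sum_nat_const mulnC; set A := #|_|.
have [->|[z0 z0A]] : A = 0 \/ exists z, (z \in X) && P z && (run_end z == y).
- case: (pickP (fun z => (z \in X) && P z && (run_end z == y))) => [z hz|h]; first by right; exists z.
  by left; apply: eq_card0 => z; apply: h.
- by rewrite muln0.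
pose R := [set z | (z \in X) && P z && (run_end z == y)].
have z0R : z0 \in R by rewrite inE.
have [z1 z1R e1] : {z1 | z1 \in R & \max_(z in R) run_len z = run_len z1}.
  by apply: eq_bigmax_cond; apply/card_gt0P; exists z0.
have := z1R; rewrite inE => /andP[/andP[z1X Pz1] /eqP ez1].
apply: leq_trans (_ : 6 * (run_len z1).+1 <= _); last by rewrite -ez1 hB.
rewrite leq_mul2l /=; have -> : A = #|R| by apply: eq_card => z; rewrite [in RHS]inE.
have le z : z \in R -> run_len z <= run_len z1.
  by move=> zR; rewrite -e1; apply: (bigmax_sup z).
rewrite -(@card_in_imset _ _ (fun z => inord (run_len z) : 'I_(run_len z1).+1) R).
  by apply: leq_trans (max_card _) _; rewrite card_ord.
move=> u v uR vR /(congr1 val); rewrite /= !inordK ?ltnS ?le // => euv.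
move: uR vR; rewrite !inE => /andP[_ /eqP eu] /andP[_ /eqP ev].
move: eu; rewrite -ev /run_end euv; elim: (run_len v) => //= k IH /perm_inj; exact: IH.
Qed.
End Runs.

Section FaceCost.
Variables (T : finType) (phi : {perm T}) (sm e : pred T) (x : T).
Notation X := (porbit phi x).
Hypothesis sme : forall z, z \in X -> sm z -> e (phi z) = e z.

Let c y : nat := if sm y then 0 else if e y && e (phi y) then 6 else
  if e y || e (phi y) then 3 else 2.

Definition int_runs := \sum_(y in X) (~~ e y && ~~ sm y).
Definition ext_runs := \sum_(y in X) (e y && ~~ sm y).
Definition ext_int := \sum_(y in X) [&& e y, ~~ sm y & ~~ e (phi y)].

(** Around a cycle there are as many changes from exterior to interior as back, so the two kinds of
    mixed corners, of cost 3 each, can be counted together. *)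
Lemma face_cost : \sum_(y in X) c y + 2 * ext_int = 2 * int_runs + 6 * ext_runs.
Proof.
pose ie := \sum_(y in X) [&& ~~ e y, ~~ sm y & e (phi y)].
pose ee := \sum_(y in X) [&& e y, ~~ sm y & e (phi y)].
pose ii := \sum_(y in X) [&& ~~ e y, ~~ sm y & ~~ e (phi y)].
have e1 : int_runs = ii + ie.
  by rewrite -big_split; apply: eq_bigr => y _ /=; case: (e y); case: (sm y); case: (e (phi y)).
have e2 : ext_runs = ext_int + ee.
  by rewrite -big_split; apply: eq_bigr => y _ /=; case: (e y); case: (sm y); case: (e (phi y)).
have e3 : ext_int = ie.
  have : \sum_(y in X) (e (phi y)) = \sum_(y in X) (e y) by rewrite (sum_porbit_shift phi x (fun y => e y : nat)).
  have -> : \sum_(y in X) (e (phi y)) = \sum_(y in X) (e y && sm y) + ie + ee.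
    rewrite -!big_split; apply: eq_bigr => y yX /=.
    by have := sme yX; case: (e y); case: (sm y); case: (e (phi y)) => // /(_ isT).
  have -> : \sum_(y in X) (e y) = \sum_(y in X) (e y && sm y) + ext_int + ee.
    rewrite -!big_split; apply: eq_bigr => y yX /=.
    by case: (e y); case: (sm y); case: (e (phi y)).
  by lia.
have e4 : \sum_(y in X) c y = 2 * ii + 3 * ie + 3 * ext_int + 6 * ee.
  rewrite -!sum_mull -!big_split; apply: eq_bigr => y yX; rewrite /c /=.
  by case: (e y); case: (sm y); case: (e (phi y)).
by rewrite e4; clearbody ii ie ee; lia.
Qed.

Lemma ext_int_le : ext_int <= ext_runs.
Proof. by apply: leq_sum => y _; case: (e y); case: (sm y); case: (e (phi y)). Qed.

Lemma ext_int_le_int : ext_int <= int_runs.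
Proof.
have -> : ext_int = \sum_(y in X) [&& ~~ e y, ~~ sm y & e (phi y)].
  have : \sum_(y in X) (e (phi y)) = \sum_(y in X) (e y) by rewrite (sum_porbit_shift phi x (fun y => e y : nat)).
  have -> : \sum_(y in X) (e (phi y)) = \sum_(y in X) (e y && e (phi y)) + \sum_(y in X) [&& ~~ e y, ~~ sm y & e (phi y)].
    rewrite -!big_split; apply: eq_bigr => y yX /=.
    by have := sme yX; case: (e y); case: (sm y); case: (e (phi y)) => // /(_ isT).
  have -> : \sum_(y in X) (e y) = \sum_(y in X) (e y && e (phi y)) + ext_int.
    rewrite -!big_split; apply: eq_bigr => y yX /=.
    by have := sme yX; case: (e y); case: (sm y); case: (e (phi y)) => // /(_ isT).
  by lia.
by apply: leq_sum => y _; case: (e y); case: (sm y); case: (e (phi y)).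
Qed.
End FaceCost.

Section FaceBound.
Variables (T : finType) (phi : {perm T}) (sm e : pred T) (x : T).
Notation X := (porbit phi x).
Notation n := #|porbit phi x|.
Hypothesis sme : forall z, z \in X -> sm z -> e (phi z) = e z.

(** An arc with [a] inner vertices, hence [a] smooth darts, has length [a.+1]. *)
Definition run_bound (P : pred T) (c d : nat) :=
  forall z a, z \in X -> P z -> a < n -> (forall i, i < a -> sm (iter i phi z)) ->
  c * a.+1 <= d.

Hypothesis int_bound : run_bound (fun z => ~~ e z) 6 n.-1.
Hypothesis ext_bound : run_bound e 2 n.

Lemma n_gt0 : 0 < n.
Proof. by rewrite (cardD1 x) porbit_id. Qed.

(** Otherwise the whole face would be one arc, longer than either bound allows. *)
Lemma face_break : exists2 y, y \in X & ~~ sm y.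
Proof.
case: (pickP [pred y in X | ~~ sm y]) => [y /andP[yX ny]|h]; first by exists y.
have all_sm i : sm (iter i phi x).
  by have := h (iter i phi x); rewrite /= porbit_iter /= => /negbFE.
have n0 := n_gt0; have ltn : n.-1 < n by rewrite ltn_predL.
have [ex|nx] := boolP (e x).
  by have := ext_bound (porbit_id _ _) ex ltn (fun i _ => all_sm i); lia.
by have := int_bound (porbit_id _ _) nx ltn (fun i _ => all_sm i); lia.
Qed.

Lemma run_sum_const (P : pred T) c :
  (forall z, z \in X -> sm z -> P (phi z) = P z) -> run_bound P 6 c ->
  6 * (\sum_(z in X) P z) <= c * \sum_(z in X) (P z && ~~ sm z).
Proof.
move=> smP bd.
have -> : c * \sum_(z in X) (P z && ~~ sm z) = \sum_(y in X | P y && ~~ sm y) c.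
  rewrite -sum_mull big_mkcondr; apply: eq_bigr => z _; case: (_ && _); lia.
refine (run_sum face_break smP _) => z zX Pz.
have ez : porbit phi z = X by apply/eqP; rewrite eq_porbit_mem.
have [|lt _ h] := @run_lenP _ phi sm z; first by rewrite ez; exact: face_break.
by rewrite ez in lt; exact: bd zX Pz lt h.
Qed.

Lemma face_lengths :
  [/\ 6 * (\sum_(z in X) ~~ e z) <= n.-1 * int_runs phi sm e x,
      6 * (\sum_(z in X) e z) <= 3 * n * ext_runs phi sm e x &
      \sum_(z in X) ~~ e z + \sum_(z in X) e z = n].
Proof.
split.
- by apply: run_sum_const => // z zX sz; rewrite sme.
- apply: run_sum_const => // z a zX ez lta h.
  by have := ext_bound zX ez lta h; lia.
- by rewrite -big_split -sum1_card; apply: eq_bigr => z _ /=; case: (e z).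
Qed.

Let c y : nat := if sm y then 0 else if e y && e (phi y) then 6 else
  if e y || e (phi y) then 3 else 2.

(** Without exterior arc, at least seven arcs shorter than a sixth are needed, of cost 14. With one,
    half of the face is left to interior arcs; these number at least four, and the cost is at least
    8 + 6 - 2. Two or more exterior arcs contribute at least 6 each. *)
Lemma face_ge12 : 12 <= \sum_(y in X) c y.
Proof.
have [l1 l2 l3] := face_lengths; have n0 := n_gt0.
have := face_cost sme; have := ext_int_le phi sm e x; have := ext_int_le_int sme.
rewrite -/c; move: l1 l2 l3; move: (int_runs _ _ _ _) (ext_runs _ _ _ _) (ext_int _ _ _ _) => i r m.
move: (\sum_(y in X) c y) (\sum_(z in X) ~~ e z) (\sum_(z in X) e z) => k p q.
move: n n0 => N; case: N => // N _ /=.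
case: r => [|[|r]] l1 l2 l3 mi mr kE; last by lia.
  have q0 : q = 0 by lia.
  have : 7 <= i by rewrite leqNgt; apply/negP => lt; nia.
  by lia.
have : 4 <= i by rewrite leqNgt; apply/negP => lt; nia.
by lia.
Qed.

(** The first alternative is the flat face. The second, a face with two boundary arcs, survives here
    but is excluded later along a single side. *)
Lemma face_eq12 : \sum_(y in X) c y = 12 ->
  [/\ ext_runs phi sm e x = 1, int_runs phi sm e x = 4 & ext_int phi sm e x = 1] \/
  [/\ ext_runs phi sm e x = 2, int_runs phi sm e x = ext_int phi sm e x & ext_int phi sm e x <= 2].
Proof.
have [l1 l2 l3] := face_lengths; have n0 := n_gt0.
have := face_cost sme; have := ext_int_le phi sm e x; have := ext_int_le_int sme.
rewrite -/c; move: l1 l2 l3; move: (int_runs _ _ _ _) (ext_runs _ _ _ _) (ext_int _ _ _ _) => i r m.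
move: (\sum_(y in X) c y) (\sum_(z in X) ~~ e z) (\sum_(z in X) e z) => k p q.
move: n n0 => N; case: N => // N _ /=.
case: r => [|[|r]] l1 l2 l3 mi mr kE k12.
- have q0 : q = 0 by lia.
  have : 7 <= i by rewrite leqNgt; apply/negP => lt; nia.
  by lia.
- have i4 : 4 <= i by rewrite leqNgt; apply/negP => lt; nia.
  by left; split; lia.
- by right; split; lia.
Qed.

(** An interior run after an exterior one lowers the total by 2, which is what it costs itself. *)
Lemma face_ext_runs : 6 * ext_runs phi sm e x <= \sum_(y in X) c y.
Proof.
have := face_cost sme; have := ext_int_le_int sme; rewrite -/c.
by move: (int_runs _ _ _ _) (ext_runs _ _ _ _) (ext_int _ _ _ _) (\sum_(y in X) c y) => *; lia.
Qed.
End FaceBound.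

Lemma iter_agree (T : Type) (s s' : T -> T) x :
  (forall k, s' (iter k s x) = s (iter k s x)) -> forall k, iter k s' x = iter k s x.
Proof. by move=> h; elim=> //= k ->; rewrite h. Qed.

Lemma porbit_agree (T : finType) (s s' : {perm T}) x :
  (forall k, s' (iter k s x) = s (iter k s x)) -> porbit s' x = porbit s x.
Proof.
move=> h0; have h := iter_agree h0; apply/setP => y.
by apply/porbitP/porbitP => -[k ->]; exists k; rewrite !permX h.
Qed.

(* A planar map with outer face [outer phi o] in which every arc between two distinct inner faces is shorter than a sixth of the face. *)
Record small_map (T : finType) (phi eps : {perm T}) (o : T) : Prop := SmallMap {
  sm_epsK : forall x, eps (eps x) = x;
  sm_dead : forall x, eps x = x -> phi x = x;
  sm_planar : planar phi eps;
  sm_live : eps o != o;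
  sm_spur : forall x, eps x != x -> x \notin outer phi o -> phi x != eps x;
  sm_small : forall z a, eps z != z -> z \notin outer phi o -> a < #|porbit phi z| ->
    (forall i, i < a -> phi (eps (phi (iter i phi z))) = eps (iter i phi z)) ->
    eps z \notin outer phi o -> eps z \notin porbit phi z ->
    6 * a.+1 <= #|porbit phi z|.-1 }.

Lemma six_le a n : 6 * a.+1 <= n.-1 -> 2 * a.+1 <= n.
Proof. lia. Qed.

(** * No face is glued to itself *)

Section Side.
Variables (T : finType) (phi eps phi3 eps1 : {perm T}) (o u : T).
Hypothesis M : small_map phi eps o.
Let u' := eps u.
Hypothesis lu : u' != u.
Hypothesis uO : u \notin outer phi o.
Hypothesis glued : u' \in porbit phi u.
Hypothesis pu_u' : phi u != u'.
Hypothesis pu'_u : phi u' != u.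
Hypothesis pu_u : phi u != u.
Hypothesis pu'_u' : phi u' != u'.
Hypothesis phi3u : phi3 u = u.
Hypothesis phi3u' : phi3 u' = u'.
Hypothesis phi3E : forall z, z != u -> z != u' ->
  phi3 z = if phi z == u then phi u' else if phi z == u' then phi u else phi z.
Hypothesis eps1E : forall z, eps1 z = if (z == u) || (z == u') then z else eps z.
Hypothesis planar3 : planar phi3 eps1.
Hypothesis separated : ~~ link phi3 eps1 (phi u) (phi u').
Hypothesis outer3 : forall z, z \in outer phi o -> link phi3 eps1 o z.
Hypothesis away : ~~ link phi3 eps1 (phi u) o.
Hypothesis IH : forall (phi' eps' : {perm T}) o', small_map phi' eps' o' ->
  #|[set z | eps' z != z]| < #|[set z | eps z != z]| ->
  forall z, eps' z != z -> z \notin outer phi' o' -> eps' z \notin porbit phi' z.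

Let K := comp phi3 eps1 (phi u).

Let epsK := sm_epsK M.

Let K_phi z : (phi3 z \in K) = (z \in K).
Proof.
rewrite !inE; apply/idP/idP => h; apply: link_trans h _; last exact: link1l.
by rewrite link_sym; exact: link1l.
Qed.

Let K_eps z : (eps1 z \in K) = (z \in K).
Proof.
rewrite !inE; apply/idP/idP => h; apply: link_trans h _; last exact: link1r.
by rewrite link_sym; exact: link1r.
Qed.

Let phiuK : phi u \in K. Proof. by rewrite inE link_refl. Qed.

Let isolated w : phi3 w = w -> eps1 w = w -> forall z, link phi3 eps1 w z -> z = w.
Proof.
move=> f1 f2 z /connectP[p]; elim: p => [_ ->|y p IHp] //= /andP[].
by rewrite f1 f2 orbb => /eqP <- ; exact: IHp.
Qed.

Let uK : u \notin K.
Proof.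
rewrite inE link_sym; apply/negP => /(isolated phi3u) e; move: pu_u; rewrite e ?eqxx //.
by rewrite eps1E eqxx.
Qed.

Let u'K : u' \notin K.
Proof.
rewrite inE link_sym; apply/negP => /(isolated phi3u') e; move: pu_u'; rewrite e ?eqxx //.
by rewrite eps1E eqxx orbT.
Qed.

Let neqK w z : w \notin K -> z \in K -> z != w.
Proof. by move=> nw; apply: contraTneq => ->. Qed.

Let eps1K z : z \in K -> eps1 z = eps z.
Proof. by move=> zK; rewrite eps1E (negPf (neqK uK zK)) (negPf (neqK u'K zK)). Qed.

Let phiu'K : phi u' \notin K. Proof. by rewrite inE. Qed.

Let OK z : z \in K -> z \notin outer phi o.
Proof.
rewrite inE => h; apply: contra away => /outer3; rewrite link_sym => h2.
exact: link_trans h h2.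
Qed.

Let face_split z : z \in porbit phi u -> z \in K -> z \in porbit phi3 (phi u).
Proof.
move=> zu zK.
have : [\/ z = u, z = u', z \in porbit phi3 (phi u) | z \in porbit phi3 (phi u')].
  case/porbitP: zu => n ->; rewrite permX; elim: n => [|n IHn] /=; first by constructor 1.
  have step w v : w \in porbit phi3 v -> w != u -> w != u' ->
      [\/ phi w = u, phi w = u' | phi w \in porbit phi3 v].
    move=> wv nu nu'; have := phi3E nu nu'.
    case: eqP => [->|_]; first by constructor 1.
    case: eqP => [->|_ <-]; first by constructor 2.
    by constructor 3; rewrite porbit_sym porbit_perm1 porbit_sym.
  set w := iter n phi u in IHn *.
  have [->|nu] := eqVneq w u; first by constructor 3; exact: porbit_id.
  have [->|nu'] := eqVneq w u'; first by constructor 4; exact: porbit_id.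
  case: IHn => [e|e|h|h]; try by rewrite e eqxx in nu nu'.
  - by case: (step _ _ h nu nu'); [constructor 1|constructor 2|constructor 3].
  - by case: (step _ _ h nu nu'); [constructor 1|constructor 2|constructor 4].
case=> // [e|e|h].
- by rewrite e (negPf uK) in zK.
- by rewrite e (negPf u'K) in zK.
- case/negP: separated; rewrite inE in zK; apply: link_trans zK _.
  by rewrite link_sym; apply: link_porbitl.
Qed.

(** The edge of [u] cuts its face into two closed curves; [K] is the side away from the outer face,
    bounded by the darts from [phi u] to the one before [u']. Arcs along this curve were arcs
    between distinct inner faces, hence short, and inside [K] the induction hypothesis excludes
    self-gluing. So [K] would be a disc with one marked corner, while the curvature bound asks for
    two. *)
Theorem self_glue_side : False.
Proof.
have [phiK [epsKK [plK phiKE epsKE fixK]]] := planar_restrict K_phi K_eps planar3.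
set A := outer phiK (phi u).
have phiK3 z : z \in K -> phiK z = phi3 z by move/phiKE.
have epsE z : z \in K -> epsKK z = eps z by move=> zK; rewrite epsKE // eps1K.
have phiK_K z : (phiK z \in K) = (z \in K).
  have [zK|nz] := boolP (z \in K); first by rewrite (phiK3 _ zK) K_phi zK.
  by rewrite (proj1 (fixK _ nz)) (negPf nz).
have epsK_K z : z \in K -> eps z \in K by move=> zK; rewrite -eps1K // K_eps.
have iterK k z : z \in K -> iter k phiK z \in K by move=> zK; elim: k => //= k; rewrite phiK_K.
have AK z : z \in A -> z \in K by case/porbitP=> n ->; rewrite permX; apply: iterK.
have A3 : A = porbit phi3 (phi u).
  symmetry; apply: porbit_agree => k; symmetry; apply: phiK3; exact: iterK.
have A_face z : z \in A -> z \in porbit phi u.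
  rewrite A3 => /porbitP[n ->]; rewrite permX; elim: n => /= [|n IHn].
    by rewrite porbit_sym porbit_perm1 porbit_id.
  have [->|nu] := eqVneq (iter n phi3 (phi u)) u; first by rewrite phi3u porbit_id.
  have [->|nu'] := eqVneq (iter n phi3 (phi u)) u'; first by rewrite phi3u'.
  rewrite phi3E //; case: eqP => _; first by rewrite porbit_sym porbit_perm1 porbit_sym.
  case: eqP => _; first by rewrite porbit_sym porbit_perm1 porbit_id.
  by rewrite porbit_sym porbit_perm1 porbit_sym.
have nface z : z \in K -> z \notin A -> z \notin porbit phi u.
  by move=> zK; apply: contra => zu; rewrite A3; apply: face_split.
have not_uu' z : z \notin porbit phi u -> z != u /\ z != u'.
  by move=> nz; split; apply: contraNneq nz => ->; rewrite ?porbit_id.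
have phi_in z : z \notin porbit phi u -> phi z \notin porbit phi u.
  by rewrite -!eq_porbit_mem porbit_perm1.
have phiE z : z \in K -> z \notin A -> phiK z = phi z.
  move=> zK zA; have nz := nface _ zK zA; have [n1 n2] := not_uu' _ nz.
  have [n3 n4] := not_uu' _ (phi_in _ nz).
  by rewrite phiK3 // phi3E // (negPf n3) (negPf n4).
have A_phi z : (phiK z \in A) = (z \in A) by rewrite /A outer_phi.
have faceE z : z \in K -> z \notin A -> porbit phiK z = porbit phi z.
  move=> zK zA; symmetry; apply: porbit_agree => k; symmetry; apply: phiE; first exact: iterK.
  by elim: k => //= k; rewrite A_phi.
have iterE z k : z \in K -> z \notin A -> iter k phiK z = iter k phi z.
  move=> zK zA; elim: k => //= k IHk; rewrite -IHk phiE //; first exact: iterK.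
  by elim: (k) => //= j; rewrite A_phi.
have iterA z k : z \notin A -> iter k phiK z \notin A.
  by move=> zA; elim: k => //= k; rewrite A_phi.
have liveK z : epsKK z != z -> z \in K.
  by apply: contraR => /fixK[_ ->].
have live z : epsKK z != z -> eps z != z by move=> lz; rewrite -epsE // liveK.
(* Arcs of the cut-out piece, inner or along its boundary, are arcs of the original map. *)
have smooth_int z : z \in K -> z \notin A -> eps z \notin A ->
    phiK (epsKK (phiK z)) = epsKK z -> phi (eps (phi z)) = eps z /\ eps (phi z) \notin A.
  move=> zK zA ezA; rewrite (phiE z) // !epsE // -?(phiE z) ?phiK_K // => e.
  have nA : eps (phiK z) \notin A by rewrite -A_phi e.
  by split=> //; rewrite -(phiE (eps _)) // epsK_K // phiK_K.
have MK : small_map phiK epsKK (phi u).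
  split.
  - move=> z; have [zK|nz] := boolP (z \in K); last by rewrite !(proj2 (fixK _ nz)).
    by rewrite (epsE z) // epsE ?epsK // epsK_K.
  - move=> z; have [zK|nz] := boolP (z \in K); last by rewrite (proj1 (fixK _ nz)).
    rewrite epsE // => ez; have fz := sm_dead M ez.
    by rewrite phiK3 // phi3E ?fz ?(negPf (neqK uK zK)) ?(negPf (neqK u'K zK)).
  - exact: plK.
  - rewrite epsE //; apply: contra pu_u => /eqP ez.
    by have := sm_dead M ez => /perm_inj ->.
  - move=> z lz zA; have zK := liveK _ lz.
    by rewrite phiE // epsE //; apply: sm_spur M _ (live _ lz) (OK zK).
  - move=> z a lz zA; have zK := liveK _ lz; rewrite faceE // epsE // => lta hs ezA ez.
    apply: (sm_small M) => //; [exact: live|exact: OK|move=> i ia|exact/OK/epsK_K].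
    have hA : eps (iter i phi z) \notin A.
      elim: i ia => //= i IHi ia; have ia' := ltnW ia.
      have := smooth_int (iter i phiK z); rewrite iterK // iterA // iterE // => /(_ isT isT (IHi ia')).
      by move=> /(_ _)[|//]; rewrite -iterE // hs.
    have := smooth_int (iter i phiK z); rewrite iterK // iterA // iterE // => /(_ isT isT hA).
    by move=> /(_ _)[|//]; rewrite -iterE // hs.
have ltl : #|[set z | epsKK z != z]| < #|[set z | eps z != z]|.
  apply: proper_card; apply/properP; split.
    by apply/subsetP => z; rewrite !inE; exact: live.
  by exists u; rewrite !inE //; have := proj2 (fixK _ uK) => ->; rewrite eqxx.
have noglue := IH MK ltl.
(* The only mark is at the cut; elsewhere the new boundary follows an old face, which has no
   spur. *)
have QA : [set phi u] \subset outer phiK (phi u) by rewrite sub1set porbit_id.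
have osp z : z \in outer phiK (phi u) -> phiK (epsKK z) = z -> z \in [set phi u].
  move=> zA; have zK := AK _ zA; rewrite epsE // => e; rewrite inE.
  have ezA : eps z \in A by rewrite -A_phi e.
  have ezK := AK _ ezA.
  move: e; rewrite phiK3 // phi3E ?(neqK uK ezK) ?(neqK u'K ezK) //.
  case: eqP => [_ e|_]; first by have := zK; rewrite -e (negPf phiu'K).
  case: eqP => [_ -> //|_ e].
  have lez : eps (eps z) != eps z.
    by rewrite epsK eq_sym -epsE // (live_outer (sm_dead MK) (sm_live MK) zA).
  by have := sm_spur M lez (OK ezK); rewrite epsK e eqxx.
suff face z : epsKK z != z -> z \notin A ->
    48 + \sum_(y in porbit phiK z) 0 <= 4 * \sum_(y in porbit phiK z) cost phiK epsKK (phi u) [set phi u] y.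
  have := curvature_bound (w := fun=> 0) (sm_epsK MK) (sm_dead MK) plK (sm_live MK) QA (sm_spur MK) osp face.
  by rewrite cards1 => /(leq_trans (leq_addl _ _)).
move=> lz zA; have zK := liveK _ lz.
  rewrite big1 // addn0; suff : 12 <= \sum_(y in porbit phiK z) cost phiK epsKK (phi u) [set phi u] y.
    by move=> h; exact: (leq_mul (leqnn 4) h).
  have Xz w : w \in porbit phiK z -> [/\ w \in K, w \notin A & porbit phiK w = porbit phiK z].
    move=> wz; split; last by apply/eqP; rewrite eq_porbit_mem.
      by case/porbitP: wz => n ->; rewrite permX iterK.
    by case/porbitP: wz => n ->; rewrite permX iterA.
  have lXz w : w \in porbit phiK z -> epsKK w != w.
    by move=> wz; rewrite (live_porbit_phi (sm_dead MK) wz).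
  apply: (face_ge12 (sm := smooth phiK epsKK [set phi u]) (e := ext phiK epsKK (phi u))).
  - move=> w wX /andP[/eqP sw _]; rewrite /ext -sw.
    by rewrite outer_phi.
  - move=> w a wX we lta hs; have [wK wA eX] := Xz _ wX.
    have : 6 * a.+1 <= #|porbit phiK w|.-1.
      apply: (sm_small MK); rewrite ?eX //; first exact: lXz.
        by move=> i /hs /andP[/eqP].
      by rewrite -eX; apply: noglue => //; exact: lXz.
    by rewrite eX.
  - move=> w a wX we lta hs; have [wK wA eX] := Xz _ wX.
    rewrite -eX in lta *; rewrite faceE // in lta *.
    have ewA : eps w \in A by move: we; rewrite /ext epsE.
    suff : 6 * a.+1 <= #|porbit phi w|.-1 by exact: six_le.
    apply: (sm_small M) => //; first by rewrite -epsE // lXz.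
    + exact: OK.
    + move=> i ia; have := hs i ia => /andP[/eqP]; set y := iter i phiK w.
      have yK : y \in K by apply: iterK.
      have yA : y \notin A by apply: iterA.
      rewrite -iterE // -/y !epsE // ?phiK_K // (phiE y) // inE => e ne.
      have wK' : eps (phi y) \in K by rewrite epsK_K // -phiE // phiK_K.
      move: e ne; rewrite phiK3 // phi3E ?(neqK uK wK') ?(neqK u'K wK') //.
      case: eqP => [_ e|_]; first by have := epsK_K _ yK; rewrite -e (negPf phiu'K).
      by case: eqP => [_ <-|//]; rewrite eqxx.
    + exact/OK/epsK_K.
    + by apply: contra (nface _ wK wA) => h; rewrite -(eqP (_ : porbit phi (eps w) == porbit phi u)) ?eq_porbit_mem ?A_face // porbit_sym.
Qed.
End Side.

Section SelfGlue.
Variables (T : finType) (phi eps : {perm T}) (o x : T).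
Hypothesis M : small_map phi eps o.
Let x' := eps x.
Hypothesis lx : x' != x.
Hypothesis xO : x \notin outer phi o.
Hypothesis glued : x' \in porbit phi x.

Let phi3 := dela phi eps x.
Let eps1 := delb eps x.

Let epsK := sm_epsK M.
Let eps_x' : eps x' = x. Proof. exact: epsK. Qed.

Let x'O : x' \notin outer phi o.
Proof. by rewrite (outer_porbit o glued). Qed.

Let px_x' : phi x != x'. Proof. exact: sm_spur M _ lx xO. Qed.
Let px'_x : phi x' != x.
Proof. by have := sm_spur M (x := x'); rewrite eps_x' eq_sym lx; apply. Qed.
Let px_x : phi x != x.
Proof.
apply: contraNneq lx => fx.
by move: glued; rewrite (fixed_porbit fx) inE.
Qed.
Let px'_x' : phi x' != x'.
Proof.
apply: contraNneq lx => fx.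
by move: glued; rewrite porbit_sym (fixed_porbit fx) inE eq_sym.
Qed.

Let phi3x : phi3 x = x.
Proof. by rewrite /phi3 /dela !remE -/x' eqxx [x == x']eq_sym !(negPf lx). Qed.

Let phi3x' : phi3 x' = x'.
Proof. by rewrite /phi3 /dela remE -/x' eqxx. Qed.

Let phi1 := (tperm x x' * phi)%g.
Let phi1x : phi1 x = phi x'. Proof. by rewrite permM tpermL. Qed.
Let phi1x' : phi1 x' = phi x. Proof. by rewrite permM tpermR. Qed.
Let phi1E z : z != x -> z != x' -> phi1 z = phi z.
Proof. by move=> h h'; rewrite permM tpermD // eq_sym. Qed.

Let phi3E z : z != x -> z != x' ->
  phi3 z = if phi z == x then phi x' else if phi z == x' then phi x else phi z.
Proof.
move=> nx nx'; rewrite /phi3 /dela -/x' -/phi1 !remE.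
rewrite (negPf nx) (negPf nx') (phi1E nx nx') phi1x phi1x' (negPf lx) (negPf px_x).
by case: (eqVneq (phi z) x) => // _; rewrite (negPf px'_x').
Qed.

Let eps1E z : eps1 z = if (z == x) || (z == x') then z else eps z.
Proof. by rewrite /eps1 delbE. Qed.

Let planar3 : planar phi3 eps1.
Proof. by apply: planar_del (sm_planar M). Qed.

Let link1 u v : link phi3 eps1 u v -> link phi1 eps1 u v.
Proof.
apply: link_sub => z; last exact: link1r.
have l1 := link1l phi1 eps1.
rewrite /phi3 /dela -/x' -/phi1.
have rl : forall (c : {perm T}) w, (forall z, link phi1 eps1 z (c z)) -> forall z, link phi1 eps1 z (rem c w z).
  move=> c w h y; rewrite remE; case: eqP => [->|_]; first exact: link_refl.
  case: eqP => [e|_]; last exact: h.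
  by apply: link_trans (h y) _; rewrite e; apply: h.
exact: (rl _ _ (rl _ _ l1)).
Qed.

(* Cutting a face in two without disconnecting would produce a surface of Euler characteristic above 2. *)
Let separated : ~~ link phi3 eps1 (phi x) (phi x').
Proof.
suff h : ~~ link phi1 eps1 x x'.
  apply: contra h => /link1 h; apply: link_trans (link1l _ _ _) _; rewrite phi1x link_sym.
  by apply: link_trans (link1l _ _ _) _; rewrite phi1x'.
have nxx' : x != x' by rewrite eq_sym.
have e1 := porbits_split nxx' glued.
have x'e : x' \in porbit eps x by apply: (mem_porbit eps 1 x).
have e2 := porbits_split nxx' x'e.
have e3 : (eps1 * phi1 = eps * phi)%g.
  have tb : (tperm x x' * eps = eps * tperm x x')%g by rewrite conjgC tpermJ eps_x' -/x' tpermC.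
  by rewrite /eps1 /phi1 /delb -/x' tb -mulgA (mulgA (tperm x x')) tperm2 mul1g.
have g := genus_ge0 phi1 eps1; have p := sm_planar M.
apply/negP => lk; have lk' : link phi1 eps1 x' x by rewrite link_sym.
have : ncc phi1 eps1 <= ncc phi eps.
  apply: ncc_mono => z.
    have [->|nx] := eqVneq z x; first by apply: link_trans lk _; rewrite -phi1x'; exact: link1l.
    have [->|nx'] := eqVneq z x'; first by apply: link_trans lk' _; rewrite -phi1x; exact: link1l.
    by rewrite -phi1E //; exact: link1l.
  have [->|nx] := eqVneq z x; first exact: lk.
  have [->|nx'] := eqVneq z x'; first by rewrite eps_x'.
  have -> : eps z = eps1 z by rewrite eps1E (negPf nx) (negPf nx').
  exact: link1r.
move: p g; rewrite /planar /nch e3 -/phi1 e1.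
rewrite -[#|porbits eps1|]/(#|porbits (tperm x x' * eps)%g|) e2.
move: #|porbits phi| #|porbits eps| #|porbits (eps * phi)%g| (ncc phi eps) (ncc phi1 eps1) #|T|; clear; lia.
Qed.

Let outer3 z : z \in outer phi o -> link phi3 eps1 o z.
Proof.
have oE k : phi3 (iter k phi o) = phi (iter k phi o).
  have kO : iter k phi o \in outer phi o by rewrite /outer porbit_iter.
  have kO' : phi (iter k phi o) \in outer phi o by rewrite outer_phi.
  have nx z' : z' \in outer phi o -> z' != x by move=> h; apply: contraNneq xO => <-.
  have nx' z' : z' \in outer phi o -> z' != x' by move=> h; apply: contraNneq x'O => <-.
  by rewrite phi3E ?nx ?nx' // (negPf (nx _ kO')) (negPf (nx' _ kO')).
by rewrite /outer -(porbit_agree oE) => /link_porbitl.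
Qed.

Hypothesis IH : forall (phi' eps' : {perm T}) o', small_map phi' eps' o' ->
  #|[set z | eps' z != z]| < #|[set z | eps z != z]| ->
  forall z, eps' z != z -> z \notin outer phi' o' -> eps' z \notin porbit phi' z.

(** By [separated] the outer face is on at most one side of the edge; the argument is applied to the
    other side, exchanging the two darts if necessary. *)
Lemma self_glue_step : False.
Proof.
have [|h] := boolP (link phi3 eps1 (phi x) o); last first.
  exact: (@self_glue_side T phi eps phi3 eps1 o x M).
move=> hx; have h : ~~ link phi3 eps1 (phi x') o.
  apply: contra separated => h; apply: link_trans hx _; by rewrite link_sym.
have hsep : ~~ link phi3 eps1 (phi x') (phi (eps x')) by rewrite eps_x' link_sym.
apply: (@self_glue_side T phi eps phi3 eps1 o x' M); rewrite ?eps_x' //.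
- by rewrite eq_sym.
- by rewrite porbit_sym.
- move=> z nz nz'; rewrite phi3E //.
  by case: (eqVneq (phi z) x) => [->|_] //; rewrite eq_sym (negPf lx).
- by move=> z; rewrite eps1E orbC.
- by rewrite link_sym.
Qed.
End SelfGlue.

Theorem no_self_glue (T : finType) (phi eps : {perm T}) (o : T) : small_map phi eps o ->
  forall x, eps x != x -> x \notin outer phi o -> eps x \notin porbit phi x.
Proof.
have [m] := ubnP #|[set z | eps z != z]|; elim: m phi eps o => // m IHm phi eps o ltm M x lx xO.
apply/negP => g; apply: (self_glue_step M lx xO g) => phi' eps' o' M' lt.
apply: IHm M'; exact: leq_trans lt ltm.
Qed.

(** * Words, paths and pieces *)

Section Words.
Variable S : Type.
Implicit Types (a : letter S) (u v w : word S).

Lemma inv_letterK : involutive (@inv_letter S).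
Proof. by case=> s b; rewrite /inv_letter /= negbK. Qed.

Lemma inv_letter_neq a : inv_letter a <> a.
Proof. by case: a => s [] []. Qed.

Lemma list_revE (T : Type) (s : seq T) : List.rev s = rev s.
Proof. by elim: s => //= x s ->; rewrite rev_cons -cats1. Qed.

Lemma inv_wordE w : inv_word w = rev [seq inv_letter a | a <- w].
Proof. exact: list_revE. Qed.

Lemma inv_cat u v : inv_word (u ++ v) = inv_word v ++ inv_word u.
Proof. by rewrite !inv_wordE map_cat rev_cat. Qed.

Lemma inv_cons a u : inv_word (a :: u) = inv_word u ++ [:: inv_letter a].
Proof. by rewrite -cat1s inv_cat. Qed.

Lemma inv_rcons a u : inv_word (rcons u a) = inv_letter a :: inv_word u.
Proof. by rewrite -cats1 inv_cat. Qed.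

Lemma inv_wordK : involutive (@inv_word S).
Proof.
by move=> w; rewrite !inv_wordE map_rev revK (mapK inv_letterK).
Qed.

Lemma size_inv w : size (inv_word w) = size w.
Proof. by rewrite inv_wordE size_rev size_map. Qed.

End Words.

Section Geq.
Variables (S : Type) (Γ : LGraph S).
Implicit Types (a : letter S) (u v w r : word S).
Notation "u ≡ v" := (geq Γ u v) (at level 70).

Lemma geqxx u : u ≡ u. Proof. exact: geq_refl. Qed.
Lemma geqC u v : u ≡ v -> v ≡ u. Proof. exact: geq_sym. Qed.
Lemma geqT v u w : u ≡ v -> v ≡ w -> u ≡ w. Proof. exact: geq_trans. Qed.

Lemma geq_ctx A B u v : u ≡ v -> A ++ u ++ B ≡ A ++ v ++ B.
Proof.
elim=> {u v} [u|u v _ IH|u v w _ IH1 _ IH2|u a w|u r w rr].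
- exact: geqxx.
- exact: geqC.
- exact: geqT IH1 IH2.
- rewrite -[X in A ++ X ++ B ≡ _]/(u ++ a :: inv_letter a :: w) -[X in _ ≡ A ++ X ++ B]/(u ++ w) -!catA.
  have : (A ++ u) ++ a :: inv_letter a :: (w ++ B) ≡ (A ++ u) ++ w ++ B := geq_free Γ (A ++ u) a (w ++ B).
  by rewrite -!catA.
- rewrite -[X in A ++ X ++ B ≡ _]/(u ++ r ++ w) -[X in _ ≡ A ++ X ++ B]/(u ++ w).
  have : (A ++ u) ++ r ++ (w ++ B) ≡ (A ++ u) ++ w ++ B := geq_rel (A ++ u) (w ++ B) rr.
  by rewrite !catA.
Qed.

Lemma geq_catl A u v : u ≡ v -> A ++ u ≡ A ++ v.
Proof. by move=> h; have := geq_ctx A [::] h; rewrite !cats0. Qed.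

Lemma geq_catr B u v : u ≡ v -> u ++ B ≡ v ++ B.
Proof. by move=> h; have := geq_ctx [::] B h. Qed.

Lemma geq_cat u u' v v' : u ≡ u' -> v ≡ v' -> u ++ v ≡ u' ++ v'.
Proof. by move=> h1 h2; apply: geqT (geq_catr v h1) (geq_catl u' h2). Qed.

Lemma geq_mulV w : w ++ inv_word w ≡ [::].
Proof.
elim/last_ind: w => [|w a IH]; first exact: geqxx.
rewrite inv_rcons -cats1 -catA /=; apply: geqT IH.
exact: (geq_free Γ w a (inv_word w)).
Qed.

Lemma geq_Vmul w : inv_word w ++ w ≡ [::].
Proof. by have := geq_mulV (inv_word w); rewrite inv_wordK. Qed.

Lemma geq_cancell A u v : A ++ u ≡ A ++ v -> u ≡ v.
Proof.
move=> /(geq_catl (inv_word A)); rewrite !catA => h.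
have e w : (inv_word A ++ A) ++ w ≡ w by have := geq_catr w (geq_Vmul A).
exact: geqT (geqC (e u)) (geqT h (e v)).
Qed.

Lemma geq_cancelr B u v : u ++ B ≡ v ++ B -> u ≡ v.
Proof.
move=> /(geq_catr (inv_word B)); rewrite -!catA => h.
have e w : w ++ B ++ inv_word B ≡ w by have := geq_catl w (geq_mulV B); rewrite cats0.
exact: geqT (geqC (e u)) (geqT h (e v)).
Qed.

Lemma geq_inv u v : u ≡ v -> inv_word u ≡ inv_word v.
Proof.
move=> h; apply: (geq_cancell (A := u)); apply: geqT (geq_mulV u) _.
by apply: geqT (geqC (geq_mulV v)) _; apply/geq_catr/geqC.
Qed.

Lemma geq_invP u v : u ++ v ≡ [::] -> u ≡ inv_word v.
Proof.
move=> h; apply: (geq_cancelr (B := v)); apply: geqT h _.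
exact/geqC/geq_Vmul.
Qed.

End Geq.

Section Paths.
Variables (S : Type) (Γ : LGraph S).
Implicit Types (p q : seq (step Γ)) (v : V Γ).

Lemma valid_cat v p q : valid v (p ++ q) <-> valid v p /\ valid (path_end v p) q.
Proof. by elim: p v => [|st p IH] v /=; [tauto|rewrite IH; tauto]. Qed.

Lemma path_end_cat v p q : path_end v (p ++ q) = path_end (path_end v p) q.
Proof. by elim: p v => //=. Qed.

Definition rstep (st : step Γ) : step Γ := (st.1, ~~ st.2).
Definition rpath p := rev [seq rstep st | st <- p].

Lemma rstepK : involutive rstep. Proof. by case=> e b; rewrite /rstep /= negbK. Qed.
Lemma rstep_src st : step_src (rstep st) = step_tgt st. Proof. by case: st => e []. Qed.
Lemma rstep_tgt st : step_tgt (rstep st) = step_src st. Proof. by case: st => e []. Qed.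
Lemma rstep_label st : step_label (rstep st) = inv_letter (step_label st). Proof. by []. Qed.

Lemma label_ofE p : label_of p = [seq step_label st | st <- p]. Proof. by []. Qed.
Lemma label_cat p q : label_of (p ++ q) = label_of p ++ label_of q.
Proof. by rewrite !label_ofE map_cat. Qed.
Lemma size_label p : size (label_of p) = size p. Proof. exact: size_map. Qed.

Lemma label_rpath p : label_of (rpath p) = inv_word (label_of p).
Proof. by rewrite inv_wordE !label_ofE /rpath map_rev -!map_comp. Qed.

Lemma rpath_cat p q : rpath (p ++ q) = rpath q ++ rpath p.
Proof. by rewrite /rpath map_cat rev_cat. Qed.

Lemma size_rpath p : size (rpath p) = size p.
Proof. by rewrite size_rev size_map. Qed.

Lemma rpath_valid v p : valid v p -> valid (path_end v p) (rpath p) /\ path_end (path_end v p) (rpath p) = v.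
Proof.
elim: p v => [|st p IH] v //= [es /IH[h1 h2]].
rewrite -cat1s rpath_cat valid_cat path_end_cat h2 /= rstep_src rstep_tgt es; tauto.
Qed.

Lemma src_tgt v p : valid v p ->
  [seq step_src st | st <- p] ++ [:: path_end v p] = v :: [seq step_tgt st | st <- p].
Proof. by elim: p v => [|st p IH] v //= [<- /IH ->]. Qed.

Lemma simple_cycle_rot v p q : simple_cycle v (p ++ q) -> simple_cycle (path_end v p) (q ++ p).
Proof.
case=> ne [/valid_cat[vp vq] [ce [n1 n2]]]; rewrite path_end_cat in ce.
split; first by move=> e; apply: ne; case: (q) (p) e => [|a l] //= [|b l'].
split; first by rewrite valid_cat ce.
split; first by rewrite path_end_cat ce.
have rot (T : Type) (f : step Γ -> T) : NoDup (List.map f (p ++ q)) -> NoDup (List.map f (q ++ p)).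
  apply: Permutation_NoDup; apply: Permutation_map; exact: Permutation_app_comm.
by split; apply: rot.
Qed.

Lemma simple_cycle_rev v p : simple_cycle v p -> simple_cycle v (rpath p).
Proof.
case=> ne [vp [ce [n1 n2]]]; have [h1 h2] := rpath_valid vp; rewrite ce in h1 h2.
split; first by move=> /(congr1 size); rewrite size_rpath; case: (p) ne.
split=> //; split=> //; split.
  have -> : List.map (@step_tgt S Γ) (rpath p) = List.rev (List.map (@step_src S Γ) p).
    rewrite list_revE -[List.map _ _]/[seq step_tgt x | x <- rpath p] /rpath map_rev -map_comp; congr rev.
    by apply: eq_map => x /=; rewrite rstep_tgt.
  apply: NoDup_rev; apply: Permutation_NoDup n1.
  have := src_tgt vp; rewrite ce => e.
  apply: (@Permutation_cons_inv _ _ _ v); rewrite -[X in Permutation X _]e.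
  apply: Permutation_sym; exact: Permutation_cons_append.
have -> : List.map fst (rpath p) = List.rev (List.map fst p) :> list (E Γ).
  by rewrite list_revE -[List.map _ _]/[seq x.1 | x <- rpath p] /rpath map_rev -map_comp; congr rev.
exact: NoDup_rev.
Qed.

(** Cycles can be rotated, so an initial reading stands for any factor; [n] is kept as the scale
    against which [u] is measured. *)
Definition occ (u : word S) (n : nat) : Prop :=
  exists v (c1 c2 : seq (step Γ)), [/\ simple_cycle v (c1 ++ c2), label_of c1 = u & size (c1 ++ c2) = n].

Lemma occ_prefix u w n : occ (u ++ w) n -> occ u n.
Proof.
case=> v [c1 [c2 [sc lc sz]]].
exists v, (take (size u) c1), (drop (size u) c1 ++ c2); rewrite catA cat_take_drop; split=> //.
by rewrite label_ofE map_take -label_ofE lc take_size_cat.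
Qed.

Lemma occ_suffix u w n : occ (u ++ w) n -> occ w n.
Proof.
case=> v [c1 [c2 [sc lc sz]]].
exists (path_end v (take (size u) c1)), (drop (size u) c1), (c2 ++ take (size u) c1); split.
- by rewrite catA; apply: simple_cycle_rot; rewrite catA cat_take_drop.
- by rewrite label_ofE map_drop -label_ofE lc drop_size_cat.
- by rewrite -sz -[in RHS](cat_take_drop (size u) c1) !size_cat; lia.
Qed.

Lemma occ_factor u A B n : occ (A ++ u ++ B) n -> occ u n.
Proof. by move=> /occ_suffix; exact: occ_prefix. Qed.

Lemma occ_inv u n : occ u n -> occ (inv_word u) n.
Proof.
case=> v [c1 [c2 [sc lc sz]]].
have := simple_cycle_rev sc; rewrite rpath_cat => /simple_cycle_rot sc'.
by eexists; exists (rpath c1), (rpath c2); split; [exact: sc'|rewrite label_rpath lc|rewrite -sz !size_cat !size_rpath].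
Qed.

Lemma occ_size u n : occ u n -> size u <= n.
Proof. by case=> v [c1 [c2 [_ <- <-]]]; rewrite size_label size_cat leq_addr. Qed.

(** The rest of the cycle, read backwards, joins the same end points. *)
Lemma occ_geq u n : occ u n -> exists2 w, geq Γ u w & size u + size w = n.
Proof.
case=> v [c1 [c2 [sc lc sz]]]; exists (inv_word (label_of c2)).
  rewrite -lc; apply: geq_invP; rewrite -label_cat.
  have r : relator Γ (label_of (c1 ++ c2)) by exists v, (c1 ++ c2).
  by have := geq_rel [::] [::] r; rewrite -[List.app _ _]/(label_of (c1 ++ c2) ++ [::]) cats0.
by rewrite size_inv -lc !size_label -sz size_cat.
Qed.
End Paths.

Lemma not_NoDup (T : Type) (l : seq T) : ~ NoDup l -> exists l1 x l2 l3, l = l1 ++ x :: l2 ++ x :: l3.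
Proof.
elim: l => [|x l IH] h; first by case: h; constructor.
case: (classic (In x l)) => [/(in_split x l)[l2 [l3 ->]]|nx]; first by exists [::], x, l2, l3.
have [|l1 [y [l2 [l3 ->]]]] := IH; first by move=> nd; apply: h; constructor.
by exists (x :: l1), y, l2, l3.
Qed.

Lemma map_split3 (A B : Type) (f : A -> B) (l : seq A) l1 x l2 l3 :
  [seq f y | y <- l] = l1 ++ x :: l2 ++ x :: l3 ->
  exists m1 y m2 z m3, [/\ l = m1 ++ y :: m2 ++ z :: m3, f y = x, f z = x & size m1 = size l1].
Proof.
elim: l1 l => [|b l1 IH] [|a l] //= [e1 e2].
  elim: l2 l e2 => [|c l2 IH] [|d l] //= [e3 e4].
    by exists [::], a, [::], d, l; rewrite e1 e3.
  have [m1 [y [m2 [z [m3 [e5 e6 e7 e8]]]]]] := IH _ e4.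
  by case: m1 e5 e8 => // -[e9 e10] _; exists [::], a, (d :: m2), z, m3; rewrite e10 e9.
have [m1 [y [m2 [z [m3 [-> e6 e7 e8]]]]]] := IH _ e2.
by exists (a :: m1), y, m2, z, m3; rewrite /= e8.
Qed.

(* Adding an isolated edge for every generator makes each pair of inverse letters readable along a closed path, without creating simple cycles. *)
Definition plus (S : Type) (Γ : LGraph S) : LGraph S :=
  {| V := V Γ + S * bool; E := E Γ + S;
     src := fun e => match e with inl e => inl (src Γ e) | inr s => inr (s, true) end;
     tgt := fun e => match e with inl e => inl (tgt Γ e) | inr s => inr (s, false) end;
     lab := fun e => match e with inl e => lab Γ e | inr s => s end |}.

Section Rigid.
Variables (S : Type) (Γ : LGraph S).
Implicit Types u : word S.

(* The words that are not rigid are the pieces. *)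
Definition rigid u : Prop := forall v1 (p1 : seq (step Γ)) v2 p2,
  valid v1 p1 -> valid v2 p2 -> label_of p1 = u -> label_of p2 = u ->
  exists fV fE, [/\ lp_aut Γ fV fE, fV v1 = v2 & [seq fE e | e <- [seq x.1 | x <- p1]] = [seq x.1 | x <- p2]].

(** If the arc of the cycle were related by automorphisms to every reading of [u], any two readings
    would be related by composition. So some reading forms a piece with that arc. *)
Lemma occ_piece u n : Gr'16 Γ -> occ Γ u n -> ~ rigid u -> 6 * size u < n.
Proof.
move=> gr [v [c1 [c2 [sc lc sz]]]] nr; apply: NNPP => big; apply: nr => v1 p1 v2 p2 h1 h2 l1 l2.
have vc : valid v c1 by case: sc => _ [/valid_cat[]].
have rel w q : valid w q -> label_of q = u -> exists fV fE, [/\ lp_aut Γ fV fE, fV v = w & [seq fE e | e <- [seq x.1 | x <- c1]] = [seq x.1 | x <- q]].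
  move=> vq lq; apply: NNPP => nex; apply: big.
  have := gr _ _ sc c1 w q; rewrite -[length c1]/(size c1) -[length (c1 ++ c2)]/(size (c1 ++ c2)) sz.
  rewrite -lc size_label => hh; apply/ltP; apply: hh; last by exists c2.
  split=> //; split=> //; split; first by rewrite lc lq.
  by case=> fV [fE [au [e1 e2]]]; apply: nex; exists fV, fE; split.
have [fV [fE [[[fV' [k1 k2]] [[fE' [k3 k4]] au]] e1 e2]]] := rel _ _ h1 l1.
have [gV [gE [[[gV' [m1 m2]] [[gE' [m3 m4]] au']] e3 e4]]] := rel _ _ h2 l2.
exists (fun x => gV (fV' x)), (fun e => gE (fE' e)); split.
- split; first by exists (fun x => fV (gV' x)); split=> x; rewrite ?m1 ?k1 ?k2 ?m2.
  split; first by exists (fun x => fE (gE' x)); split=> x; rewrite ?m3 ?k3 ?k4 ?m4.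
  move=> e; have [a1 [a2 a3]] := au' (fE' e); have [b1 [b2 b3]] := au (fE' e); rewrite k4 in b1 b2 b3.
  by rewrite a1 a2 a3 b1 b2 b3 !k1.
- by rewrite -e1 k1.
- rewrite -e2 -e4 -!map_comp; apply: eq_map => st /=; by rewrite k3.
Qed.

(** In a reduced labelling a letter followed by its inverse retraces an edge, and a simple cycle
    uses each edge once. *)
Lemma occ_reduced u n : reduced Γ -> occ Γ u n -> forall x a y, u <> x ++ a :: inv_letter a :: y.
Proof.
case=> r1 r2 [v [c1 [c2 [sc lc _]]]] x a y eu; move: sc; subst u.
have ec : c1 = take (size x) c1 ++ drop (size x) c1 by rewrite cat_take_drop.
have : label_of (drop (size x) c1) = a :: inv_letter a :: y by rewrite label_ofE map_drop -label_ofE eu drop_size_cat.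
case ed : (drop (size x) c1) ec => [|st1 [|st2 l]] // ec; rewrite label_ofE => -[l1 l2 l3 _].
rewrite ec -catA => -[nn [vp [_ [_ nd]]]].
have [_ [_ [s12 _]]] := (valid_cat _ _ _).1 vp.
have e12 : st2.1 = st1.1.
  move: s12 l2 l3; rewrite -l1 /step_src /step_tgt /step_label /inv_letter.
  case: st1 st2 {l1 nd nn vp ed ec} => [e1 b1] [e2 b2] /= s12 le eb; move: s12; rewrite eb.
  by case: (b1) => s12; [apply: r2|apply: r1].
move: nd; rewrite -[List.map _ _]/([seq z.1 | z <- _ ++ _]) map_cat /= e12 => /NoDup_app_remove_l.
by move=> /NoDup_cons_iff[[]]; left.
Qed.
End Rigid.

Section Plus.
Variables (S : Type) (Γ : LGraph S).
Notation Δ := (plus Γ).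

Definition lift (st : step Γ) : step Δ := (inl st.1, st.2).
Definition free_step (a : letter S) : step Δ := (inr a.1, a.2).

Lemma free_label a : step_label (free_step a) = a. Proof. by case: a. Qed.

Lemma reduced_plus : reduced Γ -> reduced Δ.
Proof.
case=> h1 h2; split=> -[e1|s1] [e2|s2] //=.
- by move=> [e] l; rewrite (h1 e1 e2).
- by move=> _ ->.
- by move=> [e] l; rewrite (h2 e1 e2).
- by move=> _ ->.
Qed.

Lemma lift_src st : step_src (lift st) = inl (step_src st). Proof. by case: st => e []. Qed.
Lemma lift_tgt st : step_tgt (lift st) = inl (step_tgt st). Proof. by case: st => e []. Qed.
Lemma lift_label p : label_of [seq lift st | st <- p] = label_of p.
Proof. by rewrite !label_ofE -map_comp. Qed.

Lemma lift_rpath p : rpath [seq lift st | st <- p] = [seq lift st | st <- rpath p].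
Proof. by rewrite /rpath map_rev -!map_comp. Qed.

Lemma lift_fst p : [seq x.1 | x <- [seq lift st | st <- p]] = [seq inl e | e <- [seq x.1 | x <- p]].
Proof. by rewrite -!map_comp. Qed.

Lemma lift_valid v p : valid (inl v : V Δ) [seq lift st | st <- p] -> valid v p.
Proof. by elim: p v => //= st p IH v; rewrite lift_src lift_tgt => -[[->] /IH]. Qed.

Lemma lift_end v p : path_end (inl v : V Δ) [seq lift st | st <- p] = inl (path_end v p).
Proof. by elim: p v => //= st p IH v; rewrite lift_tgt IH. Qed.

Lemma valid_lift v (p : seq (step Δ)) : valid (inl v : V Δ) p -> exists p', p = [seq lift st | st <- p'].
Proof.
elim: p v => [|[[e|s] b] p IH] v; first by exists [::].
  move=> [e1 h]; rewrite -[(inl e, b)]/(lift (e, b)) lift_tgt in h.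
  by have [p' ->] := IH _ h; exists ((e, b) :: p').
by move=> []; rewrite /step_src /=; case: b.
Qed.

Lemma free_valid s (p : seq (step Δ)) v : valid (inr v : V Δ) p -> v.1 = s -> forall st, In st p -> st.1 = inr s.
Proof.
elim: p v => //= -[[e|s'] b] p IH v [e1 h] vs.
  by move: e1; rewrite /step_src /=; case: b {h}.
have vs' : v.1 = s' by move: e1; rewrite /step_src /=; case: (b) => -[<-].
move=> st [<-|]; first by rewrite /= -vs' vs.
have h' : valid (inr (s', ~~ b) : V Δ) p by move: h; rewrite /step_tgt /=; case: (b).
exact: (IH _ h' (etrans (esym vs') vs) st).
Qed.

(** A closed path inside an added isolated edge has to come back along that edge. *)
Lemma simple_plus (v : V Δ) (p : seq (step Δ)) : simple_cycle v p ->
  exists v' p', [/\ v = inl v', p = [seq lift st | st <- p'] & simple_cycle v' p'].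
Proof.
case: v => [v|v] [ne [vp [ce [n1 n2]]]].
  have [p' ep] := valid_lift vp; exists v, p'; split=> //; subst p.
  split; first by move=> e; apply: ne; rewrite e.
  split; first exact: lift_valid.
  split; first by move: ce; rewrite lift_end => -[].
  split.
    apply: (NoDup_map_inv (@inl (V Γ) (S * bool))).
    have -> : List.map (@inl (V Γ) (S * bool)) (List.map (@step_tgt S Γ) p') = List.map (@step_tgt S Δ) [seq lift st | st <- p']; last exact: n1.
    rewrite -[LHS]/[seq inl x | x <- [seq step_tgt st | st <- p']] -[RHS]/[seq step_tgt st | st <- [seq lift st | st <- p']].
    by rewrite -!map_comp; apply: eq_map => st /=; rewrite lift_tgt.
  apply: (NoDup_map_inv (@inl (E Γ) S)).
  by move: n2; rewrite -[List.map fst _]/[seq x.1 | x <- [seq lift st | st <- p']] lift_fst.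
exfalso; have fr := free_valid vp erefl.
case: p ne vp ce n1 n2 fr => [|st [|st2 p]] //= _ [e1 h] ce n1 n2 fr.
  have es := fr st (or_introl erefl); case: st es e1 ce {h n1 n2 fr} => e b /= ->.
  by rewrite /step_src /step_tgt /=; case: b => <-.
have es := fr st (or_introl erefl); have es2 := fr st2 (or_intror (or_introl erefl)).
by move: n2; rewrite es es2 => /NoDup_cons_iff[[]]; left.
Qed.

(** The path is shortened until it is a simple cycle. A repeated vertex cuts off a shorter closed
    path; an edge repeated without repeated vertex is run in both directions, so it encloses a
    closed path and cancels around it. *)
Lemma closed_trivial (v : V Δ) (p : seq (step Δ)) :
  valid v p -> path_end v p = v -> geq Γ (label_of p) [::].
Proof.
have [m] := ubnP (size p); elim: m v p => // m IH v p ltm vp ce.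
case: (classic (p = [::])) => [->|ne]; first exact: geqxx.
case: (classic (NoDup (List.map (@step_tgt S Δ) p))) => [n1|/not_NoDup[l1 [x [l2 [l3 e]]]]]; last first.
  have [m1 [y [m2 [z [m3 [ep ey ez _]]]]]] := map_split3 e.
  move: vp ce ltm; rewrite ep -!cat_rcons !valid_cat !path_end_cat => -[v1 [v2 v3]] ce ltm.
  have e1 : path_end v (rcons m1 y) = x by rewrite -cats1 path_end_cat /= ey.
  have e2 : path_end x (rcons m2 z) = x by rewrite -cats1 path_end_cat /= ez.
  rewrite e1 in v2 v3 ce; rewrite e2 in v3 ce.
  have h1 : geq Γ (label_of (rcons m2 z)) [::].
    by apply: (IH x) => //; move: ltm; rewrite !size_cat !size_rcons; lia.
  have h2 : geq Γ (label_of (rcons m1 y ++ m3)) [::].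
    apply: (IH v); first by move: ltm; rewrite !size_cat !size_rcons; lia.
      by rewrite valid_cat e1.
    by rewrite path_end_cat e1.
  rewrite !label_cat; apply: geqT (geq_ctx _ _ h1) _; rewrite /=.
  by rewrite -label_cat.
case: (classic (NoDup (List.map (@fst (E Δ) bool) p))) => [n2|/not_NoDup[l1 [x [l2 [l3 e]]]]].
  have [v' [p' [_ -> sc]]] : exists v' p', [/\ v = inl v', p = [seq lift st | st <- p'] & simple_cycle v' p'].
    exact: simple_plus.
  rewrite lift_label; have r : relator Γ (label_of p') by exists v', p'.
  by have := geq_rel [::] [::] r; rewrite -[List.app _ _]/(label_of p' ++ [::]) cats0.
have [m1 [[e1 b1] [m2 [[e2 b2] [m3 [ep /= ey ez _]]]]]] := map_split3 e; subst e1 e2.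
move: vp ce ltm n1; rewrite ep -cat_cons -cat1s valid_cat path_end_cat /= => -[v1 [sx]].
rewrite valid_cat path_end_cat /= => -[v2 [sz v3]] ce ltm n1.
have nb : b2 = ~~ b1.
  case: (b1 =P b2) => [eb|]; last by case: (b1) (b2) => [] [].
  move: n1; rewrite eb -[List.map _ _]/[seq step_tgt st | st <- _] map_cat /= map_cat /=.
  move=> nd; case: (NoDup_remove_2 _ _ _ nd).
  by apply/in_or_app; right; apply/in_or_app; right; left.
have e1 : step_src ((x, b2) : step Δ) = step_tgt (x, b1) by rewrite nb; case: (b1).
have e2 : step_tgt ((x, b2) : step Δ) = step_src (x, b1) by rewrite nb; case: (b1).
have h1 : geq Γ (label_of m2) [::].
  apply: (IH (step_tgt (x, b1))) => //; last by rewrite -sz.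
  by move: ltm; rewrite !size_cat /= !size_cat /=; lia.
have h2 : geq Γ (label_of (m1 ++ m3)) [::].
  apply: (IH v); first by move: ltm; rewrite !size_cat /= !size_cat /=; lia.
    by rewrite valid_cat -sx -e2.
  by rewrite path_end_cat -sx -e2.
rewrite (label_cat m1) in h2; rewrite (label_cat m1) /=; apply: geqT h2; apply: geq_catl.
rewrite -[label_of (m2 ++ _)]/(label_of (m2 ++ (x, b2) :: m3)) (label_cat m2).
apply: geqT (geq_ctx [:: step_label ((x, b1) : step Δ)] _ h1) _ => /=.
rewrite -[step_label (x, b2)]/(lab Δ x, b2) nb.
exact: (geq_free Γ [::] (step_label ((x, b1) : step Δ)) (label_of m3)).
Qed.

Lemma lp_aut_plus (fV : V Γ -> V Γ) (fE : E Γ -> E Γ) : lp_aut Γ fV fE ->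
  exists gV gE, lp_aut Δ gV gE /\ forall e, gE (inl e) = inl (fE e).
Proof.
case=> [[fV' [k1 k2]] [[fE' [k3 k4]] h]].
pose gV (v : V Δ) : V Δ := match v with inl v => inl (fV v) | inr v => inr v end.
pose gE (e : E Δ) : E Δ := match e with inl e => inl (fE e) | inr e => inr e end.
exists gV, gE; split=> //; split.
  exists (fun v => match v with inl v => inl (fV' v) | inr v => inr v end).
  by split=> -[v|v] //=; rewrite ?k1 ?k2.
split.
  exists (fun v => match v with inl v => inl (fE' v) | inr v => inr v end).
  by split=> -[v|v] //=; rewrite ?k3 ?k4.
by move=> [e|e] //=; have [-> [-> ->]] := h e.
Qed.

(** Neighbouring faces read their common arc in opposite directions. Both readings lie in Γ, and an
    automorphism of Γ relating them would extend to the enlarged graph. *)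
Lemma parallel_piece (v1 v2 : V Δ) (c1 c2 d1 d2 : seq (step Δ)) :
  simple_cycle v1 (c1 ++ c2) -> simple_cycle v2 (d1 ++ d2) ->
  label_of c1 = label_of (rpath d1) ->
  (forall fV fE, lp_aut Δ fV fE -> [seq fE e | e <- [seq x.1 | x <- c1]] <> [seq x.1 | x <- rpath d1]) ->
  occ Γ (label_of c1) (size (c1 ++ c2)) /\ ~ rigid Γ (label_of c1).
Proof.
move=> /simple_plus[w1 [p1 [_ e1 s1]]] /simple_plus[w2 [p2 [_ e2 s2]]] lbl nrel.
have take_lift (p : seq (step Γ)) (a b : seq (step Δ)) : a ++ b = [seq lift st | st <- p] ->
    a = [seq lift st | st <- take (size a) p].
  by move=> e; rewrite map_take -e take_size_cat.
set q1 := take (size c1) p1; set q2 := take (size d1) p2.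
have f1 : c1 = [seq lift st | st <- q1] by apply: take_lift e1.
have f2 : d1 = [seq lift st | st <- q2] by apply: take_lift e2.
have ep1 : p1 = q1 ++ drop (size c1) p1 by rewrite cat_take_drop.
have ep2 : p2 = q2 ++ drop (size d1) p2 by rewrite cat_take_drop.
have v1' : valid w1 q1 by case: s1 => _ [+ _]; rewrite ep1 valid_cat => -[].
have v2' : valid w2 q2 by case: s2 => _ [+ _]; rewrite ep2 valid_cat => -[].
have [v3 _] := rpath_valid v2'.
have l1 : label_of q1 = label_of c1 by rewrite f1 lift_label.
have l2 : label_of (rpath q2) = label_of c1 by rewrite lbl f2 lift_rpath lift_label.
split; first by exists w1, q1, (drop (size c1) p1); rewrite -ep1 e1 size_map.
move=> rg; have [fV [fE [au [_ efE]]]] := rg _ _ _ _ v1' v3 l1 l2.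
have [gV [gE [au' egE]]] := lp_aut_plus au.
apply: (nrel gV gE au'); rewrite f1 f2 lift_rpath !lift_fst -efE -!map_comp.
by apply: eq_map => e /=; rewrite egE.
Qed.
End Plus.

Section Cycles.
Variable T : finType.
Implicit Types (f g : T -> T) (p q : seq T) (x y z : T).

Lemma fpath_change f f' x y p z : f' y = f x -> {in p, f' =1 f} ->
  fpath f x (rcons p z) -> fpath f' y (rcons p z).
Proof.
move=> e ag.
have tl u q : {subset u :: q <= p} -> fpath f u (rcons q z) -> fpath f' u (rcons q z).
  elim: q u => [|v q IH] u sub /=; first by rewrite ag // sub ?mem_head.
  rewrite ag ?sub ?mem_head // => /andP[-> /IH]; apply=> w wq.
  by apply: sub; rewrite inE wq orbT.
case: p ag tl => [|u p] ag tl /=; first by rewrite e.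
by rewrite e => /andP[-> /tl]; apply.
Qed.

Lemma fcycle_rcons f p x : fcycle f (rcons p x) = fpath f x (rcons p x).
Proof. by case: p => [|y p] //=; rewrite rcons_path last_rcons andbC. Qed.

Lemma fcycle_split f f' p q x y : uniq (rcons p x ++ rcons q y) ->
  f' x = f y -> f' y = f x -> (forall z, z != x -> z != y -> f' z = f z) ->
  fcycle f (rcons p x ++ rcons q y) -> fcycle f' (rcons p x) /\ fcycle f' (rcons q y).
Proof.
rewrite cat_uniq !rcons_uniq => /and3P[/andP[xp _] hs /andP[yq _]] ex ey ef.
rewrite -rcons_cat fcycle_rcons rcons_cat cat_path last_rcons => /andP[h1 h2].
have np z : z \in p -> z != x /\ z != y.
  move=> zp; split; first by apply: contraNneq xp => <-.
  apply: contraNneq hs => e; apply/hasP; exists y; first by rewrite mem_rcons mem_head.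
  by rewrite /= mem_rcons inE -e zp orbT.
have nq z : z \in q -> z != x /\ z != y.
  move=> zq; split; last by apply: contraNneq yq => <-.
  apply: contraNneq hs => e; apply/hasP; exists x; first by rewrite mem_rcons inE -e zq orbT.
  by rewrite /= mem_rcons mem_head.
by rewrite !fcycle_rcons; split; [apply: (fpath_change ex _ h1) => z /np[? ?]; apply: ef|apply: (fpath_change ey _ h2) => z /nq[? ?]; apply: ef].
Qed.

Lemma fcycle_porbit (s : {perm T}) p x : fcycle s p -> x \in p -> porbit s x =i p.
Proof.
move=> c xp y; apply/porbitP/idP => [[n ->]|yp].
  rewrite permX; elim: n => //= n IH.
  by have /eqP -> := next_cycle c IH; rewrite mem_next.
have : fconnect s x y by rewrite (fconnect_cycle c xp).
by move/iter_findex => <-; exists (findex s x y); rewrite permX.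
Qed.

Lemma fcycle_mem (s : {perm T}) p x : fcycle s p -> (s x \in p) = (x \in p).
Proof.
move=> c; apply/idP/idP => xp; have h := fcycle_porbit c xp; rewrite -h.
  by rewrite porbit_sym; apply: (mem_porbit s 1 x).
exact: (mem_porbit s 1 x).
Qed.

Lemma fcycle_nth f p x d : fcycle f p -> x \in p ->
  f x = nth d p (if (index x p).+1 == size p then 0 else (index x p).+1).
Proof.
move=> c xp; have /eqP -> := next_cycle c xp; rewrite next_nth xp.
case: p {c} xp => // y p xp; have := xp; rewrite -index_mem; set i := index x _; rewrite /= ltnS => le.
by case: eqP => [[e]|ne]; [rewrite nth_default ?e|apply: set_nth_default; lia].
Qed.
End Cycles.

(** * Diagrams *)

Section Diagram.
Variables (S : Type) (Γ : LGraph S).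
Notation Δ := (plus Γ).
Notation "u ≡ v" := (geq Γ u v) (at level 70).

Section Def.
Variable T : finType.
Variables (phi eps : {perm T}) (h : T -> step Δ) (dev : T -> word S) (O : seq T).

Definition lb d : letter S := step_label (h d).

(* [O] is the outer face, the other faces carry closed paths of Δ, and [dev] develops the map into the group. *)
Record diagram : Prop := Diagram {
  dg_epsK : forall d, eps (eps d) = d;
  dg_dead : forall d, eps d = d -> d \notin O -> phi d = d;
  dg_label : forall d, eps d != d -> lb (eps d) = inv_letter (lb d);
  dg_walk : forall d, d \notin O -> eps d != d -> step_tgt (h d) = step_src (h (phi d));
  dg_eps : forall d, eps d != d -> dev (eps d) ≡ dev d ++ [:: lb d];
  dg_phi : forall d, eps d != d -> dev (phi d) ≡ dev d ++ [:: lb d];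
  dg_null : forall d, eps d = d -> dev (phi d) ≡ dev d;
  dg_planar : planar phi eps;
  dg_cycle : fcycle phi O;
  dg_uniq : uniq O }.
End Def.

(* The base dart [b] is fixed by [eps], that is, it carries no edge. *)
Definition based (T : finType) (phi eps : {perm T}) h dev (b : T) s w :=
  [/\ diagram phi eps h dev (b :: s), eps b = b, {in s, forall d, eps d != d} &
      w = [seq lb h d | d <- s]].

(** The [m] further fixed darts are material for later surgery: new edges are made of them, so that
    the type of darts never has to grow. The base dart keeps the outer face nonempty even for the
    empty word. *)
Definition fillable w := forall m, exists (T : finType) phi eps h dev (b : T) s,
  @based T phi eps h dev b s w /\ m <= #|[set d | (eps d == d) && (d != b)]|.

Lemma fillable_nil : S -> fillable [::].
Proof.
move=> a m; exists 'I_m.+1, 1%g, 1%g, (fun=> free_step Γ (a, true)), (fun=> [::]), ord0, [::].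
split; last first.
  have -> : [set d | ((1%g : {perm 'I_m.+1}) d == d) && (d != ord0)] = ~: [set ord0].
    by apply/setP => d; rewrite !inE perm1 eqxx.
  by rewrite cardsC1 card_ord.
split; [|by rewrite perm1|by []|by []].
split=> //; try by move=> d; rewrite !perm1 ?eqxx.
- by move=> d _; exact: geqxx.
- by rewrite /planar ncc1 mul1g porbits1; lia.
- by rewrite /= perm1 eqxx.
Qed.

Lemma fpath_dev (T : finType) phi eps h dev O (r : seq T) x : @diagram T phi eps h dev O ->
  fpath phi x r -> {in x :: r, forall d, eps d != d} ->
  dev (phi (last x r)) ≡ dev x ++ [seq lb h d | d <- x :: r].
Proof.
move=> D; elim: r x => [|y r IH] x /=; first by move=> _ lv; apply: dg_phi D _ (lv _ (mem_head _ _)).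
case/andP=> /eqP e p lv; apply: geqT (IH _ p _) _; first by move=> d dr; apply: lv; rewrite inE dr orbT.
rewrite -[X in _ ≡ X]/(dev x ++ [:: lb h x] ++ [seq lb h d | d <- y :: r]) catA.
by apply: geq_catr; rewrite -e; apply: (dg_phi D); apply: lv; apply: mem_head.
Qed.

Lemma closed_walk_nth (p : seq (step Δ)) v0 st0 : valid v0 p -> path_end v0 p = v0 ->
  forall i, i < size p -> step_tgt (nth st0 p i) = step_src (nth st0 p (if i.+1 == size p then 0 else i.+1)).
Proof.
move=> vp ce.
have src_nth v q i : valid v q -> i < size q -> step_src (nth st0 q i) = path_end v (take i q).
  elim: q v i => [|st q IH] v [|i] //= [e h]; rewrite ?ltnS //; exact: IH.
have tgt_nth v q i : valid v q -> i < size q -> step_tgt (nth st0 q i) = path_end v (take i.+1 q).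
  elim: q v i => [|st q IH] v [|i] //= [e h]; rewrite ?ltnS ?take0 //; exact: IH.
move=> i lti; rewrite (tgt_nth v0) //; case: eqP => [e|ne].
  by rewrite e take_size ce (src_nth v0) ?take0 //; apply: leq_ltn_trans lti.
by rewrite (src_nth v0) //; lia.
Qed.

(** One transposition closes the boundary stretch reading [r] into an inner face: [x] is the dart
    before the stretch and [y] its last one. The darts of the new face are relabelled by the closed
    path [p]. *)
Lemma fillable_cut u r w (v0 : V Δ) (p : seq (step Δ)) :
  r <> [::] -> valid v0 p -> path_end v0 p = v0 -> label_of p = r ->
  fillable (u ++ r ++ w) -> fillable (u ++ w).
Proof.
move=> rn vp ce lp fl m.
have [T [phi [eps [h [dev [b [s [[D eb lv ew] lem]]]]]]]] := fl m.
have [s1 [r1 [y [s2 [es eu er ew']]]]] : exists s1 r1 y s2, [/\ s = s1 ++ rcons r1 y ++ s2,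
    u = [seq lb h d | d <- s1], r = [seq lb h d | d <- rcons r1 y] & w = [seq lb h d | d <- s2]].
  exists (take (size u) s); set r' := take (size r) (drop (size u) s).
  have er : r = [seq lb h d | d <- r'] by rewrite map_take map_drop -ew drop_size_cat // take_size_cat.
  have es : s = take (size u) s ++ r' ++ drop (size r) (drop (size u) s) by rewrite !cat_take_drop.
  case/lastP: (r') es er => [|r1 y] es er; first by case: rn; rewrite er.
  exists r1, y, (drop (size r) (drop (size u) s)); split=> //.
    by rewrite map_take -ew take_size_cat.
  by rewrite !map_drop -ew !drop_size_cat.
set q := rcons r1 y in es er *.
have szp : size p = size q by rewrite -(size_map (lb h)) -er -lp size_label.
set x := last b s1; set t1 := belast b s1.
have et : b :: s1 = rcons t1 x by rewrite lastI.
have c0 : fcycle phi (q ++ rcons (s2 ++ t1) x).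
  by have := dg_cycle D; rewrite es -cat_cons -(rot_cycle (size (b :: s1))) rot_size_cat rcons_cat -et catA.
have u0 : uniq (q ++ rcons (s2 ++ t1) x).
  by have := dg_uniq D; rewrite es -cat_cons -(rot_uniq (size (b :: s1))) rot_size_cat rcons_cat -et catA.
have qO d : d \in q -> d \in b :: s by move=> dq; rewrite es inE !mem_cat dq !orbT.
have xO : x \in b :: s by rewrite es -cat_cons mem_cat mem_last.
have xq : x \notin q.
  by move: u0; rewrite cat_uniq => /and3P[_ /hasPn hs _]; apply: hs; rewrite mem_rcons mem_head.
have yq : y \in q by rewrite mem_rcons mem_head.
have nxy : x != y by apply: contraNneq xq => ->.
have qs d : d \in q -> eps d != d by move=> dq; apply: lv; rewrite es !mem_cat dq orbT.
pose phi' : {perm T} := (tperm x y * phi)%g.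
have px : phi' x = phi y by rewrite permM tpermL.
have py : phi' y = phi x by rewrite permM tpermR.
have pE d : d != x -> d != y -> phi' d = phi d by move=> h1 h2; rewrite permM tpermD // eq_sym.
have [c1 c2] : fcycle phi' q /\ fcycle phi' (rcons (s2 ++ t1) x).
  by apply: fcycle_split u0 _ _ _ c0 => // d h1 h2; apply: pE.
pose st0 := h b.
pose h' d := if d \in q then nth st0 p (index d q) else h d.
have lb' d : lb h' d = lb h d.
  rewrite /lb /h'; case: ifP => // dq; have lt : index d q < size q by rewrite index_mem.
  have := congr1 (fun l => nth (lb h b) l (index d q)) lp; rewrite er label_ofE.
  by rewrite (nth_map st0) ?szp // (nth_map b) // nth_index.
(* The label of a closed path is trivial, so both ends of the stretch have the same image in the
   group and [dev] survives the transposition. *)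
have devy : dev (phi y) ≡ dev (phi x).
  have : fcycle phi (rcons (s2 ++ t1) x ++ q) by rewrite -(rot_cycle (size (rcons (s2 ++ t1) x))) rot_size_cat.
  rewrite /q -rcons_cat fcycle_rcons rcons_cat cat_path last_rcons -/q => /andP[_].
  have lq : last y q = y by rewrite /q last_rcons.
  have {}er : r = [seq lb h d | d <- q] := er.
  case eq : q lq er qs => [|z q']; first by move: yq; rewrite eq.
  move=> /= lq er' qs' /andP[/eqP ez pq]; rewrite -{1}lq ez.
  have {}er' : [seq lb h d | d <- z :: q'] = r by rewrite er'.
  apply: geqT (fpath_dev D pq qs') _; rewrite er'.
  by have := geq_catl (dev z) (closed_trivial vp ce); rewrite lp cats0.
exists T, phi', eps, h', dev, b, (s1 ++ s2); split; last first.
  exact: lem.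
have O'O d : (d \in b :: s) = (d \in q) || (d \in b :: s1 ++ s2).
  by rewrite es !inE !mem_cat; case: (d == b); case: (d \in s1); case: (d \in q); case: (d \in s2).
split=> //; last 2 first.
- by move=> d; rewrite mem_cat => ds; apply: lv; rewrite es !mem_cat; case/orP: ds => ->; rewrite ?orbT.
- by rewrite (eq_map lb') map_cat -eu -ew'.
have xO' : x \in b :: s1 ++ s2 by rewrite -cat_cons mem_cat mem_last.
split.
- exact: dg_epsK D.
- move=> d ed nd; have dq : d \notin q by apply: contraPN ed => /qs/eqP.
  rewrite pE; last by apply: contraNneq dq => ->.
    by apply: (dg_dead D) => //; rewrite O'O (negPf dq).
  by apply: contraNneq nd => ->.
- by move=> d ld; rewrite !lb'; apply: (dg_label D).
- move=> d nd ld; rewrite /h'; case: (boolP (d \in q)) => dq.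
    have phiq : phi' d \in q by rewrite (fcycle_mem _ c1).
    rewrite phiq (fcycle_nth d c1 dq).
    have lt : index d q < size p by rewrite szp index_mem.
    rewrite (closed_walk_nth st0 vp ce lt) szp index_uniq //; last first.
      by move: u0; rewrite cat_uniq => /and3P[].
    have lt' : index d q < size q by rewrite index_mem.
    by case: eqP => [_|/eqP ne]; [apply: leq_ltn_trans lt'|rewrite ltn_neqAle ne].
  have dO : d \notin b :: s by rewrite O'O (negPf dq).
  have e : phi' d = phi d by apply: pE; [apply: contraNneq nd => ->|apply: contraNneq dq => ->].
  rewrite e; have : phi d \notin b :: s by rewrite (fcycle_mem _ (dg_cycle D)).
  by rewrite O'O negb_or => /andP[/negPf -> _]; apply: (dg_walk D).
- by move=> d ld; rewrite lb'; apply: (dg_eps D).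
- move=> d ld; rewrite lb'.
  have [e|nx] := eqVneq d x.
    by rewrite e px; apply: geqT devy _; apply: (dg_phi D); rewrite -e.
  have [->|ny] := eqVneq d y; last by rewrite pE //; apply: (dg_phi D).
  by rewrite py; apply: geqT (geqC devy) _; apply: (dg_phi D); apply: qs.
- move=> d ed; have [e|nx] := eqVneq d x.
    by rewrite e px; apply: geqT devy _; apply: (dg_null D); rewrite -e.
  have dy : d != y by apply: contraTneq (qs _ yq) => <-; rewrite ed eqxx.
  by rewrite pE //; apply: (dg_null D).
- apply: planar_split => //; last exact: dg_planar D.
  by rewrite (fcycle_porbit (dg_cycle D)) // qO.
- by rewrite -cat_cons -(rot_cycle (size (b :: s1))) rot_size_cat et -rcons_cat.
- move: u0; rewrite cat_uniq => /and3P[_ _]; rewrite rcons_cat -et.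
  by rewrite -cat_cons -[uniq (_ ++ s2)](rot_uniq (size (b :: s1))) rot_size_cat.
Qed.
End Diagram.

(** * Every trivial word bounds a diagram *)

Section Fill.
Variables (S : Type) (Γ : LGraph S).
Notation Δ := (plus Γ).
Notation "u ≡ v" := (geq Γ u v) (at level 70).

(** Two spare darts are attached one after the other behind the last dart [x] of [u] and then joined
    into an edge: a hair labelled [a]. *)
Lemma fillable_spur u a w : fillable Γ (u ++ w) -> fillable Γ (u ++ a :: inv_letter a :: w).
Proof.
move=> fl m.
have [T [phi [eps [h [dev [b [s [[D eb lv ew] lem]]]]]]]] := fl m.+2.
set A := [set d | _] in lem.
have /card_gt0P[d dA] : 0 < #|A| by apply: leq_trans lem.
have /card_gt0P[d' dA'] : 0 < #|A :\ d| by move: lem; rewrite (cardsD1 d) dA add1n ltnS => /(leq_ltn_trans (leq0n m)).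
move: dA dA'; rewrite !inE => /andP[/eqP ed db] /and3P[dd /eqP ed' db'].
have nO z : eps z = z -> z != b -> z \notin b :: s.
  by move=> ez zb; rewrite inE (negPf zb); apply: contraL (introT eqP ez) => /lv.
have dO := nO _ ed db; have dO' := nO _ ed' db'.
have pd := dg_dead D ed dO; have pd' := dg_dead D ed' dO'.
have [s1 [s2 [es eu ew']]] : exists s1 s2, [/\ s = s1 ++ s2, u = [seq lb h d | d <- s1] & w = [seq lb h d | d <- s2]].
  exists (take (size u) s), (drop (size u) s); rewrite cat_take_drop map_take map_drop -ew.
  by rewrite take_size_cat // drop_size_cat.
set x := last b s1; set t1 := belast b s1.
have et : b :: s1 = rcons t1 x by rewrite lastI.
set q := s2 ++ t1.
have rotE : rot (size (b :: s1)) (b :: s) = rcons q x by rewrite es -cat_cons rot_size_cat et rcons_cat.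
have c0 : fcycle phi (rcons q x) by rewrite -rotE rot_cycle; exact: dg_cycle D.
have u0 : uniq (rcons q x) by rewrite -rotE rot_uniq; exact: dg_uniq D.
have memO z : (z \in rcons q x) = (z \in b :: s) by rewrite -rotE mem_rot.
have xO : x \in b :: s by rewrite -memO mem_rcons mem_head.
have xd : x != d by apply: contraNneq dO => <-.
have xd' : x != d' by apply: contraNneq dO' => <-.
have dd' : d != d' by rewrite eq_sym.
pose phi1 : {perm T} := (tperm x d * phi)%g.
pose phi' : {perm T} := (tperm d d' * phi1)%g.
pose eps' : {perm T} := (tperm d d' * eps)%g.
have px : phi' x = d by rewrite permM tpermD 1?eq_sym // permM tpermL pd.
have pd1 : phi' d = d' by rewrite permM tpermL permM tpermD // pd'.
have pd2 : phi' d' = phi x by rewrite permM tpermR permM tpermR.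
have pE z : z != x -> z != d -> z != d' -> phi' z = phi z.
  by move=> h1 h2 h3; rewrite permM tpermD 1?eq_sym // permM tpermD // eq_sym.
have e1 : eps' d = d' by rewrite permM tpermL.
have e2 : eps' d' = d by rewrite permM tpermR.
have eE z : z != d -> z != d' -> eps' z = eps z by move=> h1 h2; rewrite permM tpermD // eq_sym.
pose h' z := if z == d then free_step Γ a else if z == d' then free_step Γ (inv_letter a) else h z.
pose dev' z := if z == d then dev (phi x) else if z == d' then dev (phi x) ++ [:: a] else dev z.
have lbd : lb h' d = a by rewrite /lb /h' eqxx free_label.
have lbd' : lb h' d' = inv_letter a by rewrite /lb /h' (negPf dd) eqxx free_label.
have lbE z : z != d -> z != d' -> lb h' z = lb h z by move=> h1 h2; rewrite /lb /h' (negPf h1) (negPf h2).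
have dvd : dev' d = dev (phi x) by rewrite /dev' eqxx.
have dvd' : dev' d' = dev (phi x) ++ [:: a] by rewrite /dev' (negPf dd) eqxx.
have dvE z : z != d -> z != d' -> dev' z = dev z by move=> h1 h2; rewrite /dev' (negPf h1) (negPf h2).
have nd z : z \in b :: s -> z != d /\ z != d'.
  by move=> zO; split; [apply: contraNneq dO => <-|apply: contraNneq dO' => <-].
have fixedE z : eps' z = z -> [/\ z != d, z != d' & eps z = z].
  have [->|h1] := eqVneq z d; first by rewrite e1 => e; rewrite e eqxx in dd.
  have [->|h2] := eqVneq z d'; first by rewrite e2 => e; rewrite -e eqxx in dd.
  by rewrite eE.
have liveE z : z != d -> z != d' -> eps' z != z -> eps z != z by move=> h1 h2; rewrite eE.
have pnd z : z != d -> z != d' -> phi z != d /\ phi z != d'.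
  by move=> h1 h2; split; [apply: contraNneq h1|apply: contraNneq h2] => e; rewrite -(inj_eq (@perm_inj _ phi)) e ?pd ?pd'.
have end_ z : z != d -> z != d' -> eps z != d /\ eps z != d'.
  by move=> h1 h2; split; [apply: contraNneq h1|apply: contraNneq h2] => e; rewrite -(inj_eq (@perm_inj _ eps)) e ?ed ?ed'.
exists T, phi', eps', h', dev', b, (s1 ++ d :: d' :: s2); split; last first.
  apply: leq_trans (_ : #|A :\ d :\ d'| <= _).
    move: lem; rewrite (cardsD1 d) (cardsD1 d' (A :\ d)) !inE ed ed' db db' dd !eqxx /= !add1n; exact.
  apply/subset_leq_card/subsetP => z; rewrite !inE => /and4P[h1 h2 h3 h4].
  by rewrite eE // h3.
have O'E z : (z \in b :: s1 ++ d :: d' :: s2) = [|| z == d, z == d' | z \in b :: s].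
  by rewrite es !inE !mem_cat !inE; case: (z == b); case: (z == d); case: (z == d'); case: (z \in s1); case: (z \in s2).
split; last 1 first.
- rewrite map_cat /= lbd lbd' eu ew'; congr (_ ++ _ :: _ :: _); apply/eq_in_map => z zs;
    (have [|h1 h2] := nd z; [by rewrite es inE mem_cat zs ?orbT|by rewrite lbE]).
- split.
  + move=> z; have [->|h1] := eqVneq z d; first by rewrite e1 e2.
    have [->|h2] := eqVneq z d'; first by rewrite e2 e1.
    have [h3 h4] := end_ z h1 h2; rewrite (eE z) // eE //; exact: dg_epsK D z.
  + move=> z /fixedE[h1 h2 ez]; rewrite O'E (negPf h1) (negPf h2) => zO.
    by rewrite pE //; [apply: (dg_dead D)|apply: contraNneq zO => ->].
  + move=> z lz; have [->|h1] := eqVneq z d; first by rewrite e1 lbd lbd'.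
    have [->|h2] := eqVneq z d'; first by rewrite e2 lbd lbd' inv_letterK.
    have [h3 h4] := end_ z h1 h2; rewrite eE // !lbE //; apply: (dg_label D); exact: liveE lz.
  + move=> z; rewrite O'E => nz lz.
    have [h1 h2 zO] : [/\ z != d, z != d' & z \notin b :: s].
      by move: nz; case: (z == d); case: (z == d'); case: (z \in b :: s).
    have [h3 h4] := pnd z h1 h2.
    have h5 : z != x by apply: contraNneq zO => ->.
    rewrite pE // /h' (negPf h1) (negPf h2) (negPf h3) (negPf h4).
    by apply: (dg_walk D) => //; exact: liveE lz.
  + move=> z lz; have [->|h1] := eqVneq z d; first by rewrite e1 dvd dvd' lbd; exact: geqxx.
    have [->|h2] := eqVneq z d'.
      rewrite e2 dvd dvd' lbd' -catA; apply: geqC.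
      have := geq_catl (dev (phi x)) (geq_free Γ [::] a [::]); rewrite cats0; exact.
    have [h3 h4] := end_ z h1 h2; rewrite eE // !dvE // lbE //; apply: (dg_eps D); exact: liveE lz.
  + move=> z lz; have [->|h1] := eqVneq z d; first by rewrite pd1 dvd dvd' lbd; exact: geqxx.
    have [->|h2] := eqVneq z d'.
      have [h3 h4] := pnd x xd xd'.
      rewrite pd2 dvE // dvd' lbd' -catA; apply: geqC.
      have := geq_catl (dev (phi x)) (geq_free Γ [::] a [::]); rewrite cats0; exact.
    have [h3 h4] := pnd z h1 h2; rewrite lbE // (dvE z) //.
    have [e|h5] := eqVneq z x; last by rewrite pE // dvE //; apply: (dg_phi D); exact: liveE lz.
    by rewrite e px dvd -e; apply: (dg_phi D); exact: liveE lz.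
  + move=> z /fixedE[h1 h2 ez]; have [h3 h4] := pnd z h1 h2; rewrite (dvE z) //.
    have [e|h5] := eqVneq z x; last by rewrite pE // dvE //; apply: (dg_null D).
    by rewrite e px dvd; apply: (dg_null D); rewrite -e.
  + have pl1 := planar_attach xd pd ed (dg_planar D).
    have pl2 : planar phi' eps.
      by apply: planar_attach dd' _ ed' pl1; rewrite permM tpermD // eq_sym.
    exact: planar_join dd' ed ed' pd1 pl2.
  + rewrite -cat_cons -(rot_cycle (size (b :: s1))) rot_size_cat et.
    have -> : (d :: d' :: s2) ++ rcons t1 x = rot 0 ([:: d; d'] ++ rcons q x) by rewrite rot0 /q -rcons_cat.
    rewrite rot0 -(rot_cycle 2) -[2]/(size [:: d; d']) rot_size_cat -cat_rcons cats1 fcycle_rcons.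
    rewrite 2!rcons_path !last_rcons /= px pd1 !eqxx !andbT.
    move: c0; rewrite fcycle_rcons; apply: fpath_change => // z zq.
    have zO : z \in b :: s by rewrite -memO mem_rcons inE zq orbT.
    have [h1 h2] := nd z zO; apply: pE => //.
    by move: u0; rewrite rcons_uniq => /andP[xq _]; apply: contraNneq xq => <-.
  + rewrite -cat_cons -(rot_uniq (size (b :: s1))) rot_size_cat et.
    have -> : (d :: d' :: s2) ++ rcons t1 x = [:: d; d'] ++ rcons q x by rewrite /q -rcons_cat.
    by rewrite /= u0 inE !memO (negPf dO) (negPf dO') (negPf dd').
- by rewrite eE // eq_sym.
- move=> z; rewrite mem_cat !inE => zs; have [e|h1] := eqVneq z d; first by rewrite e e1.
  have [e|h2] := eqVneq z d'; first by rewrite e e2 eq_sym.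
  by rewrite eE //; apply: lv; move: zs; rewrite es mem_cat (negPf h1) (negPf h2).
Qed.

(** The word [r] followed by its inverse can be inserted by hairs alone. The inverse is read on a
    closed path too, so it can then be cut off as a face. *)
Lemma fillable_insert u r w (v0 : V Δ) (p : seq (step Δ)) :
  valid v0 p -> path_end v0 p = v0 -> label_of p = r ->
  fillable Γ (u ++ w) -> fillable Γ (u ++ r ++ w).
Proof.
move=> vp ce lp fl; case: (classic (r = [::])) => [->//|rn].
have [vr cr] := rpath_valid vp; rewrite ce in vr cr.
have lr : label_of (rpath p) = inv_word r by rewrite label_rpath lp.
have rn' : inv_word r <> [::] by move/(congr1 size); rewrite size_inv; case: (r) rn.
rewrite catA; apply: (fillable_cut rn' vr cr lr); rewrite -catA.
elim/last_ind: {vr cr lr lp rn rn' vp ce p} r w fl => [|r a IH] w fl //.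
have -> : u ++ rcons r a ++ inv_word (rcons r a) ++ w = (u ++ r) ++ a :: inv_letter a :: (inv_word r ++ w).
  by rewrite inv_rcons -cats1 -!catA.
apply: fillable_spur.
by rewrite -catA; apply: IH.
Qed.

(** The congruence is symmetric, so each generating move has to be followed both ways: cutting a
    face removes letters, hairs and faces create them. *)
Lemma fillable_geq u v : S -> u ≡ v -> fillable Γ u <-> fillable Γ v.
Proof.
move=> x0; elim=> {u v} [u|u v _ IH|u v w _ IH1 _ IH2|u a w|u r w rr] //.
- by split=> /IH.
- by split=> [/IH1/IH2|/IH2/IH1].
- suff : fillable Γ (u ++ [:: a; inv_letter a] ++ w) <-> fillable Γ (u ++ w) by [].
  split; last exact: fillable_spur.
  pose p := [:: free_step Γ a; rstep (free_step Γ a)].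
  apply: (@fillable_cut _ _ _ _ _ (step_src (free_step Γ a)) p) => //.
  + by rewrite /= rstep_src.
  + by rewrite /= rstep_tgt.
  + by rewrite /= rstep_label free_label.
- suff : fillable Γ (u ++ r ++ w) <-> fillable Γ (u ++ w) by [].
  have [v [p [[ne [vp [ce _]]] er]]] := rr.
  have vp' : valid (inl v : V Δ) [seq lift st | st <- p].
    by elim: p v vp {ne ce er} => //= st p IH v [e /IH]; rewrite lift_src lift_tgt e.
  have ce' : path_end (inl v : V Δ) [seq lift st | st <- p] = inl v by rewrite lift_end ce.
  have lp : label_of [seq lift st | st <- p] = r by rewrite lift_label.
  split; last exact: fillable_insert vp' ce' lp.
  by apply: fillable_cut vp' ce' lp; rewrite er; case: (p) ne.
Qed.

Theorem trivial_fillable w : S -> w ≡ [::] -> fillable Γ w.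
Proof. by move=> x0 /(fillable_geq x0)[_]; apply; apply: fillable_nil. Qed.
End Fill.

(** * Reduction of diagrams *)

Section RemoveDarts.
Variable T : finType.
Implicit Types (f : {perm T}) (x y z c : T).

Lemma rem_inv f c (P : T -> T -> Prop) :
  P c c -> (forall a, P a c -> P a (f c)) -> (forall a, P a (f a)) -> forall a, P a (rem f c a).
Proof.
move=> pc pt pf a; rewrite remE; case: eqP => [->//|_].
by case: eqP => [e|_]; [apply: pt; rewrite -e|].
Qed.

(** After the deletion a dart is sent to the end of a chain through the two deleted ones. [P] is
    carried along that chain, so that several invariants share this case analysis. *)
Lemma dela_inv f (b : {perm T}) x (P : T -> T -> Prop) :
  b x != x ->
  P x x -> P (b x) (b x) ->
  (forall a, P a x -> P a (f (b x))) -> (forall a, P a (b x) -> P a (f x)) ->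
  (forall a, a != x -> a != b x -> P a (f a)) -> forall a, P a (dela f b x a).
Proof.
move=> nx px pbx h1 h2 h3.
set f1 := (tperm x (b x) * f)%g.
have f1x : f1 x = f (b x) by rewrite permM tpermL.
have f1bx : f1 (b x) = f x by rewrite permM tpermR.
have P1 a : P a (f1 a).
  have [->|n1] := eqVneq a x; first by rewrite f1x; apply: h1.
  have [->|n2] := eqVneq a (b x); first by rewrite f1bx; apply: h2.
  by rewrite permM tpermD 1?eq_sym //; apply: h3.
have P2 : forall a, P a (rem f1 x a) by apply: rem_inv => // a; rewrite f1x; apply: h1.
rewrite /dela -/f1; apply: rem_inv => // a pa.
rewrite remE (negPf nx) f1bx; case: eqP => [e|_]; last exact: h2.
by rewrite f1x; apply: h1; rewrite -e; apply: h2.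
Qed.

Lemma delaE_away f (b : {perm T}) x a : a != x -> a != b x -> f a != x -> f a != b x -> dela f b x a = f a.
Proof.
move=> h1 h2 h3 h4; set f1 := (tperm x (b x) * f)%g.
have e : f1 a = f a by rewrite permM tpermD 1?eq_sym.
have e1 : rem f1 x a = f a by rewrite remE e (negPf h1) (negPf h3).
by rewrite /dela remE e1 (negPf h2) (negPf h4).
Qed.

Lemma dela_x f (b : {perm T}) x : b x != x -> dela f b x x = x.
Proof. by move=> nx; rewrite /dela !remE eqxx [x == b x]eq_sym (negPf nx). Qed.

Lemma dela_bx f (b : {perm T}) x : dela f b x (b x) = b x.
Proof. by rewrite /dela remE eqxx. Qed.
End RemoveDarts.

Lemma fcycle_agree (T : eqType) (f g : T -> T) (O : seq T) :
  {in O, f =1 g} -> fcycle f O -> fcycle g O.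
Proof.
move=> ag; rewrite (@eq_in_cycle _ (mem O) _ (frel g)) //.
by move=> x y xO yO /=; rewrite ag.
Qed.

Lemma fcycle_map (T : eqType) (f g sg : T -> T) (O : seq T) :
  {in O, forall z, g (sg z) = sg (f z)} -> fcycle f O -> fcycle g [seq sg z | z <- O].
Proof.
move=> ag c; have hO : all (mem O) O by apply/allP.
have h : {in mem O &, {homo sg : x y / frel f x y >-> frel g x y}}.
  by move=> x y xO _ /= /eqP <-; rewrite ag.
exact: homo_cycle_in h hO c.
Qed.

Section Reduce.
Variables (S : Type) (Γ : LGraph S).
Notation Δ := (plus Γ).
Notation "u ≡ v" := (geq Γ u v) (at level 70).

Lemma geq_backtrack g a : g ≡ (g ++ [:: a]) ++ [:: inv_letter a].
Proof.
rewrite -catA; apply: geqC; have := geq_catl g (geq_free Γ [::] a [::]).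
by rewrite cats0.
Qed.

Section Ops.
Variables (T : finType) (phi eps : {perm T}) (h : T -> step Δ) (dev : T -> word S) (O : seq T).
Hypothesis D : diagram (Γ := Γ) phi eps h dev O.

Lemma diagram_relabel (h' : T -> step Δ) :
  (forall d, step_label (h' d) = step_label (h d)) ->
  (forall d, d \notin O -> eps d != d -> step_tgt (h' d) = step_src (h' (phi d))) ->
  diagram (Γ := Γ) phi eps h' dev O.
Proof.
move=> hl hw; case: D => k1 k2 k3 k4 k5 k6 k7 k8 k9 k10.
by split=> // d ld; rewrite /lb ?hl; [apply: k3|apply: k5|apply: k6].
Qed.

(** Both sides of the edge lie on the same edge of Δ, so the outline left after its removal is still
    a closed path there. *)
Lemma diagram_del x : eps x != x -> x \notin O -> eps x \notin O -> h (eps x) = rstep (h x) ->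
  diagram (Γ := Γ) (dela phi eps x) (delb eps x) h dev O.
Proof.
move=> lx xO x'O hx'; set x' := eps x in lx x'O hx' *.
have ex' : eps x' = x by apply: dg_epsK D x.
have epsE d : delb eps x d = if (d == x) || (d == x') then d else eps d by rewrite delbE.
have fixE d : delb eps x d != d -> [/\ d != x, d != x' & eps d != d].
  by rewrite epsE; case: (eqVneq d x) => [->|] /=; [rewrite eqxx|case: (eqVneq d x') => [->|]; rewrite ?eqxx].
have lbx' : lb h x' = inv_letter (lb h x) by apply: (dg_label D).
have Oclosed := fcycle_mem _ (dg_cycle D).
have awayO d : d \in O -> d != x /\ d != x'.
  by move=> dO; split; [apply: contraNneq xO => <-|apply: contraNneq x'O => <-].
pose isx d := (d == x) || (d == x').
have dvx : dev x' ≡ dev x ++ [:: lb h x] by apply: (dg_eps D).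
have lx' : eps x' != x' by rewrite ex' eq_sym.
have dvpx : dev (phi x) ≡ dev x' by apply: geqT (dg_phi D lx) (geqC dvx).
have dvpx' : dev (phi x') ≡ dev x.
  apply: geqT (dg_phi D lx') _; rewrite lbx'.
  by apply: geqT (geq_catr _ dvx) _; apply: geqC; apply: geq_backtrack.
have devP : forall a, dev (dela phi eps x a) ≡ if isx a || (eps a == a) then dev a else dev a ++ [:: lb h a].
  apply: (@dela_inv _ phi eps x (fun a b => dev b ≡ if isx a || (eps a == a) then dev a else dev a ++ [:: lb h a])) => //.
  - by rewrite /isx eqxx; exact: geqxx.
  - by rewrite /isx eqxx orbT; exact: geqxx.
  - by move=> a; apply: geqT.
  - by move=> a; apply: geqT.
  - move=> a n1 n2; rewrite /isx (negPf n1) (negPf n2) /=; case: eqP => [e|/eqP ne]; first exact: dg_null D _ e.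
    exact: (dg_phi D).
pose ev a := if isx a then step_src (h a) else step_tgt (h a).
have walkP : forall a, ((dela phi eps x a) \in O) = (a \in O) /\
    (a \notin O -> eps a != a -> ev a = step_src (h (dela phi eps x a))).
  have tx' : step_tgt (h x') = step_src (h x) by rewrite hx' rstep_tgt.
  have sx' : step_src (h x') = step_tgt (h x) by rewrite hx' rstep_src.
  have e1 : step_src (h (phi x')) = step_src (h x) by rewrite -(dg_walk D).
  have e2 : step_src (h (phi x)) = step_src (h x') by rewrite -(dg_walk D).
  apply: (@dela_inv _ phi eps x (fun a b => (b \in O) = (a \in O) /\ (a \notin O -> eps a != a -> ev a = step_src (h b)))) => //.
  - by split=> // _ _; rewrite /ev /isx eqxx.
  - by split=> // _ _; rewrite /ev /isx eqxx orbT.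
  - by move=> a [m1 m2]; rewrite Oclosed (negPf x'O) -m1 (negPf xO) e1; split=> // k1 k2; apply: m2; rewrite // -m1.
  - by move=> a [m1 m2]; rewrite Oclosed (negPf xO) -m1 (negPf x'O) e2; split=> // k1 k2; apply: m2; rewrite // -m1.
  - move=> a n1 n2; split; first exact: Oclosed.
    by move=> k1 k2; rewrite /ev /isx (negPf n1) (negPf n2); apply: (dg_walk D).
have fixed d : eps d = d -> [/\ d != x & d != x'].
  by move=> ed; split; apply/eqP => e; [have := lx; rewrite /x' -e ed eqxx|have := lx'; rewrite -e ed eqxx].
split.
- move=> d; rewrite !epsE; have [dx|] := boolP ((d == x) || (d == x')); first by rewrite dx.
  rewrite negb_or => /andP[n1 n2].
  have -> : (eps d == x) = false by apply/negbTE; apply: contraNneq n2 => e; rewrite -(inj_eq (@perm_inj _ eps)) e ex'.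
  have -> : (eps d == x') = false by apply/negbTE; apply: contraNneq n1 => e; rewrite -(inj_eq (@perm_inj _ eps)) e.
  exact: dg_epsK D d.
- move=> d; rewrite epsE; case: (eqVneq d x) => [->|n1] /=; first by move=> _ _; rewrite dela_x.
  case: (eqVneq d x') => [->|n2] /=; first by move=> _ _; rewrite dela_bx.
  by move=> ed dO; have fd := dg_dead D ed dO; rewrite delaE_away ?fd.
- move=> d /fixE[n1 n2 ld]; rewrite epsE (negPf n1) (negPf n2); exact: dg_label D _ ld.
- move=> d dO /fixE[n1 n2 ld]; have [_ /(_ dO ld)] := walkP d.
  by rewrite /ev /isx (negPf n1) (negPf n2).
- move=> d /fixE[n1 n2 ld]; rewrite epsE (negPf n1) (negPf n2); exact: dg_eps D _ ld.
- by move=> d /fixE[n1 n2 ld]; have := devP d; rewrite /isx (negPf n1) (negPf n2) (negPf ld).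
- move=> d; rewrite epsE => e; have := devP d; rewrite /isx; move: e.
  by case: ifP => //= _ ->; rewrite eqxx.
- apply: planar_del => //; exact: dg_planar D.
- apply: fcycle_agree (dg_cycle D) => d dO; have [n1 n2] := awayO _ dO.
  have pO : phi d \in O by rewrite Oclosed.
  have [n3 n4] := awayO _ pO.
  by rewrite delaE_away.
- exact: dg_uniq D.
Qed.

End Ops.

Section Faces.
Variables (T : finType) (phi eps : {perm T}) (h : T -> step Δ) (dev : T -> word S) (O : seq T).
Hypothesis D : diagram (Γ := Γ) phi eps h dev O.
Hypothesis lO : {in O, forall d, eps d != d}.

Lemma dg_live_phi d : (eps (phi d) != phi d) = (eps d != d).
Proof.
have fx z : eps z = z -> phi z = z.
  by move=> ez; apply: (dg_dead D) => //; apply: contraL (introT eqP ez) => /lO.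
congr negb; apply/eqP/eqP => [e|e]; last by rewrite (fx _ e) e.
by have e1 := perm_inj (fx _ e); rewrite -e1 e.
Qed.

Lemma dg_porbit d z : z \in porbit phi d -> (z \in O) = (d \in O) /\ (eps z != z) = (eps d != d).
Proof.
move=> /porbitP[k ->]; rewrite permX; elim: k => //= k [<- <-].
by rewrite dg_live_phi (fcycle_mem _ (dg_cycle D)).
Qed.

Lemma dg_inner_walk x r : x \notin O -> eps x != x -> fpath phi x r ->
  valid (step_src (h x)) [seq h d | d <- x :: r] /\
  path_end (step_src (h x)) [seq h d | d <- x :: r] = step_tgt (h (last x r)).
Proof.
elim: r x => [|y r IH] x xO lx //= /andP[/eqP e p].
have yO : y \notin O by rewrite -e (fcycle_mem _ (dg_cycle D)).
have ly : eps y != y by rewrite -e dg_live_phi.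
by have [[_ h1] h2] := IH y yO ly p; rewrite (dg_walk D) // e.
Qed.

(** The two darts end at one vertex of Δ, where the closed path of the face splits into two. The
    label between them is trivial, so [dev] remains consistent. *)
Lemma dg_split x y : x \notin O -> eps x != x -> x != y -> y \in porbit phi x ->
  step_tgt (h x) = step_tgt (h y) -> diagram (Γ := Γ) (tperm x y * phi)%g eps h dev O.
Proof.
move=> xO lx nxy yx e; have [yO ly] := dg_porbit yx; rewrite (negPf xO) in yO; rewrite lx in ly.
move/negbT: yO => yO.
have pE d : (tperm x y * phi)%g d = if d == x then phi y else if d == y then phi x else phi d.
  rewrite permM; case: (eqVneq d x) => [->|nx]; first by rewrite tpermL.
  by case: (eqVneq d y) => [->|ny]; [rewrite tpermR|rewrite tpermD // eq_sym].
have dv : dev (phi y) ≡ dev (phi x).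
  have : y \in porbit phi (phi x) by rewrite -eq_porbit_mem porbit_perm1 eq_porbit_mem.
  case/porbitP => k; rewrite permX => ey.
  have pO : phi x \notin O by rewrite (fcycle_mem _ (dg_cycle D)).
  have lp : eps (phi x) != phi x by rewrite dg_live_phi.
  have fp := fpath_traject phi (phi x) k.
  have lst : last (phi x) (traject phi (phi (phi x)) k) = y by rewrite last_traject.
  have [w1 w2] := dg_inner_walk pO lp fp; rewrite lst -e (dg_walk D) // in w2.
  have lv : {in phi x :: traject phi (phi (phi x)) k, forall d, eps d != d}.
    rewrite -trajectS => d /trajectP[j _ ->].
    by elim: j => //= j IH; rewrite dg_live_phi.
  have := fpath_dev D fp lv; rewrite lst => h1; apply: geqT h1 _.
  have -> : [seq lb h d | d <- phi x :: traject phi (phi (phi x)) k] = label_of [seq h d | d <- phi x :: traject phi (phi (phi x)) k].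
    by rewrite label_ofE -map_comp.
  by have := geq_catl (dev (phi x)) (closed_trivial w1 w2); rewrite cats0.
case: D => k1 k2 k3 k4 k5 k6 k7 k8 k9 k10; split=> //.
- move=> d ed dO; rewrite pE; case: eqP => [e1|_]; first by rewrite -e1 ed eqxx in lx.
  by case: eqP => [e1|_]; [rewrite -e1 ed eqxx in ly|apply: k2].
- move=> d dO ld; rewrite pE; case: eqP => [->|_]; first by rewrite e k4.
  by case: eqP => [->|_]; [rewrite -e k4|apply: k4].
- move=> d ld; rewrite pE; case: eqP => [->|_]; first by apply: geqT dv _; apply: k6.
  by case: eqP => [->|_]; [apply: geqT (geqC dv) _; apply: k6|apply: k6].
- move=> d ed; rewrite pE; case: eqP => [e1|_]; first by rewrite -e1 ed eqxx in lx.
  by case: eqP => [e1|_]; [rewrite -e1 ed eqxx in ly|apply: k7].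
- exact: planar_split.
- apply: fcycle_agree k9 => d dO; rewrite pE; case: eqP => [e1|_]; first by rewrite -e1 dO in xO.
  by case: eqP => [e1|_] //; rewrite -e1 dO in yO.
Qed.

(** The bigon is squeezed by deleting the edge of [d2]. If another inner face lies behind it, the
    bigon first adopts the edge of Δ used there; if the outer face does, [d1], which has the same
    label, replaces the deleted dart on the boundary. *)
Lemma dg_bigon d1 d2 : phi d1 = d2 -> phi d2 = d1 -> d1 != d2 -> d2 \notin O -> eps d2 != d2 ->
  h d2 = rstep (h d1) -> exists (phi3 : {perm T}) h3 O3,
  [/\ diagram (Γ := Γ) phi3 (delb eps d2) h3 dev O3, {in O3, forall d, delb eps d2 d != d} &
      [seq lb h3 d | d <- O3] = [seq lb h d | d <- O]].
Proof.
move=> p1 p2 n12 O2 l2 h21; set e2 := eps d2 in l2.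
have ee2 : eps e2 = d2 by apply: dg_epsK D d2.
have O1 : d1 \notin O by rewrite -p2 (fcycle_mem _ (dg_cycle D)).
have l1 : eps d1 != d1 by rewrite -p2 dg_live_phi.
have lbe2 : lb h e2 = inv_letter (lb h d2) by apply: (dg_label D).
have epsE d : delb eps d2 d = if (d == d2) || (d == e2) then d else eps d by rewrite delbE.
have lO2 : e2 \notin O -> {in O, forall d, delb eps d2 d != d}.
  move=> eO d dO; rewrite epsE ifN; first exact: lO.
  by rewrite negb_or; apply/andP; split; [apply: contraNneq O2|apply: contraNneq eO] => <-.
have [e21|ne21] := eqVneq e2 d1.
  exists (dela phi eps d2), h, O; split=> //; last by apply: lO2; rewrite e21.
  by apply: diagram_del => //; rewrite -/e2 e21 // h21 rstepK.
have [eO|eO] := boolP (e2 \in O); last first.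
  pose h' z := if z == d1 then h e2 else if z == d2 then rstep (h e2) else h z.
  have lbh z : step_label (h' z) = step_label (h z).
    rewrite /h'; case: eqP => [->|_].
      by rewrite -[LHS]/(lb h e2) lbe2 /lb h21 rstep_label inv_letterK.
    by case: eqP => [->|_] //; rewrite rstep_label -[step_label (h e2)]/(lb h e2) lbe2 inv_letterK.
  have D' : diagram (Γ := Γ) phi eps h' dev O.
    apply: (diagram_relabel D) => // z zO lz; rewrite /h'.
    case: (eqVneq z d1) => [->|nz1]; first by rewrite p1 eq_sym (negPf n12) eqxx rstep_src.
    case: (eqVneq z d2) => [->|nz2]; first by rewrite p2 eqxx rstep_tgt.
    have -> : phi z == d1 = false by apply/negbTE; apply: contraNneq nz2; rewrite -p2 => /perm_inj ->.
    have -> : phi z == d2 = false by apply/negbTE; apply: contraNneq nz1; rewrite -p1 => /perm_inj ->.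
    exact: (dg_walk D).
  exists (dela phi eps d2), h', O; split; [|exact: lO2|].
    apply: (diagram_del D') => //; rewrite -/e2 /h' (negPf ne21) eqxx.
    by rewrite (negPf l2) eq_sym (negPf n12) rstepK.
  by apply: eq_map => z; rewrite /lb lbh.
have O2' := O2.
pose sg z := if z == e2 then d1 else z.
set phi3 := dela phi eps d2.
have neO z : z \in O -> z != d1 /\ z != d2.
  by move=> zO; split; [apply: contraNneq O1 => <-|apply: contraNneq O2 => <-].
have dve2 : dev e2 ≡ dev d1.
  by apply: geqT (dg_eps D l2) _; rewrite -p2; apply/geqC/(dg_phi D).
have f3d2 : phi3 d2 = d2 by rewrite /phi3 dela_x.
have f3e2 : phi3 e2 = e2 by rewrite /phi3 dela_bx.
have phie2 : phi e2 != d2.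
  have h0 : phi e2 \in O by rewrite (fcycle_mem _ (dg_cycle D)).
  by case: (neO _ h0).
have f3d1 : phi3 d1 = sg (phi e2).
  set f1 := (tperm d2 (eps d2) * phi)%g.
  have h1 : f1 d1 = d2 by rewrite permM tpermD ?p1 // eq_sym.
  have h2 : f1 d2 = phi e2 by rewrite permM tpermL.
  have h3 : f1 e2 = d1 by rewrite permM tpermR.
  have h4 : rem f1 d2 d1 = phi e2 by rewrite remE (negPf n12) h1 eqxx h2.
  have h5 : rem f1 d2 e2 = d1 by rewrite remE (negPf l2) h3 (negPf n12).
  by rewrite /phi3 /dela -/f1 remE -/e2 h4 h5 eq_sym (negPf ne21).
have f3 z : z != d1 -> z != d2 -> z != e2 -> phi3 z = sg (phi z).
  move=> n1 n2 n3; set f1 := (tperm d2 (eps d2) * phi)%g.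
  have h1 : f1 z = phi z by rewrite permM tpermD // eq_sym.
  have h2 : f1 e2 = d1 by rewrite permM tpermR.
  have h5 : rem f1 d2 e2 = d1 by rewrite remE (negPf l2) h2 (negPf n12).
  have h4 : rem f1 d2 z = phi z.
    rewrite remE (negPf n2) h1; case: eqP => // e; case/negP: n1.
    by rewrite -(inj_eq (@perm_inj _ phi)) e p1.
  by rewrite /phi3 /dela -/f1 remE -/e2 (negPf n3) h4 h5.
have dvsg z : dev (sg z) ≡ dev z.
  by rewrite /sg; case: eqP => [->|_]; [exact: geqC|exact: geqxx].
have memO3 z : (z \in [seq sg y | y <- O]) = (z == d1) || (z \in O) && (z != e2).
  apply/mapP/idP => [[y yO ->]|].
    by rewrite /sg; case: (eqVneq y e2) => [_|ny]; [rewrite eqxx|rewrite yO ny orbT].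
  case/orP => [/eqP ->|/andP[zO ne]]; first by exists e2 => //; rewrite /sg eqxx.
  by exists z => //; rewrite /sg (negPf ne).
have liveE z : delb eps d2 z != z -> [/\ z != d2, z != e2 & eps z != z].
  by rewrite epsE; case: (eqVneq z d2) => [->|] /=; [rewrite eqxx|case: (eqVneq z e2) => [->|]; rewrite ?eqxx].
have le2 : eps e2 != e2 by rewrite ee2 eq_sym.
exists phi3, h, [seq sg y | y <- O]; split.
- split.
  + move=> d; rewrite !epsE; have [dx|] := boolP ((d == d2) || (d == e2)); first by rewrite dx.
    rewrite negb_or => /andP[m1 m2].
    have -> : (eps d == d2) = false by apply/negbTE; apply: contraNneq m2 => e; rewrite -(inj_eq (@perm_inj _ eps)) e ee2.
    have -> : (eps d == e2) = false by apply/negbTE; apply: contraNneq m1 => e; rewrite -(inj_eq (@perm_inj _ eps)) e.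
    exact: dg_epsK D d.
  + move=> d; rewrite epsE memO3; case: (eqVneq d d2) => [->|m1] //=; case: (eqVneq d e2) => [->|m2] //= ed.
    have dO : d \notin O by apply: contraL (introT eqP ed) => /lO.
    rewrite negb_or => /andP[m3 _]; rewrite f3 //.
    by rewrite (dg_dead D) // /sg (negPf m2).
  + move=> d /liveE[m1 m2 ld]; rewrite epsE (negPf m1) (negPf m2); exact: dg_label D _ ld.
  + move=> d; rewrite memO3 negb_or => /andP[m0 m3] /liveE[m1 m2 ld].
    rewrite m2 andbT in m3; rewrite f3 // /sg ifN; first exact: (dg_walk D).
    by apply: contraNneq m3 => e; rewrite -(fcycle_mem _ (dg_cycle D)) e.
  + move=> d /liveE[m1 m2 ld]; rewrite epsE (negPf m1) (negPf m2); exact: dg_eps D _ ld.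
  + move=> d /liveE[m1 m2 ld]; case: (eqVneq d d1) => [->|m0].
      rewrite f3d1; apply: geqT (dvsg _) _; apply: geqT (dg_phi D le2) _.
      rewrite lbe2 /lb h21 rstep_label inv_letterK.
      exact: geq_catr.
    by rewrite f3 //; apply: geqT (dvsg _) _; apply: (dg_phi D).
  + move=> d; rewrite epsE; case: (eqVneq d d2) => [->|m1] //=; first by rewrite f3d2 => _; exact: geqxx.
    case: (eqVneq d e2) => [->|m2] //= ed; first by rewrite f3e2; exact: geqxx.
    have m0 : d != d1 by apply: contraNneq l1 => <-; rewrite ed.
    by rewrite f3 //; apply: geqT (dvsg _) _; apply: (dg_null D).
  + apply: planar_del => //; exact: dg_planar D.
  + apply: fcycle_map (dg_cycle D) => z zO; have [m1 m2] := neO _ zO.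
    by rewrite {1}/sg; case: (eqVneq z e2) => [->|m3] //; rewrite f3.
  + rewrite map_inj_in_uniq; first exact: dg_uniq D.
    move=> y z yO zO; rewrite /sg; have [m1 _] := neO _ yO; have [m2 _] := neO _ zO.
    case: (eqVneq y e2) => [->|_]; case: (eqVneq z e2) => [->|_] // e; first by rewrite e eqxx in m2.
    by rewrite e eqxx in m1.
- move=> z; rewrite memO3 epsE; case: (eqVneq z d1) => [->|m0] /=.
    by rewrite (negPf n12) [d1 == e2]eq_sym (negPf ne21).
  by case/andP => zO m2; rewrite (negPf m2) orbF; have [_ /negPf ->] := neO _ zO; apply: lO.
- rewrite -map_comp; apply/eq_in_map => z _ /=; rewrite /sg; case: eqP => [->|//].
  by rewrite lbe2 /lb h21 rstep_label inv_letterK.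
Qed.

(** The automorphism moves the closed path of one face so that it agrees with the neighbouring face
    on the common edge, which can then be deleted. *)
Lemma dg_fold x fV fE : x \notin O -> eps x != x -> eps x \notin O -> eps x \notin porbit phi x ->
  lp_aut Δ fV fE -> fE (h x).1 = (h (eps x)).1 ->
  exists h3, diagram (Γ := Γ) (dela phi eps x) (delb eps x) h3 dev O /\ lb h3 =1 lb h.
Proof.
move=> xO lx x'O nx' [_ [_ au]] e.
pose h' z : step Δ := if z \in porbit phi x then (fE (h z).1, (h z).2) else h z.
have lbh z : step_label (h' z) = step_label (h z).
  by rewrite /h'; case: ifP => // _; congr pair; have [_ [_ e1]] := au (h z).1.
have srcE st : step_src ((fE st.1, st.2) : step Δ) = fV (step_src st).
  by have [e1 [e2 _]] := au st.1; rewrite /step_src; case: st.2.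
have tgtE st : step_tgt ((fE st.1, st.2) : step Δ) = fV (step_tgt st).
  by have [e1 [e2 _]] := au st.1; rewrite /step_tgt; case: st.2.
have D' : diagram (Γ := Γ) phi eps h' dev O.
  apply: (diagram_relabel D) => // z zO lz; rewrite /h'.
  have -> : (phi z \in porbit phi x) = (z \in porbit phi x) by rewrite -!eq_porbit_mem porbit_perm1.
  by case: ifP => _; rewrite ?srcE ?tgtE (dg_walk D).
exists h'; split; last by move=> z; rewrite /lb lbh.
apply: (diagram_del D') => //; rewrite /h' porbit_id (negPf nx').
have := dg_label D lx; rewrite /lb /step_label /inv_letter /= => -[_].
by rewrite /rstep e /=; case: (h (eps x)) => ? ? /= ->.
Qed.
End Faces.

Lemma NoDup_map_in (T : eqType) (A : Type) (f : T -> A) (s : seq T) : uniq s ->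
  {in s &, injective f} -> NoDup [seq f x | x <- s].
Proof.
elim: s => [|x s IH] /=; first by constructor.
case/andP=> xs us inj; constructor; last first.
  by apply: IH us _ => y z ys zs; apply: inj; rewrite inE ?ys ?zs orbT.
move=> h; have [y ys e] : exists2 y, y \in s & f y = f x.
  elim: s h {IH xs us inj} => //= y s IH [e|/IH[z zs e]]; first by exists y; rewrite ?mem_head.
  by exists z; rewrite ?inE ?zs ?orbT.
by case/negP: xs; rewrite (inj x y) ?mem_head ?inE ?ys ?orbT.
Qed.

(** The last field speaks of single edges. Thus it makes not only every arc between two inner faces
    a piece, but also every part of such an arc. *)
Record reduced_diagram (T : finType) (phi eps : {perm T}) h dev O : Prop := ReducedDiagram {
  rd_diagram : diagram (Γ := Γ) phi eps h dev O;
  rd_live : {in O, forall d, eps d != d};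
  rd_face : forall x, eps x != x -> x \notin O ->
    simple_cycle (step_src (h x)) [seq h d | d <- traject phi x #|porbit phi x|];
  rd_rigid : forall x, eps x != x -> x \notin O -> eps x \notin O -> eps x \notin porbit phi x ->
    forall fV fE, lp_aut Δ fV fE -> fE (h x).1 <> (h (eps x)).1 }.

(** Lexicographic order in one number: the live darts first, then the number of faces, which a
    splitting increases without touching the edges. *)
Definition weight (T : finType) (phi eps : {perm T}) :=
  #|[set z | eps z != z]| * #|T|.+1 + (#|T| - #|porbits phi|).

Lemma lex_ltn a b n p q : a < b -> a * n.+1 + (n - p) < b * n.+1 + (n - q).
Proof. by move=> lt; have : a.+1 * n.+1 <= b * n.+1; [rewrite leq_mul2r lt orbT|rewrite mulSn; lia]. Qed.

Lemma weight_delb (T : finType) (phi phi' eps : {perm T}) x : eps x != x -> eps (eps x) = x ->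
  weight phi' (delb eps x) < weight phi eps.
Proof.
move=> lx ex; rewrite /weight.
have h : #|[set z | delb eps x z != z]| < #|[set z | eps z != z]|.
  apply/proper_card/properP; split.
    by apply/subsetP => z; rewrite !inE delbE //; case: ifP => //; rewrite eqxx.
  by exists x; rewrite !inE // delbE // eqxx /= eqxx.
exact: lex_ltn.
Qed.

Lemma weight_split (T : finType) (phi eps : {perm T}) x y : x != y -> y \in porbit phi x ->
  weight (tperm x y * phi)%g eps < weight phi eps.
Proof.
move=> nxy yx; rewrite /weight.
have h := porbits_split nxy yx.
have : #|porbits (tperm x y * phi)%g| <= #|T| by rewrite /porbits; apply: leq_trans (leq_imset_card _ _) _; exact: max_card.
by rewrite h => le; rewrite ltn_add2l; apply: ltn_sub2l.
Qed.

(** A diagram of least weight admits no reduction: no splitting means that a face repeats no vertex,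
    no bigon to collapse that it repeats no edge, and no folding gives [rd_rigid]. *)
Theorem reduced_diagram_exists w : fillable Γ w -> w <> [::] ->
  exists (T : finType) (phi eps : {perm T}) h dev O,
    reduced_diagram phi eps h dev O /\ w = [seq lb h d | d <- O].
Proof.
move=> fl wn.
have [T [phi [eps [h [dev [O [D lO ew]]]]]]] : exists (T : finType) (phi eps : {perm T}) h dev O,
    [/\ diagram (Γ := Γ) phi eps h dev O, {in O, forall d, eps d != d} & w = [seq lb h d | d <- O]].
  have [T [phi [eps [h [dev [b [s [[D eb lv ew] _]]]]]]]] := fl 0.
  have sn : s <> [::] by move=> e; apply: wn; rewrite ew e.
  have pE z : z != b -> rem phi b z = if phi z == b then phi b else phi z.
    by move=> nz; rewrite remE (negPf nz).
  have pb : rem phi b b = b by rewrite remE eqxx.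
  have bs : b \notin s by have := dg_uniq D => /andP[].
  have nb d : eps d != d -> d != b by apply: contraNneq => ->; rewrite eb.
  exists T, (rem phi b), eps, h, dev, s; split=> //; split.
  - exact: dg_epsK D.
  - move=> d ed ds; case: (eqVneq d b) => [->//|ndb]; rewrite pE //.
    by rewrite (dg_dead D) ?inE ?negb_or ?ndb // (negPf ndb).
  - exact: dg_label D.
  - move=> d ds ld; have ndb := nb _ ld; have dO : d \notin b :: s by rewrite inE negb_or ndb.
    rewrite pE // ifN; first exact: (dg_walk D).
    by apply: contraNneq dO => e; rewrite -(fcycle_mem _ (dg_cycle D)) e mem_head.
  - exact: dg_eps D.
  - move=> d ld; rewrite pE ?nb //; case: eqP => [e|_]; last exact: (dg_phi D).
    by apply: geqT (dg_null D eb) _; rewrite -e; apply: (dg_phi D).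
  - move=> d ed; case: (eqVneq d b) => [->|ndb]; first by rewrite pb; exact: geqxx.
    rewrite pE //; case: eqP => [e|_]; last exact: (dg_null D).
    by apply: geqT (dg_null D eb) _; rewrite -e; apply: (dg_null D).
  - apply: planar_rem; exact: dg_planar D.
  - have c := dg_cycle D; have u := dg_uniq D; case/lastP: s sn {lv ew D} bs c u => // p x _ bs c.
    have {c} : fpath phi b (rcons (rcons p x) b) := c.
    rewrite rcons_path last_rcons => /andP[c /eqP px] u; rewrite fcycle_rcons.
    apply: fpath_change c => [|z zp].
      by rewrite pE ?px ?eqxx //; apply: contraNneq bs => <-; rewrite mem_rcons mem_head.
    rewrite pE; last by apply: contraNneq bs => <-; rewrite mem_rcons inE zp orbT.
    rewrite -px (inj_eq (@perm_inj _ phi)) ifN //.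
    by move: u; rewrite /= rcons_uniq => /and3P[_ xp _]; apply: contraNneq xp => <-.
  - by have := dg_uniq D => /andP[].
have [m] := ubnP (weight phi eps); elim: m phi eps h dev O D lO ew => // m IH phi eps h dev O D lO ew ltm.
apply: NNPP => nex.
have nosmall (phi' eps' : {perm T}) h' dev' O' : diagram (Γ := Γ) phi' eps' h' dev' O' ->
    {in O', forall d, eps' d != d} -> w = [seq lb h' d | d <- O'] -> ~ weight phi' eps' < weight phi eps.
  move=> D' lO' ew' lt; apply: nex; apply: (IH phi' eps' h' dev' O') => //.
  by apply: leq_trans lt _.
have epsK := dg_epsK D.
have inj_tgt x y z : eps z != z -> z \notin O -> x \in porbit phi z -> y \in porbit phi z ->
    step_tgt (h x) = step_tgt (h y) -> x = y.
  move=> lz zO xz yz e; apply/eqP/negPn/negP => nxy.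
  have [xO lx] := dg_porbit D lO xz; rewrite (negPf zO) lz in xO lx; move/negbT in xO.
  have yx : y \in porbit phi x.
    by move: xz yz; rewrite -!eq_porbit_mem => /eqP <-.
  exact: (nosmall _ _ _ _ _ (dg_split D lO xO lx nxy yx e) lO ew) (weight_split eps nxy yx).
apply: nex; exists T, phi, eps, h, dev, O; split=> //; split=> //.
- move=> x lx xO; have ue := uniq_traject_porbit phi x.
  have memo z : (z \in traject phi x #|porbit phi x|) = (z \in porbit phi x) by rewrite porbit_traject.
  have [k ek] : exists k, #|porbit phi x| = k.+1.
    by exists #|porbit phi x|.-1; rewrite prednK //; apply/card_gt0P; exists x; exact: porbit_id.
  set r := traject phi (phi x) k.
  have er : traject phi x #|porbit phi x| = x :: r by rewrite ek.
  have fp : fpath phi x r by exact: fpath_traject.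
  have lst : phi (last x r) = x by rewrite last_traject -[RHS](iter_porbit phi x) ek.
  have [v1 v2] := dg_inner_walk D lO xO lx fp.
  split; first by rewrite er.
  split; first by rewrite er.
  have lr : last x r \in porbit phi x by rewrite -memo er mem_last.
  have [lrO lrl] := dg_porbit D lO lr.
  split; first by rewrite er v2 (dg_walk D) ?lrO ?lrl ?lst.
  split.
    rewrite -[List.map _ _]/[seq step_tgt st | st <- [seq h d | d <- traject phi x #|porbit phi x|]] -map_comp.
    apply: NoDup_map_in ue _ => y z; rewrite !memo => yx zx /= e; exact: inj_tgt lx xO yx zx e.
  rewrite -[List.map _ _]/[seq st.1 | st <- [seq h d | d <- traject phi x #|porbit phi x|]] -map_comp.
  apply: NoDup_map_in ue _ => y z; rewrite !memo => yx zx /= e.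
  case: (boolP ((h y).2 == (h z).2)) => [/eqP e2|n2].
    apply: (inj_tgt _ _ x) => //; congr step_tgt.
    by rewrite [h y]surjective_pairing [h z]surjective_pairing e e2.
  have hzy : h z = rstep (h y).
    by rewrite /rstep [h z]surjective_pairing e; congr pair; move: n2; case: (h y).2; case: (h z).2.
  have [yO ly] := dg_porbit D lO yx; have [zO lz] := dg_porbit D lO zx.
  rewrite (negPf xO) in yO zO; rewrite lx in ly lz; move/negbT in yO; move/negbT in zO.
  (* The two darts run one edge in opposite directions. As the end vertices in the face are
     distinct, each of them must follow the other, and the face is a bigon. *)
  have pz : phi z = y.
    have zpx : phi z \in porbit phi x by rewrite -eq_porbit_mem porbit_perm1 eq_porbit_mem.
    have yp : (phi^-1)%g y \in porbit phi x by rewrite -eq_porbit_mem -[porbit phi (_ y)]porbit_perm1 permKV eq_porbit_mem.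
    have [ypO ypl] := dg_porbit D lO yp; rewrite (negPf xO) in ypO; rewrite lx in ypl; move/negbT in ypO.
    have : (phi^-1)%g y = z; last by move=> <-; rewrite permKV.
    by apply: (inj_tgt _ _ x) => //; rewrite (dg_walk D) // permKV hzy rstep_tgt.
  have py : phi y = z.
    have yp : (phi^-1)%g z \in porbit phi x by rewrite -eq_porbit_mem -[porbit phi (_ z)]porbit_perm1 permKV eq_porbit_mem.
    have [ypO ypl] := dg_porbit D lO yp; rewrite (negPf xO) in ypO; rewrite lx in ypl; move/negbT in ypO.
    have : (phi^-1)%g z = y; last by move=> <-; rewrite permKV.
    by apply: (inj_tgt _ _ x) => //; rewrite (dg_walk D) // permKV hzy rstep_src.
  apply/eqP/negPn/negP => nyz; exfalso.
  have [phi3 [h3 [O3 [D3 lO3 e3]]]] := dg_bigon D lO py pz nyz zO lz hzy.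
  by apply: (nosmall _ _ _ _ _ D3 lO3 _ (weight_delb _ _ lz (epsK z))); rewrite e3.
- move=> x lx xO x'O nx' fV fE au e.
  have [h3 [D3 e3]] := dg_fold D xO lx x'O nx' au e.
  apply: (nosmall _ _ _ _ _ D3 _ _ (weight_delb _ _ lx (epsK x))).
    move=> d dO; rewrite delbE // ifN; first exact: lO.
    by rewrite negb_or; apply/andP; split; [apply: contraNneq xO|apply: contraNneq x'O] => <-.
  by rewrite ew; apply: eq_map => d; rewrite e3.
Qed.
End Reduce.

(** * Small cancellation in a reduced diagram *)

Section ReducedDiagram.
Variables (S : Type) (Γ : LGraph S).
Hypothesis red : reduced Γ.
Hypothesis gr : Gr'16 Γ.
Notation Δ := (plus Γ).
Notation "u ≡ v" := (geq Γ u v) (at level 70).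
Variables (T : finType) (phi eps : {perm T}) (h : T -> step Δ) (dev : T -> word S) (o : T) (s : seq T).
Notation O := (o :: s).
Hypothesis R : reduced_diagram (Γ := Γ) phi eps h dev O.
Let D := rd_diagram R.
Let lO := rd_live R.
Let epsK := dg_epsK D.

Lemma rd_outer x : (x \in outer phi o) = (x \in O).
Proof. exact: (fcycle_porbit (dg_cycle D) (mem_head _ _)). Qed.

Lemma rd_eps_live x : (eps (eps x) != eps x) = (eps x != x).
Proof. by rewrite epsK eq_sym. Qed.

Lemma rd_iter x k : (iter k phi x \in O) = (x \in O) /\ (eps (iter k phi x) != iter k phi x) = (eps x != x).
Proof. by apply: (dg_porbit D lO); apply/porbitP; exists k; rewrite permX. Qed.

Lemma rd_label_run (z y : T) a : (forall i, i <= a -> eps (iter i phi z) = iter (a - i) phi y) ->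
  eps z != z -> [seq lb h d | d <- traject phi y a.+1] = inv_word [seq lb h d | d <- traject phi z a.+1].
Proof.
move=> ag lz; rewrite inv_wordE -map_comp -map_rev; apply: (@eq_from_nth _ (lb h z)).
  by rewrite !size_map size_rev !size_traject.
move=> i; rewrite size_map size_traject => lt.
rewrite (nth_map z) ?size_traject // (nth_map z) ?size_rev ?size_traject // nth_rev ?size_traject //.
have lt' : a.+1 - i.+1 < a.+1 by lia.
rewrite [nth z (traject phi y _) _](set_nth_default y) ?size_traject // !nth_traject //=.
have e : i = a - (a.+1 - i.+1) by lia.
rewrite {1}e -ag; last by lia.
by rewrite (dg_label D) // (rd_iter z _).2.
Qed.

(** Along the arc the opposite face is followed backwards. An automorphism matching the two readings
    would match the first edge, against [rd_rigid]. *)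
Lemma rd_int_piece z a : eps z != z -> z \notin O -> eps z \notin O -> eps z \notin porbit phi z ->
  a < #|porbit phi z| -> (forall i, i < a -> phi (eps (phi (iter i phi z))) = eps (iter i phi z)) ->
  occ Γ [seq lb h d | d <- traject phi z a.+1] #|porbit phi z| /\ ~ rigid Γ [seq lb h d | d <- traject phi z a.+1].
Proof.
move=> lz zO ezO nz lt ag; set n := #|porbit phi z| in lt *.
set za := iter a phi z; set y := eps za.
have eqs i : i <= a -> eps (iter i phi z) = iter (a - i) phi y.
  move=> ia; have := leq_subr i a; set j := a - i; have -> : i = a - j by rewrite /j; lia.
  elim: j => [|j IH] le; first by rewrite subn0.
  rewrite iterS -IH; last by apply: ltnW.
  have -> : a - j = (a - j.+1).+1 by lia.
  by rewrite iterS ag //; lia.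
have yO : y \notin O by move: ezO; rewrite [eps z](eqs 0) // (rd_iter y _).1.
have ly : eps y != y by rewrite /y rd_eps_live (rd_iter z _).2.
have scz := rd_face R lz zO; have scy := rd_face R ly yO.
have lea : a.+1 <= #|porbit phi y|.
  have ue : uniq [seq eps d | d <- traject phi z a.+1].
    rewrite map_inj_uniq; last exact: perm_inj.
    have := uniq_traject_porbit phi z; rewrite -/n -(subnKC lt) trajectD cat_uniq; by case/andP.
  have <- : size [seq eps d | d <- traject phi z a.+1] = a.+1 by rewrite size_map size_traject.
  rewrite -(card_uniqP ue); apply/subset_leq_card/subsetP => d /mapP[d' /trajectP[i lti ->] ->].
  by rewrite eqs //; apply/porbitP; exists (a - i); rewrite permX.
move: scz scy; rewrite -/n -(subnKC lt) -(subnKC lea) !trajectD !map_cat => scz scy.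
have lbl : label_of [seq h d | d <- traject phi z a.+1] = label_of (rpath [seq h d | d <- traject phi y a.+1]).
  rewrite label_rpath !label_ofE -!map_comp.
  have := rd_label_run eqs lz; rewrite /lb /comp => ->.
  by rewrite inv_wordK.
have rig : forall fV fE, lp_aut Δ fV fE -> [seq fE e | e <- [seq x.1 | x <- [seq h d | d <- traject phi z a.+1]]] <>
    [seq x.1 | x <- rpath [seq h d | d <- traject phi y a.+1]].
  move=> fV fE au; rewrite /rpath [traject phi y _]trajectSr !map_rcons rev_rcons /= => -[e1 _].
  apply: (rd_rigid R lz zO ezO nz au); rewrite e1; congr (h _).1.
  by rewrite [eps z](eqs 0) // subn0.
have := parallel_piece scz scy lbl rig.
by rewrite size_cat !size_map !size_traject subnKC // label_ofE -map_comp.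
Qed.

(** Interior arcs are pieces, hence shorter than a sixth, and a spur inside a face would repeat an
    edge of its simple cycle. *)
Lemma rd_small_map : small_map phi eps o.
Proof.
split.
- exact: epsK.
- by move=> x ex; apply: (dg_dead D) => //; apply: contraL (introT eqP ex) => /lO.
- exact: dg_planar D.
- exact: lO (mem_head _ _).
- move=> x lx; rewrite rd_outer => xO; apply/eqP => e.
  have [_ [_ [_ [_ nd]]]] := rd_face R lx xO.
  have srcE : step_src (h (phi x)) = step_src (rstep (h x)) by rewrite -(dg_walk D) // rstep_src.
  have labE : step_label (h (phi x)) = step_label (rstep (h x)).
    by rewrite rstep_label e; exact: (dg_label D lx).
  have [r1 r2] := reduced_plus red.
  have fst_ : (h (phi x)).1 = (h x).1.
    move: srcE labE; rewrite /step_src /step_label; case: (h (phi x)) => e1 b1; case: (h x) => e2 b2 /= es [el eb].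
    by move: es; rewrite eb; case: b2 eb => _ es; [apply: r2|apply: r1].
  have nx : phi x != x by rewrite e.
  have c1 : 1 < #|porbit phi x|.
    rewrite (cardD1 x) porbit_id (cardD1 (phi x)) !inE nx /=.
    by rewrite -eq_porbit_mem porbit_perm1 eqxx.
  move: nd; case: #|porbit phi x| c1 => [|[|k]] //= _; rewrite fst_ => /NoDup_cons_iff[[]]; by left.
- move=> z a lz; rewrite rd_outer => zO lt ag; rewrite rd_outer => ezO nz.
  have [oc nr] := rd_int_piece lz zO ezO nz lt ag.
  have := occ_piece gr oc nr; rewrite size_map size_traject; case: #|_| => // k; exact.
Qed.

Lemma rd_no_self_glue x : eps x != x -> x \notin O -> eps x \notin porbit phi x.
Proof. by move=> lx xO; apply: (no_self_glue rd_small_map) => //; rewrite rd_outer. Qed.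

Variable m : pred nat.
Hypothesis m0 : m 0.
(** In polygons the marks are the first darts of the sides. Arcs stop at marks, so each lies on one
    side; position 0 is always marked because the numbering jumps there. *)
Definition marked : {set T} := [set x in O | m (index x O)].
Notation Q := marked.
Notation sm := (smooth phi eps Q).
Notation xt := (ext phi eps o).

Lemma xtE z : xt z = (eps z \in O).
Proof. by rewrite /ext rd_outer. Qed.

Lemma sm_ext z : sm z -> xt (phi z) = xt z.
Proof. by case/andP => /eqP e _; rewrite !xtE -e (fcycle_mem _ (dg_cycle D)). Qed.

Lemma rd_int_bound x : eps x != x -> x \notin O -> run_bound phi sm x (fun z => ~~ xt z) 6 #|porbit phi x|.-1.
Proof.
move=> lx xO z a zx nz lt ag; have ex : porbit phi z = porbit phi x by apply/eqP; rewrite eq_porbit_mem.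
have [zO lz] := dg_porbit D lO zx; rewrite (negPf xO) in zO; rewrite lx in lz.
have zO' : z \notin outer phi o by rewrite rd_outer zO.
rewrite -ex; apply: (sm_small rd_small_map) => //; first by rewrite ex.
  by move=> i /ag /andP[/eqP].
by apply: (no_self_glue rd_small_map).
Qed.

Definition outer_nth i := nth o O i.
Notation X := outer_nth.

Lemma outer_nth_index z : z \in O -> X (index z O) = z.
Proof. exact: nth_index. Qed.

Lemma index_outer_nth i : i < size O -> index (X i) O = i.
Proof. by move=> lt; rewrite index_uniq //; exact: dg_uniq D. Qed.

Lemma outer_nthS i : i.+1 < size O -> X i.+1 = phi (X i).
Proof.
move=> lt; rewrite (fcycle_nth o (dg_cycle D) (mem_nth o (ltnW lt))).
rewrite index_outer_nth; last exact: ltnW.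
by rewrite ltn_eqF.
Qed.

Lemma phi_last i : i.+1 = size O -> phi (X i) = o.
Proof.
move=> e; have lt : i < size O by rewrite -e.
by rewrite (fcycle_nth o (dg_cycle D) (mem_nth o lt)) index_outer_nth // e eqxx.
Qed.

(* The outer face is traversed in the opposite direction, so positions decrease along the run. *)
Lemma ext_run_nth a z : xt z -> (forall i, i < a -> sm (iter i phi z)) ->
  exists2 t, t + a < size O & (forall i, i <= a -> eps (iter i phi z) = X (t + (a - i))) /\
    (forall j, t < j <= t + a -> ~~ m j).
Proof.
elim: a z => [|a IH] z; rewrite xtE => zO ag.
  exists (index (eps z) O); first by rewrite addn0 index_mem.
  split=> [i|j]; last by lia.
  by rewrite leqn0 => /eqP -> /=; rewrite subn0 addn0 outer_nth_index.
have s0 : sm z := ag 0 isT.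
have [|i lti|t lt [e1 e2]] := IH (phi z); first by rewrite sm_ext // xtE.
  by rewrite -iterSr; exact: (ag i.+1).
case/andP: (s0) => /eqP e0 nQ.
have e3 : phi (X (t + a)) = eps z by rewrite -e0; have := e1 0 isT; rewrite subn0 /= => ->.
have lt' : t + a.+1 < size O.
  rewrite addnS ltn_neqAle lt andbT; apply/eqP => e4; move: nQ; rewrite -e3 phi_last //.
  by rewrite inE mem_head /= eqxx m0.
have e4 : X (t + a.+1) = eps z by rewrite addnS outer_nthS ?e3 // -addnS.
exists t => //; split.
  case=> [|i] le; first by rewrite subn0 e4.
  by rewrite iterSr e1 // subSS.
move=> j /andP[l1 l2]; have [e|ne] := eqVneq j (t + a.+1); last by apply: e2; lia.
by move: nQ; rewrite inE zO -e4 index_outer_nth // -e.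
Qed.

Notation w := [seq lb h d | d <- O].

Lemma face_occ z k : eps z != z -> z \notin O -> k <= #|porbit phi z| ->
  occ Γ [seq lb h d | d <- traject phi z k] #|porbit phi z|.
Proof.
move=> lz zO le; have /simple_plus[v [p [_ ep sc]]] := rd_face R lz zO.
have ep' : take k p ++ drop k p = p by rewrite cat_take_drop.
exists v, (take k p), (drop k p); rewrite ep'; split=> //.
  rewrite label_ofE map_take -label_ofE -lift_label -ep label_ofE -map_comp -map_take.
  by rewrite -{1}(subnKC le) trajectD take_size_cat ?size_traject.
by rewrite -(size_map (@lift S Γ)) -ep size_map size_traject.
Qed.

Lemma outer_run_label a z t : eps z != z -> t + a < size O -> (forall i, i <= a -> eps (iter i phi z) = X (t + (a - i))) ->
  [seq lb h d | d <- traject phi z a.+1] = inv_word (take a.+1 (drop t w)).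
Proof.
move=> lz lt2 e1; rewrite -map_drop -map_take.
have -> : take a.+1 (drop t O) = traject phi (X t) a.+1.
  apply: (@eq_from_nth _ o); first by rewrite size_takel ?size_drop ?size_traject //; move: (size O) lt2; clear; lia.
  rewrite size_takel ?size_drop; last by move: (size O) lt2; clear; lia.
  move=> i lti; rewrite nth_take // nth_drop [RHS](set_nth_default (X t)) ?size_traject // nth_traject // -/(X (t + i)).
  elim: i lti => [|i IH] lti; first by rewrite addn0.
  rewrite addnS outer_nthS ?IH //; first exact: ltnW.
  by move: (size O) lt2 lti; clear; lia.
have -> : X t = eps (iter a phi z) by rewrite e1 // subnn addn0.
rewrite (@rd_label_run z (eps (iter a phi z)) a) ?inv_wordK // => i le.
have h1 : forall j, j <= a -> eps (iter (a - j) phi z) = iter j phi (eps (iter a phi z)).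
  elim=> [|j IH] le1; first by rewrite subn0.
  rewrite iterS -IH ?(ltnW le1) // !e1 ?leq_subr // !subKn ?(ltnW le1) //.
  by rewrite addnS outer_nthS //; apply: leq_ltn_trans lt2; rewrite -addnS leq_add2l.
by rewrite -h1 ?leq_subr // subKn.
Qed.

Lemma ext_run_occ a z : eps z != z -> z \notin O -> xt z -> a < #|porbit phi z| -> (forall i, i < a -> sm (iter i phi z)) ->
  exists t, [/\ t + a < size O, forall i, i <= a -> eps (iter i phi z) = X (t + (a - i)),
    (forall j, t < j <= t + a -> ~~ m j) & occ Γ (take a.+1 (drop t w)) #|porbit phi z|].
Proof.
move=> lz zO xz lt ag; have [t lt2 [e1 e2]] := ext_run_nth xz ag; exists t; split=> //.
rewrite -[X in occ _ X _]inv_wordK; apply: occ_inv; rewrite -(outer_run_label lz lt2 e1).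
exact: face_occ.
Qed.

Hypothesis tame : forall t a n, 0 < a -> t + a <= size w -> (forall j, t < j < t + a -> ~~ m j) ->
  occ Γ (take a (drop t w)) n -> 2 * a <= n.
Hypothesis nospur : forall i a, 0 < i < size w -> ~~ m i ->
  nth a w i <> inv_letter (nth a w i.-1).

Lemma rd_ext_bound x : eps x != x -> x \notin O -> run_bound phi sm x xt 2 #|porbit phi x|.
Proof.
move=> lx xO z a zx xz lt ag; have ex : porbit phi z = porbit phi x by apply/eqP; rewrite eq_porbit_mem.
have [zO lz] := dg_porbit D lO zx; rewrite (negPf xO) in zO; rewrite lx in lz.
have lt' : a < #|porbit phi z| by rewrite ex.
have [t [h1 _ h2 h3]] := ext_run_occ lz (negbT zO) xz lt' ag.
rewrite -ex; apply: tame h3 => [//||j]; first by rewrite size_map addnS.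
by rewrite addnS ltnS; exact: h2.
Qed.

Lemma rd_outer_spur x : x \in outer phi o -> phi (eps x) = x -> x \in Q.
Proof.
rewrite rd_outer => xO e; rewrite inE xO /=; apply: contraT => nm.
have yO : eps x \in O by rewrite -(fcycle_mem _ (dg_cycle D)) e.
pose i := index x O; have lti : i < size O by rewrite index_mem.
have {}nm : ~~ m i := nm.
have i0 : 0 < i by rewrite lt0n; apply/eqP => e0; move: nm; rewrite e0 m0.
have ei : X i = x by rewrite outer_nth_index.
have ey : X i.-1 = eps x.
  apply: (@perm_inj _ phi); rewrite e -ei -{2}(prednK i0) outer_nthS //; by rewrite prednK.
case: (nospur (i := i) (a := lb h o) _ nm); first by rewrite size_map i0.
rewrite !(nth_map o) ?(leq_ltn_trans (leq_pred _)) // -/(X i) -/(X i.-1) ei ey.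
by rewrite (dg_label D) ?inv_letterK //; exact: lO.
Qed.

Definition face_cost_of y := \sum_(z in porbit phi y) cost phi eps o Q z.
(** Selects one dart, the last, of each boundary run of a face with excess cost. *)
Definition thick y : bool := [&& xt y, ~~ sm y & 12 < face_cost_of y].
Definition branching x : bool := [&& x \in O, 4 <= #|porbit (eps * phi)%g x|, phi (eps x) \notin O & phi (eps (phi (eps x))) \notin O].

Lemma costE z : cost phi eps o Q z = if sm z then 0 else if xt z && xt (phi z) then 6 else
  if xt z || xt (phi z) then 3 else 2.
Proof. by []. Qed.

(** A face of cost [c] has at most [c / 6] boundary runs, and from [c = 13] on this is below its
    excess [4 * c - 48]. So thick runs can be charged to the curvature of their faces. *)
Theorem polygon_bound :
  #|[set y | [&& eps y != y, y \notin O & thick y]]| + 4 * #|[set x | branching x]| + 48 <= 24 * #|marked|.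
Proof.
have M := rd_small_map.
have := @curvature_bound T phi eps o Q epsK (sm_dead M) (dg_planar D) (lO (mem_head _ _)).
move=> /(_ _ _ rd_outer_spur (fun y => thick y)); have -> : \sum_x crowded (eps * phi)%g (outer phi o) x = #|[set x | branching x]|.
  rewrite -sum1_card [LHS](big_mkcond predT) [RHS]big_mkcond /=; apply: eq_bigr => x _.
  by rewrite inE /crowded /branching !permM !rd_outer; case: ifP.
have -> : \sum_(x | (eps x != x) && (x \notin outer phi o)) thick x = #|[set y | [&& eps y != y, y \notin O & thick y]]|.
  rewrite -sum1_card [LHS]big_mkcond [RHS]big_mkcond /=; apply: eq_bigr => x _.
  by rewrite inE rd_outer; case: (_ != _) => //=; case: (_ \notin _) => //=; case: (thick x).
apply.
- by apply/subsetP => x; rewrite inE rd_outer => /andP[].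
- by move=> x lx xO; apply: (sm_spur M).
move=> x lx; rewrite rd_outer => xO.
have sme z : z \in porbit phi x -> sm z -> xt (phi z) = xt z by move=> _; apply: sm_ext.
have h1 := face_ge12 sme (rd_int_bound lx xO) (rd_ext_bound lx xO).
have h2 := face_ext_runs sme.
rewrite -(eq_bigr _ (fun z _ => costE z)) in h1 h2.
have fcx y : y \in porbit phi x -> face_cost_of y = face_cost_of x.
  by rewrite -eq_porbit_mem /face_cost_of => /eqP ->.
rewrite -/(face_cost_of x) in h1 h2 *.
have : \sum_(y in porbit phi x) thick y <= (12 < face_cost_of x) * ext_runs phi sm xt x.
  case: (boolP (12 < face_cost_of x)) => hc; last first.
    rewrite mul0n leqn0 sum_nat_eq0; apply/forall_inP => y yx.
    by rewrite /thick fcx // (negPf hc) !andbF.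
  by rewrite mul1n; apply: leq_sum => y _; rewrite /thick; case: (xt y) (sm y) => [] [] //=; case: (_ < _).
move: h1 h2; move: (\sum_(y in _) thick y) (ext_runs _ _ _ _) (face_cost_of x) => a b c; clear.
by case: (ltnP 12 c) => ?; rewrite ?mul1n ?mul0n; lia.
Qed.
End ReducedDiagram.

Section Sides.
Variables (S : Type) (Γ : LGraph S).
Implicit Types (u v w : word S) (sides : seq (word S)).

Definition factor u v : Prop := exists x y, v = x ++ u ++ y.

Lemma factor_refl u : factor u u.
Proof. by exists [::], [::]; rewrite cats0. Qed.

Lemma factor_trans u v w : factor u v -> factor v w -> factor u w.
Proof. by move=> [x [y ->]] [x' [y' ->]]; exists (x' ++ x), (y ++ y'); rewrite !catA. Qed.

Lemma factor_catl u v w : factor u v -> factor u (w ++ v).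
Proof. by move=> [x [y ->]]; exists (w ++ x), y; rewrite !catA. Qed.

Lemma factor_catr u v w : factor u v -> factor u (v ++ w).
Proof. by move=> [x [y ->]]; exists x, (y ++ w); rewrite !catA. Qed.

Lemma factor_size u v : factor u v -> size u <= size v.
Proof. by move=> [x [y ->]]; rewrite !size_cat; lia. Qed.

Lemma factor_sub u t a : factor (take a (drop t u)) u.
Proof. by exists (take t u), (drop a (drop t u)); rewrite !cat_take_drop. Qed.

Definition freely_reduced v : Prop := forall x a y, v <> x ++ a :: inv_letter a :: y.

(** Half is the threshold of Dehn's algorithm: geodesics satisfy it, and a face with one boundary
    arc on such a side keeps half of its length for pieces. *)
Definition tame v : Prop := forall u n, u <> [::] -> factor u v -> occ Γ u n -> 2 * size u <= n.

Definition good v : Prop := freely_reduced v /\ tame v.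

Lemma freely_reduced_factor u v : factor u v -> freely_reduced v -> freely_reduced u.
Proof. by move=> [x [y e]] h a b c eu; apply: (h (x ++ a) b (c ++ y)); rewrite e eu -!catA. Qed.

Lemma good_factor u v : factor u v -> good v -> good u.
Proof.
move=> fu [h1 h2]; split; first exact: freely_reduced_factor fu h1.
by move=> z n zn fz; apply: h2 => //; apply: factor_trans fz fu.
Qed.

Fixpoint marks off sides : seq nat := if sides is v :: sides' then off :: marks (off + size v) sides' else [::].

Lemma size_marks off sides : size (marks off sides) = size sides.
Proof. by elim: sides off => //= v sides IH off; rewrite IH. Qed.

(** The interval may begin at a mark, but with none after its first letter it cannot run into the
    next side. *)
Lemma unmarked_factor off sides t a : 0 < a -> t + a <= size (flatten sides) ->
  (forall j, t < j < t + a -> off + j \notin marks off sides) ->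
  exists2 v, In v sides & factor (take a (drop t (flatten sides))) v.
Proof.
elim: sides off t => [|v sides IH] off t a0 /=; first by lia.
rewrite size_cat => le nm.
have [ge|lt] := leqP (size v) t.
  have [|j jb|x xs fx] := IH (off + size v) (t - size v) a0; first by lia.
    have := nm (j + size v); rewrite inE negb_or => /(_ _)/andP[]; first by lia.
    by have -> : off + (j + size v) = off + size v + j by lia.
  exists x; [by right|].
  by rewrite drop_cat ltnNge ge.
have le2 : t + a <= size v.
  rewrite leqNgt; apply/negP => gt; case: sides IH le nm => [|v2 sides] IH /=; first by lia.
  move=> _ /(_ (size v)); rewrite !inE eqxx orbT /= => h.
  by have := h (introT andP (conj lt gt)).
exists v; [by left|]; rewrite drop_cat lt take_cat size_drop.
have [_|ge] := ltnP a (size v - t); first exact: factor_sub.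
have -> : a - (size v - t) = 0 by lia.
by rewrite take0 cats0; exists (take t v), [::]; rewrite cats0 cat_take_drop.
Qed.
End Sides.

(** * Polygons *)

Section Polygon.
Variables (S : Type) (Γ : LGraph S).
Hypothesis red : reduced Γ.
Hypothesis gr : Gr'16 Γ.
Notation "u ≡ v" := (geq Γ u v) (at level 70).

Record polygon (sides : seq (word S)) (T : finType) (phi eps : {perm T}) h dev (o : T) s : Prop := Polygon {
  pg_reduced : reduced_diagram (Γ := Γ) phi eps h dev (o :: s);
  pg_label : [seq lb h d | d <- o :: s] = flatten sides;
  pg_good : forall v, In v sides -> good Γ v }.

Lemma polygon_exists sides : flatten sides <> [::] -> flatten sides ≡ [::] ->
  (forall v, In v sides -> good Γ v) -> exists T phi eps h dev o s, @polygon sides T phi eps h dev o s.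
Proof.
move=> ne e gs; have a : S by case: (flatten sides) ne => // -[a _] _ _.
have [T [phi [eps [h [dev [O [RD ew]]]]]]] := reduced_diagram_exists (trivial_fillable a e) ne.
by case: O RD ew => [|o s] RD ew; [rewrite ew in ne|exists T, phi, eps, h, dev, o, s; split].
Qed.

Variables (sides : seq (word S)) (T : finType) (phi eps : {perm T}).
Variables (h : T -> step (plus Γ)) (dev : T -> word S) (o : T) (s : seq T).
Hypothesis P : polygon sides phi eps h dev o s.
Notation O := (o :: s).
Notation w := [seq lb h d | d <- O].
Let R := pg_reduced P.
Let D := rd_diagram R.
Let m : pred nat := mem (marks 0 sides).
Notation Q := (marked o s m).
Notation sm := (smooth phi eps Q).
Notation xt := (ext phi eps o).
Notation X := (outer_nth o s).
Notation fcost := (face_cost_of phi eps o s m).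

Lemma pg_m0 : m 0.
Proof.
rewrite /m; have := pg_label P; by case: (sides) => [|v l].
Qed.

Lemma pg_interval t a : 0 < a -> t + a <= size w -> (forall j, t < j < t + a -> ~~ m j) ->
  exists2 v, In v sides & factor (take a (drop t w)) v.
Proof. by rewrite (pg_label P) => a0 le nm; exact: (@unmarked_factor _ 0 sides t a a0 le nm). Qed.

Lemma pg_tame t a n : 0 < a -> t + a <= size w -> (forall j, t < j < t + a -> ~~ m j) ->
  occ Γ (take a (drop t w)) n -> 2 * a <= n.
Proof.
move=> a0 le nm oc; have [v vs fv] := pg_interval a0 le nm.
have [_ tv] := pg_good P vs; have sz : size (take a (drop t w)) = a by rewrite size_takel // size_drop; lia.
rewrite -{1}sz; apply: tv fv oc => e; by move: sz a0; rewrite e => <-.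
Qed.

Lemma pg_nospur i a : 0 < i < size w -> ~~ m i -> nth a w i <> inv_letter (nth a w i.-1).
Proof.
case: i => // k /andP[_ lt] nm e; rewrite /= in e.
have [|j jb|v vs [x [y ev]]] := @pg_interval k 2 isT; first by rewrite addn2.
  by have -> : j = k.+1 by move: jb; clear; lia.
have [rv _] := pg_good P vs; apply: (rv x (nth a w k) y).
rewrite ev; congr (_ ++ _); rewrite (drop_nth a) ?(ltnW lt) //= (drop_nth a) //=.
by rewrite take0 -[lb h _ :: _]/w e.
Qed.

Lemma pg_marked : #|Q| <= size sides.
Proof.
rewrite -(size_marks 0) cardE -(size_map (fun x => index x O)); apply: uniq_leq_size.
  rewrite map_inj_in_uniq ?enum_uniq // => x y; rewrite !mem_enum !inE => /andP[xO _] /andP[yO _] e.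
  by rewrite -(@nth_index _ o x O xO) e nth_index.
by move=> i /mapP[x]; rewrite mem_enum inE => /andP[_ xm] ->.
Qed.

Lemma pg_bound :
  #|[set y | [&& eps y != y, y \notin O & thick phi eps o s m y]]| + 4 * #|[set x | branching phi eps o s x]| + 48 <= 24 * size sides.
Proof.
apply: leq_trans (polygon_bound red gr R pg_m0 pg_tame pg_nospur) _.
by rewrite leq_mul2l pg_marked.
Qed.

Lemma pg_int_bound x : eps x != x -> x \notin O -> run_bound phi sm x (fun z => ~~ xt z) 6 #|porbit phi x|.-1.
Proof. by move=> lx xO; exact: (rd_int_bound red gr R lx xO). Qed.

Lemma pg_ext_bound x : eps x != x -> x \notin O -> run_bound phi sm x xt 2 #|porbit phi x|.
Proof. by move=> lx xO; exact: (rd_ext_bound R pg_m0 pg_tame lx xO). Qed.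

Lemma pg_sme x z : z \in porbit phi x -> sm z -> xt (phi z) = xt z.
Proof. by move=> _; exact: (sm_ext R). Qed.

Lemma pg_break x : eps x != x -> x \notin O -> exists2 y, y \in porbit phi x & ~~ sm y.
Proof.
by move=> lx xO; exact: (face_break (pg_int_bound lx xO) (pg_ext_bound lx xO)).
Qed.

(** Inner faces run against the boundary, so the run that starts at position [i] ends at the lowest
    position of its arc. *)
Definition run_start i := i - run_len phi sm (eps (X i)).

Lemma outer_mem i : i < size O -> X i \in O. Proof. exact: mem_nth. Qed.

Lemma pg_live i : i < size O -> eps (X i) != X i.
Proof. by move=> /outer_mem; apply: (rd_live R). Qed.

Section Position.
Variable i : nat.
Hypothesis lti : i < size O.
Hypothesis yO : eps (X i) \notin O.
Let y := eps (X i).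
Let n := #|porbit phi y|.
Let t := run_start i.

Lemma pos_live : eps y != y. Proof. by rewrite (rd_eps_live R) pg_live. Qed.
Lemma pos_ext : xt y. Proof. by rewrite (xtE R) (dg_epsK D) outer_mem. Qed.

Lemma run_start_len : t <= i /\ run_len phi sm y = i - t.
Proof.
have [_ _ l3] := run_lenP (pg_break pos_live yO).
have [t' lt' [e1 _]] := ext_run_nth R pg_m0 pos_ext l3.
have et' : i = t' + run_len phi sm y.
  by rewrite -(index_outer_nth R lti) -(index_outer_nth R lt') -[X i](dg_epsK D) [eps (eps _)](e1 0) // subn0.
have et : t = t' by rewrite /t /run_start -/y {1}et' addnK.
by rewrite et {1 2}et' leq_addr addKn.
Qed.

Lemma run_startP : [/\ t <= i, ~~ sm (eps (X t)), i - t < n, forall k, k <= i - t -> iter k phi y = eps (X (i - k)) &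
  forall j, t < j <= i -> ~~ m j].
Proof.
have [l1 l2 l3] := run_lenP (pg_break pos_live yO).
have [t' lt' [e1 e2]] := ext_run_nth R pg_m0 pos_ext l3.
have et' : i = t' + run_len phi sm y.
  by rewrite -(index_outer_nth R lti) -(index_outer_nth R lt') -[X i](dg_epsK D) [eps (eps _)](e1 0) // subn0.
have et : t = t' by rewrite /t /run_start -/y {1}et' addnK.
have el : i - t = run_len phi sm y by rewrite et et' addKn.
have eX k : k <= i - t -> iter k phi y = eps (X (i - k)).
  rewrite el => le; rewrite -[LHS](dg_epsK D) e1 //; congr (eps (X _)).
  by rewrite [in RHS]et' addnBA.
split=> //; first by rewrite et et' leq_addr.
- have := eX _ (leqnn _); rewrite subKn; last by rewrite et et' leq_addr.
  by move=> <-; rewrite el.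
- by rewrite el.
- by move=> j; rewrite et [in j <= i]et'; apply: e2.
Qed.

Lemma pos_run a z : z \in porbit phi y -> xt z -> a < n -> (forall k, k < a -> sm (iter k phi z)) ->
  exists t', [/\ t' + a < size O, eps (iter a phi z) = X t', eps z = X (t' + a), (forall j, t' < j <= t' + a -> ~~ m j) & occ Γ (take a.+1 (drop t' w)) n].
Proof.
move=> zy xz lt ag; have ez : porbit phi z = porbit phi y by apply/eqP; rewrite eq_porbit_mem.
have [zO lz] := dg_porbit D (rd_live R) zy; rewrite (negPf yO) in zO; rewrite pos_live in lz.
have lt' : a < #|porbit phi z| by rewrite ez.
have [t' [h1 h2 h3 h4]] := ext_run_occ R pg_m0 lz (negbT zO) xz lt' ag.
exists t'; rewrite /n -ez; split=> //.
- by rewrite h2 // subnn addn0.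
- by rewrite [eps z](h2 0) // subn0.
Qed.

(* A thin face has few interior runs, each shorter than a sixth of it, so that some exterior run is long. *)
Lemma thin_run_long : fcost y <= 12 ->
  exists b, [/\ t + b < size O, forall j, t < j <= t + b -> ~~ m j, occ Γ (take b.+1 (drop t w)) n & n <= 6 * b.+1].
Proof.
move=> cy; have lx := pos_live; have bI := pg_int_bound lx yO; have bE := pg_ext_bound lx yO; have brk := pg_break lx yO.
have c12 : fcost y = 12 by apply/eqP; rewrite eqn_leq cy; exact: (face_ge12 (@pg_sme y) bI bE).
apply: NNPP => nex.
pose e := run_end phi sm y.
have [ti nsm _ eX _] := run_startP.
have ee : e = eps (X t).
  by rewrite /e /run_end run_start_len.2 eX // subKn.
have small z : z \in porbit phi y -> xt z -> run_end phi sm z = e -> 6 * (run_len phi sm z).+1 <= n.-1.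
  move=> zy xz ez; rewrite leqNgt; apply/negP => gt; apply: nex.
  have ezy : porbit phi z = porbit phi y by apply/eqP; rewrite eq_porbit_mem.
  have brkz : exists2 y0, y0 \in porbit phi z & ~~ sm y0 by rewrite ezy.
  have [l1 l2 l3] := run_lenP brkz; rewrite ezy in l1.
  have [t' [h1 h2 h3 h4 h5]] := pos_run zy xz l1 l3.
  have et : t' = t.
    rewrite -(index_outer_nth R (i := t')); last by apply: leq_ltn_trans h1; rewrite leq_addr.
    rewrite -h2 -/(run_end phi sm z) ez ee (dg_epsK D) (index_outer_nth R) //.
    by apply: leq_ltn_trans lti.
  subst t'; exists (run_len phi sm z); split=> //; by move: gt; clear; lia.
(* Were all runs ending at [e] shorter than a sixth, the arcs could not fill the face: five arcs
   below a sixth in the flat case, otherwise one arc of at most a half and at most three below a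
   sixth. *)
pose B z := if z == e then n.-1 else 3 * n.
have h2 := @run_sum T phi sm y brk xt (@pg_sme y) B.
have {}h2 : 6 * (\sum_(z in porbit phi y) xt z) <= \sum_(z in porbit phi y | xt z && ~~ sm z) B z.
  apply: h2 => z zy xz; rewrite /B; case: eqP => [ez|_]; first exact: small.
  have ezy : porbit phi z = porbit phi y by apply/eqP; rewrite eq_porbit_mem.
  have brkz : exists2 y0, y0 \in porbit phi z & ~~ sm y0 by rewrite ezy.
  have [l1 l2 l3] := run_lenP brkz; rewrite ezy in l1.
  have := bE _ _ zy xz l1 l3; rewrite -/n; clear; lia.
have eX' : e \in porbit phi y by rewrite /e; apply: run_end_mem; exact: porbit_id.
have xe : xt e by rewrite /e (run_end_pred brk (@pg_sme y)) ?porbit_id // pos_ext.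
have ne : ~~ sm e by rewrite ee.
have sumB : \sum_(z in porbit phi y | xt z && ~~ sm z) B z + 3 * n <= n.-1 + 3 * n * ext_runs phi sm xt y.
  rewrite (bigD1 e) /=; last by rewrite eX' xe ne.
  rewrite /B eqxx -addnA leq_add2l /ext_runs [X in _ <= 3 * n * X](bigD1 e) //= xe ne /= mulnDr muln1 addnC leq_add2l.
  rewrite big_distrr /= big_mkcond [X in _ <= X]big_mkcond /=; apply: leq_sum => z _.
  by case: (z == e); case: (z \in porbit phi y); case: (xt z); case: (sm z) => /=; rewrite ?muln1.
have [h1 _ h3] := face_lengths (@pg_sme y) bI bE.
have h4 := face_eq12 (@pg_sme y) bI bE c12.
have n0 : 0 < n by apply/card_gt0P; exists y; exact: porbit_id.
move: h1 h2 sumB h3 h4; rewrite -/n.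
move: (\sum_(z in porbit phi y | _) B z) (\sum_(z in _) ~~ xt z) (\sum_(z in _) xt z) (int_runs _ _ _ _) (ext_runs _ _ _ _) (ext_int _ _ _ _) n n0.
by clear=> Sb I E ir er ei n n0 h1 h2 h3 h4 [[e1 e2 _]|[e1 e2 e3]]; subst er; [subst ir|]; nia.
Qed.
Lemma start_mem : eps (X t) \in porbit phi y.
Proof.
have [ti _ _ eX _] := run_startP.
by rewrite -[t](subKn ti) -eX ?leqnn //; apply/porbitP; exists (i - t); rewrite permX.
Qed.

Lemma thick_start : 12 < fcost y ->
  eps (X t) \in [set y | [&& eps y != y, y \notin O & thick phi eps o s m y]].
Proof.
move=> cy; have em := start_mem; have [ti ns _ _ _] := run_startP.
have [zO lz] := dg_porbit D (rd_live R) em; rewrite inE lz pos_live zO yO /=.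
have -> : thick phi eps o s m (eps (X t)) = (12 < fcost (eps (X t))).
  by rewrite /thick ns (xtE R) (dg_epsK D) outer_mem // (leq_ltn_trans ti lti).
by move: em; rewrite -eq_porbit_mem /face_cost_of => /eqP ->.
Qed.
End Position.

Lemma pg_dev j : j <= size s -> dev (X j) ≡ dev o ++ take j w.
Proof.
elim: j => [|j IH] lt; first by rewrite take0 cats0; exact: geqxx.
have lt' : j < size O by apply: leq_trans lt _.
rewrite (outer_nthS R) ?ltnS // (take_nth (lb h o)) ?size_map // -cats1 catA.
apply: geqT (dg_phi D (pg_live lt')) _.
by rewrite (nth_map o) //; apply: geq_catr; apply: IH; apply: ltnW.
Qed.

Lemma pg_between i j : i <= j <= size s -> dev (X j) ≡ dev (X i) ++ take (j - i) (drop i w).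
Proof.
move=> /andP[ij lj]; apply: geqT (pg_dev lj) _.
rewrite -{1}(subnKC ij) takeD catA; apply: geq_catr; apply/geqC/pg_dev; exact: leq_trans ij lj.
Qed.

(** The two darts of an edge have the same end points, so the boundary between them is a loop in the
    group. *)
Lemma glued_trivial i j : i < j < size O -> eps (X i) = X j -> take (j - i.+1) (drop i.+1 w) ≡ [::].
Proof.
move=> /andP[ij lj] e; have lti : i < size O by apply: ltn_trans lj.
have h1 : dev (X i.+1) ≡ dev (X j).
  rewrite (outer_nthS R); last exact: leq_ltn_trans lj.
  by apply: geqT (dg_phi D (pg_live lti)) _; rewrite -e; apply/geqC/(dg_eps D)/pg_live.
have := @pg_between i.+1 j; rewrite ij -ltnS lj => /(_ isT) h2.
apply: (geq_cancell (A := dev (X i.+1))); rewrite cats0.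
exact: geqT (geqC h2) (geqC h1).
Qed.

Lemma glued_label i j a : i < size O -> j < size O -> eps (X i) = X j -> nth a w j = inv_letter (nth a w i).
Proof.
move=> li lj e; rewrite !(nth_map o) // -/(X i) -/(X j) -e.
by apply: (dg_label D); apply: pg_live.
Qed.
End Polygon.

(** * Polygons with one or two sides *)

Section Small.
Variables (S : Type) (Γ : LGraph S).
Hypothesis red : reduced Γ.
Hypothesis gr : Gr'16 Γ.
Notation "u ≡ v" := (geq Γ u v) (at level 70).

(** A polygon with a single side contradicts the curvature bound, since 48 exceeds 24. *)
Lemma good_nontrivial v : good Γ v -> v ≡ [::] -> v = [::].
Proof.
move=> gv e; apply: NNPP => ne.
have [|||T [phi [eps [h [dev [o [s P]]]]]]] := @polygon_exists _ Γ [:: v]; try by rewrite /= cats0.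
  by move=> x [<-|].
have := pg_bound red gr P; rewrite /=; move: (#|_|) (#|_|); clear; lia.
Qed.

(** The property of interior arcs ([int_run_small]); it compares with every cycle, not only with the
    two adjacent faces. *)
Definition small q : Prop := freely_reduced q /\ forall u n, u <> [::] -> factor u q -> occ Γ u n -> 6 * size u < n.

Lemma small_good q : small q -> good Γ q.
Proof. by move=> [r sq]; split=> // u n un fu /sq-/(_ un fu); clear; lia. Qed.

Lemma small_factor u q : factor u q -> small q -> small u.
Proof.
move=> fu [r sq]; split; first exact: freely_reduced_factor fu r.
by move=> z n zn fz; apply: sq => //; apply: factor_trans fz fu.
Qed.

(** When nothing cancels, two corners leave no curvature, so no run is thick. The face at the first
    letter of [q] then has a boundary arc of at least a sixth of its length; starting at a corner,
    this arc lies on [q], against smallness. If that letter is glued to the boundary instead, the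
    loop enclosed is trivial, hence empty, and two adjacent letters cancel. *)
Lemma good_small_inv v q : good Γ v -> small q -> v ++ q ≡ [::] -> v = inv_word q.
Proof.
elim: q v => [|b q IH] v gv sq; first by rewrite cats0; apply: good_nontrivial.
case/lastP: v gv => [|v a] gv e.
  by have := good_nontrivial (small_good sq) e.
case: (classic (b = inv_letter a)) => [eb|nab].
  rewrite inv_cons eb inv_letterK -cats1; congr (_ ++ _); apply: IH.
  - by apply: good_factor gv; exists [::], [:: a]; rewrite cats1.
  - by apply: small_factor sq; exists [:: b], [::]; rewrite cats0.
  - by move: e; rewrite eb cat_rcons; apply: geqT; apply/geqC/geq_free.
exfalso; set v' := rcons v a in gv e.
have szv : size v' = (size v).+1 by rewrite size_rcons.
have ew : flatten [:: v'; b :: q] = v' ++ b :: q by rewrite /= cats0.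
have [|||T [phi [eps [h [dev [o [s P]]]]]]] := @polygon_exists _ Γ [:: v'; b :: q].
- by rewrite ew /v'; case: (v).
- by rewrite ew.
- by move=> x [<-//|[<-|//]]; exact: small_good.
have R := pg_reduced P; have D := rd_diagram R; have lw := pg_label P; rewrite ew in lw.
have lO : size (o :: s) = (size v).+1 + (size q).+1 by rewrite -(size_map (lb h)) lw size_cat szv.
pose i := (size v).+1; have lti : i < size (o :: s) by rewrite lO -addSnnS leq_addr.
have nth_v k : k <= size v -> nth a (v' ++ b :: q) k = nth a v' k by move=> le; rewrite nth_cat szv ltnS le.
have nth_i : nth a (v' ++ b :: q) i = b by rewrite nth_cat szv ltnn subnn.
have bnd := pg_bound red gr P.
have nothick y : y \in [set y | [&& eps y != y, y \notin o :: s & thick phi eps o s (mem (marks 0 [:: v'; b :: q])) y]] -> False.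
  by move=> yin; move: bnd; rewrite (cardD1 y) yin /=; move: (#|_|) (#|_|); clear; lia.
have mi : mem (marks 0 [:: v'; b :: q]) i.
  by rewrite -[mem _ i]/(i \in [:: 0; 0 + size v']) !inE add0n szv eqxx orbT.
have [yO|yO] := boolP (eps (outer_nth o s i) \in o :: s).
  set j := index (eps (outer_nth o s i)) (o :: s).
  have lj : j < size (o :: s) by rewrite index_mem.
  have ej : eps (outer_nth o s i) = outer_nth o s j by rewrite [RHS]nth_index.
  have nij : i != j.
    by apply: contraNneq (pg_live P lti) => e1; rewrite ej -e1.
  have ej' : eps (outer_nth o s j) = outer_nth o s i by rewrite -ej (dg_epsK D).
  have [ltij|ltji] : i < j \/ j < i by case: ltngtP nij; auto.
    have := glued_trivial P (introT andP (conj ltij lj)) ej; rewrite lw.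
    have gl := glued_label P a lti lj ej; rewrite lw nth_i in gl.
    have -> : drop i.+1 (v' ++ b :: q) = q by rewrite -cat_rcons drop_size_cat // size_rcons szv.
    have fq : factor (take (j - i.+1) q) (b :: q) by exists [:: b], (drop (j - i.+1) q); rewrite cat1s /= cat_take_drop.
    move/(good_nontrivial (good_factor fq (small_good sq))) => /(congr1 size).
    rewrite size_takel; last by move: lj; rewrite lO /i; clear; lia.
    move=> /eqP; rewrite subn_eq0 => le; have {le}ej1 : j = i.+1 by apply/eqP; rewrite eqn_leq le.
    have [r _] := sq; move: gl; rewrite ej1 nth_cat szv ltnNge leqnSn /= subSnn => gl.
    have szq : 0 < size q by move: lj; rewrite ej1 lO /i; clear; lia.
    by apply: (r [::] b (behead q)); rewrite -gl; case: (q) szq.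
  have := glued_trivial P (introT andP (conj ltji lti)) ej'; rewrite lw.
  have gl := glued_label P a lj lti ej'; rewrite lw nth_i in gl.
  have -> : take (i - j.+1) (drop j.+1 (v' ++ b :: q)) = drop j.+1 v'.
    rewrite drop_cat szv; case: (ltnP j.+1 (size v).+1) => [lt|ge].
      by rewrite take_size_cat // size_drop szv.
    have -> : j.+1 = i by apply/eqP; rewrite eqn_leq ge ltji.
    by rewrite subnn take0 drop_oversize // szv.
  have fv : factor (drop j.+1 v') v' by exists (take j.+1 v'), [::]; rewrite cats0 cat_take_drop.
  move/(good_nontrivial (good_factor fv gv)) => /(congr1 size); rewrite size_drop szv => /eqP; rewrite subn_eq0 ltnS => le.
  have ej1 : j = size v by apply/eqP; rewrite eqn_leq le andbT -ltnS.
  by apply: nab; rewrite gl ej1 nth_v // /v' nth_rcons ltnn eqxx.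
have thin : face_cost_of phi eps o s (mem (marks 0 [:: v'; b :: q])) (eps (outer_nth o s i)) <= 12.
  by rewrite leqNgt; apply/negP => /(thick_start red gr P lti yO)/nothick.
have [ti _ _ _ um] := run_startP red gr P lti yO.
have et : run_start [:: v'; b :: q] phi eps o s i = i.
  apply/eqP; rewrite eqn_leq ti leqNgt; apply/negP => lt.
  by have := um i; rewrite lt leqnn mi => /(_ isT).
have [c [h1 h2 h3 h4]] := thin_run_long red gr P lti yO thin.
move: h3 h4; rewrite et lw drop_size_cat ?szv // => h3 h4.
have [_ /(_ _ _ _ _ h3)] := sq; rewrite size_takel; last by move: h1; rewrite et lO /i /=; clear; lia.
move=> h5; have : 6 * c.+1 < #|porbit phi (eps (outer_nth o s i))| by apply: h5 => //; exists [::], (drop c.+1 (b :: q)); rewrite cat_take_drop.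
by move: h4; clear; lia.
Qed.
End Small.

(** * The cyclic sequence of arcs of a face *)

Section Runs.
Variables (T : finType) (phi : {perm T}) (sm e : pred T).

(* [l] lists the lengths (minus one) of the consecutive runs from [z] on, the last one ending just before [zf]. *)
Fixpoint runs z (l : seq nat) zf : Prop :=
  if l is a :: l' then [/\ forall i, i < a -> sm (iter i phi z), ~~ sm (iter a phi z) & runs (iter a.+1 phi z) l' zf]
  else z = zf.

Fixpoint run_darts z (l : seq nat) : seq T :=
  if l is a :: l' then traject phi z a.+1 ++ run_darts (iter a.+1 phi z) l' else [::].

Fixpoint run_types z (l : seq nat) : seq bool :=
  if l is a :: l' then e z :: run_types (iter a.+1 phi z) l' else [::].

(** [b0] is the type of the run that follows the list, so that a full turn can be closed up
    cyclically. *)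
Fixpoint descents b0 (p : seq bool) : nat :=
  if p is b :: p' then (b && ~~ head b0 p') + descents b0 p' else 0.

Lemma runs_exist k z : ~~ sm (iter k phi z) ->
  exists l, runs z l (iter k.+1 phi z) /\ run_darts z l = traject phi z k.+1.
Proof.
elim/ltn_ind: k z => k IH z nk.
have ex : exists i, ~~ sm (iter i phi z) by exists k.
set a := ex_minn ex; have [na mina] : ~~ sm (iter a phi z) /\ forall i, ~~ sm (iter i phi z) -> a <= i.
  by rewrite /a; case: ex_minnP.
have bef i : i < a -> sm (iter i phi z) by move=> lt; apply: contraTT lt; rewrite -leqNgt; exact: mina.
have := mina _ nk; rewrite leq_eqVlt => /orP[/eqP ea|lt].
  by exists [:: a]; rewrite /= -?ea cats0; split=> //; split.
have lt' : k - a.+1 < k by move: lt; clear; lia.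
have nk' : ~~ sm (iter (k - a.+1) phi (iter a.+1 phi z)) by rewrite -iterD subnK.
have [l [h1 h2]] := IH _ lt' _ nk'.
exists (a :: l); split.
  split=> //; suff <- : iter (k - a.+1).+1 phi (iter a.+1 phi z) = iter k.+1 phi z by [].
  by rewrite -iterD; congr (iter _ phi z); move: lt; clear; lia.
rewrite -[LHS]/(traject phi z a.+1 ++ run_darts (iter a.+1 phi z) l) h2 -trajectD.
by congr traject; move: lt; clear; lia.
Qed.

Lemma size_run_types z l : size (run_types z l) = size l.
Proof. by elim: l z => //= a l IH z; rewrite IH. Qed.

Section Counts.
Variables (x : T).
Hypothesis sme : forall z, z \in porbit phi x -> sm z -> e (phi z) = e z.

Lemma iter_porbit_mem z i : z \in porbit phi x -> iter i phi z \in porbit phi x.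
Proof.
rewrite -!eq_porbit_mem => /eqP <-; rewrite eq_porbit_mem.
by apply/porbitP; exists i; rewrite permX.
Qed.

Lemma run_const z a : z \in porbit phi x -> (forall i, i < a -> sm (iter i phi z)) -> forall i, i <= a -> e (iter i phi z) = e z.
Proof.
move=> zx h; elim=> [//|i IH] lt; rewrite iterS sme ?h ?IH //; first exact: ltnW.
exact: iter_porbit_mem.
Qed.

Lemma count_run (q : pred T) z a : (forall i, i < a -> sm (iter i phi z)) -> ~~ sm (iter a phi z) ->
  count (fun y => q y && ~~ sm y) (traject phi z a.+1) = q (iter a phi z).
Proof.
elim: a z => [|a IH] z h n; first by rewrite /= n andbT addn0.
rewrite -[LHS]/((q z && ~~ sm z) + count (fun y => q y && ~~ sm y) (traject phi (phi z) a.+1)).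
rewrite (h 0) // andbF add0n iterSr; apply: IH; last by rewrite -iterSr.
by move=> i lt; rewrite -iterSr; apply: h.
Qed.

Lemma run_counts z l zf : z \in porbit phi x -> runs z l zf ->
  [/\ count (fun y => e y && ~~ sm y) (run_darts z l) = count id (run_types z l),
      count (fun y => ~~ e y && ~~ sm y) (run_darts z l) = count negb (run_types z l) &
      count (fun y => [&& e y, ~~ sm y & ~~ e (phi y)]) (run_darts z l) = descents (e zf) (run_types z l)].
Proof.
elim: l z => [//|a l IH] z zx [h n r].
have cst := run_const zx h (leqnn a).
have [i1 i2 i3] := IH (iter a.+1 phi z) (iter_porbit_mem a.+1 zx) r.
have eD : run_darts z (a :: l) = traject phi z a.+1 ++ run_darts (iter a.+1 phi z) l by [].
have eT : run_types z (a :: l) = e z :: run_types (iter a.+1 phi z) l by [].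
have eS b q : descents (e zf) (b :: q) = (b && ~~ head (e zf) q) + descents (e zf) q by [].
have eC (q : pred bool) b s : count q (b :: s) = q b + count q s by [].
rewrite eD eT eS !eC !count_cat i1 i2 i3.
have c3 : count (fun y => [&& e y, ~~ sm y & ~~ e (phi y)]) (traject phi z a.+1) = e z && ~~ e (iter a.+1 phi z).
  rewrite -(@eq_count _ (fun y => (e y && ~~ e (phi y)) && ~~ sm y)); last by move=> y /=; case: (e y); case: (sm y); case: (e (phi y)).
  by rewrite count_run // cst.
rewrite count_run // (@count_run (fun y => ~~ e y)) // cst c3; split=> //.
congr (nat_of_bool (_ && ~~ _) + _); case: (l) r => [<-//|b l'] _ //.
Qed.

Lemma sum_traject (q : pred T) : \sum_(y in porbit phi x) q y = count q (traject phi x #|porbit phi x|).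
Proof.
rewrite (eq_bigl (mem (traject phi x #|porbit phi x|))); last by move=> y; rewrite porbit_traject.
rewrite -big_uniq ?uniq_traject_porbit //=.
by elim: (traject _ _ _) => [|y s IH]; rewrite ?big_nil ?big_cons //= IH.
Qed.
End Counts.
End Runs.

(* [p] tells which of the runs of a thin face, read from the end of an exterior one, are exterior. *)
Lemma thin_types (p : seq bool) : last false p ->
  (count id p = 1 /\ count negb p = 4) \/
  [/\ count id p = 2, count negb p = descents (head false p) p & descents (head false p) p <= 2] ->
  p \in [:: [:: false; false; false; false; true]; [:: true; true]; [:: false; true; true];
           [:: true; false; true]; [:: false; true; false; true]].
Proof.
move=> lst h; have sz : size p <= 5.
  rewrite -(count_predC id p); have -> : count (predC id) p = count negb p by apply: eq_count.
  by case: h => [[-> ->]|[-> -> ?]] //; lia.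
have {}h : (count id p == 1) && (count negb p == 4) ||
    [&& count id p == 2, count negb p == descents (head false p) p & descents (head false p) p <= 2].
  by case: h => [[-> ->]|[-> -> ->]]; rewrite ?eqxx ?orbT.
move: lst h; case: p sz => [|a [|b [|c [|d [|f [|]]]]]] //= _.
all: by do ?[case: a]; do ?[case: b]; do ?[case: c]; do ?[case: d]; do ?[case: f].
Qed.

Lemma run_len_eq (T : finType) (phi : {perm T}) (sm : pred T) z a : a < #|porbit phi z| ->
  (forall i, i < a -> sm (iter i phi z)) -> ~~ sm (iter a phi z) -> run_len phi sm z = a.
Proof.
move=> lt h n; apply/eqP; rewrite eqn_leq (run_len_ge lt h) andbT leqNgt; apply/negP => gt.
have brk : exists2 y, y \in porbit phi z & ~~ sm y by exists (iter a phi z); first exact: porbit_iter.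
by have [_ _ h2] := run_lenP brk; move: n; rewrite h2.
Qed.

Section ZeroChain.
Variables (S : Type) (Γ : LGraph S).

(* Three of the four interior arcs of a flat face, the middle two merged into [t], form with [p] its boundary. *)
Definition zero_arc (i1 p i4 : word S) : Prop := exists t n,
  [/\ occ Γ p n, geq Γ p (i1 ++ t ++ i4), size i1 + size t + size i4 + size p = n, 6 * size t < 2 * n &
      6 * size i1 < n /\ 6 * size i4 < n].

Inductive zero_chain : word S -> seq (word S) -> Prop :=
| zero_chain_nil u : zero_chain u [::]
| zero_chain_cons u v p ps : zero_arc (inv_word u) p v -> zero_chain v ps -> zero_chain u (p :: ps).
End ZeroChain.

(** * Flat faces along the first side of a polygon *)

Section PolygonSide.
Variables (S : Type) (Γ : LGraph S).
Hypothesis red : reduced Γ.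
Hypothesis gr : Gr'16 Γ.
Notation "u ≡ v" := (geq Γ u v) (at level 70).
Variables (al bt : word S) (rest : seq (word S)).
Notation sides := (al :: bt :: rest).
Variables (T : finType) (phi eps : {perm T}).
Variables (h : T -> step (plus Γ)) (dev : T -> word S) (o : T) (s : seq T).
Hypothesis P : polygon (Γ := Γ) sides phi eps h dev o s.
Notation O := (o :: s).
Notation w := [seq lb h d | d <- O].
Let R := pg_reduced P.
Let D := rd_diagram R.
Notation m := (mem (marks 0 sides) : pred nat).
Notation Q := (marked o s m).
Notation sm := (smooth phi eps Q).
Notation xt := (ext phi eps o).
Notation X := (outer_nth o s).
Notation fcost := (face_cost_of phi eps o s m).
Notation A := (size al).

Let gal : good Γ al. Proof. by apply: (pg_good P); left. Qed.

Let leA : A <= size O.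
Proof. by rewrite -(size_map (lb h)) (pg_label P) /= !size_cat leq_addr. Qed.

Let drop_take_al t n : t + n <= A -> take n (drop t w) = take n (drop t al).
Proof.
move=> le; rewrite (pg_label P) /= drop_cat; case: ltnP => lt.
  by rewrite takel_cat // size_drop; lia.
have -> : n = 0 by lia.
by rewrite !take0.
Qed.

Let al_factor t n : t + n <= A -> factor (take n (drop t w)) al.
Proof. by move=> le; rewrite drop_take_al //; exact: factor_sub. Qed.

(** Leaving [al], the run would cross the mark at position [A], where the second side begins. *)
Let run_al t a : t < A -> (forall j, t < j <= t + a -> ~~ m j) -> t + a < A.
Proof.
move=> lt um; rewrite ltnNge; apply/negP => ge; have := um A; rewrite lt ge => /(_ isT)/negP; apply.
by rewrite -[mem _ A]/(A \in 0 :: (0 + A) :: marks (0 + A + size bt) rest) !inE add0n eqxx orbT.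
Qed.

Let live_iter z k : (eps (iter k phi z) != iter k phi z) = (eps z != z).
Proof. exact: (rd_iter R z k).2. Qed.

Let inner_iter z k : (iter k phi z \in O) = (z \in O).
Proof. exact: (rd_iter R z k).1. Qed.

Lemma dev_walk z k : eps z != z -> dev (iter k phi z) ≡ dev z ++ [seq lb h d | d <- traject phi z k].
Proof.
move=> lz; elim: k => [|k IH]; first by rewrite cats0; exact: geqxx.
rewrite iterS trajectSr map_rcons -cats1 catA.
by apply: geqT (dg_phi D _) _; [rewrite live_iter|apply: geq_catr].
Qed.

Lemma dev_next z : eps z != z -> dev (phi z) ≡ dev (eps z).
Proof. by move=> lz; apply: geqT (dg_phi D lz) (geqC (dg_eps D lz)). Qed.

(** A factor of the label is read on a part of the arc, which is again an arc between the same two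
    faces. It is therefore not rigid, and stays below a sixth of any cycle on which it occurs. *)
Lemma int_run_small z a : eps z != z -> z \notin O -> ~~ xt z -> a < #|porbit phi z| ->
  (forall i, i < a -> sm (iter i phi z)) ->
  small Γ [seq lb h d | d <- traject phi z a.+1] /\ 6 * a.+1 < #|porbit phi z|.
Proof.
move=> lz zO xz lt ag.
have piece z' b : eps z' != z' -> z' \notin O -> ~~ xt z' -> b < #|porbit phi z'| ->
    (forall i, i < b -> sm (iter i phi z')) ->
    occ Γ [seq lb h d | d <- traject phi z' b.+1] #|porbit phi z'| /\ ~ rigid Γ [seq lb h d | d <- traject phi z' b.+1].
  move=> lz' zO' xz' lt' ag'; apply: (rd_int_piece R) => //.
  - by rewrite -(xtE R).
  - exact: (rd_no_self_glue red gr R).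
  - by move=> i /ag' /andP[/eqP].
have [oc nr] := piece z a lz zO xz lt ag.
split; last by have := occ_piece gr oc nr; rewrite size_map size_traject.
split; first exact: occ_reduced red oc.
move=> u n un [x [y e]] oc'; apply: (occ_piece gr oc') => rg.
set j := size x; set b := (size u).-1.
have bu : b.+1 = size u by rewrite /b; case: (u) un.
have sz : j + b.+1 + size y = a.+1.
  by have := congr1 size e; rewrite size_map size_traject !size_cat bu /j; clear; lia.
have eu : u = [seq lb h d | d <- traject phi (iter j phi z) b.+1].
  have -> : traject phi (iter j phi z) b.+1 = take b.+1 (drop j (traject phi z a.+1)).
    rewrite -sz -addnA !trajectD drop_size_cat ?size_traject //.
    by rewrite take_size_cat ?size_traject.
  by rewrite map_take map_drop e drop_size_cat // bu take_size_cat.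
have ep : porbit phi (iter j phi z) = porbit phi z by apply/eqP; rewrite eq_porbit_mem porbit_iter.
have ja : j <= a by move: sz; clear; lia.
have cz : xt (iter j phi z) = xt z.
  exact: (run_const (fun z _ => sm_ext R (z := z)) (porbit_id phi z) ag ja).
have [||||i lti|_ nr'] := piece (iter j phi z) b; last by apply: nr'; rewrite -eu.
- by rewrite live_iter.
- by rewrite inner_iter.
- by rewrite cz.
- by rewrite ep; apply: leq_ltn_trans lt; move: sz; clear; lia.
- by rewrite -iterD; apply: ag; move: lti sz; clear; lia.
Qed.

(** The part of [al] between the two contacts and the interior arc joining them close up, so they
    are inverse words by [good_small_inv]. Hence [al] follows the face along both contacts and the
    arc between, more than half of it. *)
Lemma two_runs z b k a tb ta : eps z != z -> z \notin O ->
  (forall i, i <= b -> eps (iter i phi z) = X (tb + (b - i))) -> tb + b < A ->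
  (forall i, i <= a -> eps (iter i phi (iter (b.+1 + k) phi z)) = X (ta + (a - i))) -> ta + a < tb ->
  small Γ [seq lb h d | d <- traject phi (iter b.+1 phi z) k] ->
  b.+1 + k + a.+1 <= #|porbit phi z| -> #|porbit phi z| < 2 * (b.+1 + k + a.+1) -> False.
Proof.
move=> lz zO eb bA ea ab sq len big.
set z1 := iter b.+1 phi z in sq *; set z2 := iter (b.+1 + k) phi z in ea *.
set q := [seq lb h d | d <- _] in sq.
have ez2 : z2 = iter k phi z1 by rewrite /z2 addnC iterD.
have ltb : tb < size O by apply: leq_trans leA; apply: leq_ltn_trans bA; rewrite leq_addr.
have lta : ta + a < size O by apply: ltn_trans ltb.
have l1 : eps z1 != z1 by rewrite live_iter.
have l2 : eps z2 != z2 by rewrite live_iter.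
have d2 : dev z2 ≡ dev z1 ++ q by rewrite ez2; exact: dev_walk.
have d3 : dev (X (ta + a).+1) ≡ dev z2.
  have e : eps z2 = X (ta + a) by rewrite [eps z2](ea 0) // subn0.
  have lx : eps (X (ta + a)) != X (ta + a) := pg_live P lta.
  rewrite (outer_nthS R); last by apply: leq_ltn_trans ltb.
  by apply: geqT (dev_next lx) _; rewrite -e (dg_epsK D); exact: geqxx.
have d4 : dev z1 ≡ dev (X tb).
  have -> : X tb = eps (iter b phi z) by rewrite eb // subnn addn0.
  by apply: dev_next; rewrite live_iter.
set v := take (tb - (ta + a).+1) (drop (ta + a).+1 w).
have d5 : dev (X tb) ≡ dev (X (ta + a).+1) ++ v by apply: (pg_between P); rewrite ab.
have vq : v ++ q ≡ [::].
  apply: (geq_cancell (A := dev (X (ta + a).+1))); rewrite cats0 catA.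
  apply: geqC; apply: geqT d3 _; apply: geqT d2 _; apply: geq_catr.
  exact: geqT d4 d5.
have fv : factor v al by apply: al_factor; rewrite subnKC //; apply: ltnW; apply: leq_ltn_trans bA; rewrite leq_addr.
have ev := good_small_inv red gr (good_factor fv gal) sq vq.
set N := b.+1 + k + a.+1 in len big *.
have el : [seq lb h d | d <- traject phi z N] = inv_word (take N (drop ta w)).
  have sv : size v = k by rewrite ev size_inv size_map size_traject.
  have szv : tb - (ta + a).+1 = k by rewrite -sv size_takel // size_drop size_map; apply: leq_sub2r; exact: ltnW.
  have eN : N = a.+1 + (k + b.+1) by rewrite /N; clear; lia.
  have -> : take N (drop ta w) = take a.+1 (drop ta w) ++ v ++ take b.+1 (drop tb w).
    rewrite eN takeD; congr (_ ++ _); rewrite drop_drop [a.+1 + ta]addnC takeD; congr (_ ++ _).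
      by rewrite /v szv addnS.
    rewrite drop_drop; congr (take _ (drop _ _)); move: szv ab; clear; lia.
  rewrite !inv_cat ev inv_wordK -(outer_run_label R lz _ eb); last exact: leq_trans bA leA.
  rewrite -(outer_run_label R l2 lta ea) /N -addnA trajectD trajectD !map_cat -catA; congr (_ ++ (_ ++ _)).
  by rewrite -iterD addnC.
have lN : ta + N <= A.
  have := congr1 size ev; rewrite size_inv size_map size_traject size_takel; last by rewrite size_drop size_map; apply: leq_sub2r; exact: ltnW.
  by move: bA ab; rewrite /N; clear; lia.
have oc : occ Γ (take N (drop ta w)) #|porbit phi z|.
  by rewrite -[take _ _]inv_wordK -el; apply: occ_inv; exact: (face_occ R).
have [_ tl] := gal.
have szN : size (take N (drop ta w)) = N by rewrite size_takel // size_drop size_map; move: lN leA; clear; lia.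
have := tl _ _ _ (al_factor lN) oc; rewrite szN => hh.
have : 2 * N <= #|porbit phi z| by apply: hh => e; move: szN; rewrite e.
by move: big; clear; lia.
Qed.

(** The stretch between two glued edges is trivial, hence empty, and the edges would be a cancelling
    pair of [al]. *)
Lemma unglued_al i j : i < j -> j < A -> eps (X i) <> X j.
Proof.
move=> ij jA e; have lj : j < size O by apply: leq_trans leA.
have := glued_trivial P (introT andP (conj ij lj)) e.
have fv : factor (take (j - i.+1) (drop i.+1 w)) al by apply: al_factor; rewrite subnKC // ltnW.
move/(good_nontrivial red gr (good_factor fv gal)) => /(congr1 size).
rewrite size_takel; last by rewrite size_drop size_map; apply: leq_sub2r; exact: ltnW.
move=> /eqP; rewrite subn_eq0 => le; have ej : j = i.+1 by apply/eqP; rewrite eqn_leq le ij.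
have gl := glued_label P (lb h o) (ltn_trans ij lj) lj e.
have [r _] := gal; apply: (r (take i al) (nth (lb h o) w i) (drop j.+1 al)).
have nE k : k < A -> nth (lb h o) w k = nth (lb h o) al k by move=> lt; rewrite (pg_label P) /= nth_cat lt.
have iA : i < A by apply: ltn_trans jA.
rewrite -gl !nE // -{1}(cat_take_drop i al); congr (_ ++ _).
by rewrite (drop_nth (lb h o)) // -ej (drop_nth (lb h o) jA).
Qed.

Section Position.
Variable i : nat.
Hypothesis iA : i < A.
Let lti : i < size O. Proof. exact: leq_trans leA. Qed.
Hypothesis yO : eps (X i) \notin O.
Let y := eps (X i).
Let n := #|porbit phi y|.
Notation t := (run_start sides phi eps o s i).
Let d := phi (eps (X t)).
Hypothesis thin : fcost y <= 12.

Let ly : eps y != y. Proof. exact: (pos_live P lti). Qed.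
Let tA : t < A. Proof. by have [ti _ _ _ _] := run_startP red gr P lti yO; apply: leq_ltn_trans iA. Qed.
Let em : eps (X t) \in porbit phi y. Proof. exact: (start_mem red gr P lti yO). Qed.
Let dm : d \in porbit phi y. Proof. by rewrite -eq_porbit_mem porbit_perm1 eq_porbit_mem. Qed.
Let ezy z : z \in porbit phi y -> porbit phi z = porbit phi y. Proof. by move=> zy; apply/eqP; rewrite eq_porbit_mem. Qed.
Let nt : ~~ sm (eps (X t)). Proof. by have [] := run_startP red gr P lti yO. Qed.
Let inX z : z \in porbit phi y -> z \notin O /\ eps z != z.
Proof. by move=> zy; have [h1 h2] := dg_porbit D (rd_live R) zy; rewrite h1 h2. Qed.

(** The runs are listed from the dart after the boundary arc at [i], so that this arc comes last. *)
Lemma face_chain : exists l, [/\ runs phi sm d l d, run_darts phi d l = traject phi d n &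
  run_types phi xt d l \in [:: [:: false; false; false; false; true]; [:: true; true]; [:: false; true; true];
           [:: true; false; true]; [:: false; true; false; true]]].
Proof.
have n0 : 0 < n by apply/card_gt0P; exists y; exact: porbit_id.
have itn : iter n phi d = d by rewrite /n -(ezy dm) iter_porbit.
have eL : iter n.-1 phi d = eps (X t) by apply: (@perm_inj _ phi); rewrite -iterS prednK.
have nL : ~~ sm (iter n.-1 phi d) by rewrite eL.
have [l []] := runs_exist nL; rewrite prednK // itn => hr hd; exists l; split=> //.
have sme z : z \in porbit phi d -> sm z -> xt (phi z) = xt z by move=> _; exact: (sm_ext R).
have [c1 c2 c3] := run_counts sme (porbit_id phi d) hr; rewrite hd in c1 c2 c3.
have lst : last false (run_types phi xt d l).
  have : forall z, z \in porbit phi d -> runs phi sm z l d -> l <> [::] -> last false (run_types phi xt z l) = xt (eps (X t)).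
    elim: (l) => // a l' IH z zd [h1 h2 h3] _.
    case: l' IH h3 => [_ e|b l' IH h3]; last by apply: (IH (iter a.+1 phi z)) => //; exact: iter_porbit_mem.
    rewrite /= -(run_const sme zd h1 (leqnn a)); congr (ext _ _ _ _).
    by apply: (@perm_inj _ phi); rewrite -iterS e.
  move=> -> //; first by rewrite (xtE R) (dg_epsK D) outer_mem //; exact: leq_trans tA leA.
    exact: porbit_id.
  by move=> el; move: hd; rewrite el /=; case: (n) n0.
have bI := pg_int_bound red gr P ly yO; have bE := pg_ext_bound P ly yO.
have smey z : z \in porbit phi y -> sm z -> xt (phi z) = xt z by move=> _; exact: (sm_ext R).
have c12 : fcost y = 12 by apply/eqP; rewrite eqn_leq thin; exact: (face_ge12 smey bI bE).
have hd0 : head false (run_types phi xt d l) = xt d.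
  by case: (l) hd => [|a l'] //=; case: (n) n0.
have sumE (q : pred T) : \sum_(z in porbit phi y) q z = count q (traject phi d n).
  by rewrite -(ezy dm) sum_traject (ezy dm).
apply: thin_types lst _; rewrite hd0 -c1 -c2 -c3 -!sumE.
by case: (face_eq12 smey bI bE c12) => [[e1 e2 e3]|[e1 e2 e3]]; [left|right]; rewrite -/(ext_runs phi sm xt y) -/(int_runs phi sm xt y) -/(ext_int phi sm xt y) e1 e2; split.
Qed.

(** Contact with another side through the face at [i]: one letter crosses the boundary edge and at
    most [n] more lead around the face. *)
Definition near j0 : Prop := exists j e, [/\ A <= j < size O, size e <= n.+1 & dev (X j0) ++ e ≡ dev (X j)].

Lemma face_near z a : z \in porbit phi y -> xt z -> a < n -> (forall k, k < a -> sm (iter k phi z)) ->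
  ~ near i -> exists t', [/\ t' + a < A, forall k, k <= a -> eps (iter k phi z) = X (t' + (a - k)) & X t' = eps (iter a phi z)].
Proof.
move=> zy xz lt ag nn; have [zO lz] := inX zy.
have lt' : a < #|porbit phi z| by rewrite (ezy zy).
have [t' [h1 h2 h3 _]] := ext_run_occ R (pg_m0 P) lz zO xz lt' ag.
exists t'; split=> //; last by rewrite h2 // subnn addn0.
apply: run_al h3; rewrite ltnNge; apply/negP => ge; apply: nn.
have zam : iter a phi z \in porbit phi y by rewrite -(ezy zy); exact: porbit_iter.
have eX : eps (iter a phi z) = X t' by rewrite h2 // subnn addn0.
move: zam; rewrite porbit_traject => /trajectP[k ltk ek].
have lzk : eps (iter a phi z) != iter a phi z by rewrite live_iter.
have h4 : dev (X t') ≡ dev (phi (iter a phi z)) by rewrite -eX; apply/geqC/dev_next.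
have lx := pg_live P lti.
exists t', (lb h (X i) :: [seq lb h d | d <- traject phi y k.+1]); split.
- by rewrite ge (leq_ltn_trans _ h1) // leq_addr.
- by rewrite /= size_map size_traject.
- rewrite -cat1s catA; apply: geqC; apply: geqT h4 _; rewrite ek -iterS.
  by apply: geqT (dev_walk k.+1 ly) _; apply: geq_catr; exact: (dg_eps D).
Qed.

Lemma iter_porbit_inj z j k : j < #|porbit phi z| -> k < #|porbit phi z| -> iter j phi z = iter k phi z -> j = k.
Proof.
move=> lj lk e; apply/eqP; rewrite -(nth_uniq z _ _ (uniq_traject_porbit phi z)) ?size_traject //.
by rewrite !nth_traject // e.
Qed.

Hypothesis far : ~ near i.

(** Far from the other sides both boundary runs lie on [al], and they are disjoint there. In either
    order the configuration of [two_runs] arises, and the interior arc left out is below a sixth of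
    the face. *)
Lemma two_ext zE aE k2 zL aL k1 : zE \in porbit phi y ->
  zL = iter k2 phi (iter aE.+1 phi zE) -> zE = iter k1 phi (iter aL.+1 phi zL) ->
  xt zE -> (forall k, k < aE -> sm (iter k phi zE)) ->
  xt zL -> (forall k, k < aL -> sm (iter k phi zL)) ->
  aE.+1 + k2 + aL.+1 + k1 = n -> 6 * k1 < n -> 6 * k2 < n ->
  small Γ [seq lb h d | d <- traject phi (iter aE.+1 phi zE) k2] ->
  small Γ [seq lb h d | d <- traject phi (iter aL.+1 phi zL) k1] -> False.
Proof.
move=> zEy eL eE xE rE xL rL sum s1 s2 sm2 sm1.
have zLy : zL \in porbit phi y by rewrite eL -(ezy zEy); do 2!apply: iter_porbit_mem; exact: porbit_id.
have [zEO lE] := inX zEy; have [zLO lL] := inX zLy.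
have [|t1 [h1 h2 h3]] := face_near zEy xE _ rE far; first by move: sum; clear; lia.
have [|t2 [g1 g2 g3]] := face_near zLy xL _ rL far; first by move: sum; clear; lia.
have inj j k : j <= aE -> k <= aL -> iter j phi zE <> iter k phi zL.
  move=> le1 le2; rewrite eL -!iterD => e.
  have : j = k + k2 + aE.+1 by apply: iter_porbit_inj e; rewrite (ezy zEy) -/n; move: le1 le2 sum; clear; lia.
  by move: le1; clear; lia.
have eps_inj j k : j <= aE -> k <= aL -> eps (iter j phi zE) <> eps (iter k phi zL).
  by move=> le1 le2 /perm_inj; exact: inj.
have [lt|ge] := ltnP (t2 + aL) t1.
  apply: (@two_runs zE aE k2 aL t1 t2) => //; rewrite ?(ezy zEy) -/n ?[aE.+1 + k2]addnC ?iterD -?eL //.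
  - by rewrite [k2 + _]addnC -sum leq_addr.
  - by move: sum s1; clear; lia.
have [lt|ge2] := ltnP (t1 + aE) t2.
  apply: (@two_runs zL aL k1 aE t2 t1) => //; rewrite ?(ezy zLy) -/n ?[aL.+1 + k1]addnC ?iterD -?eE //.
  - by move: sum; clear; lia.
  - by move: sum s2; clear; lia.
have [le|lt] := leqP t1 t2.
  apply: (eps_inj (aE - (t2 - t1)) aL) => //; first by rewrite leq_subr.
  by rewrite h2 ?leq_subr // -g3; congr (X _); move: le ge2; clear; lia.
apply: (eps_inj aE (aL - (t1 - t2))) => //; first by rewrite leq_subr.
by rewrite g2 ?leq_subr // -h3; congr (X _); move: lt ge; clear; lia.
Qed.

Let arc z a : z \in porbit phi y -> ~~ xt z -> a < n -> (forall k, k < a -> sm (iter k phi z)) ->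
  small Γ [seq lb h d | d <- traject phi z a.+1] /\ 6 * a.+1 < n.
Proof.
move=> zy xz lt ag; have [zO lz] := inX zy.
by have := int_run_small lz zO xz; rewrite (ezy zy); apply.
Qed.

Let small_nil : small Γ ([::] : word S).
Proof.
split; first by case.
by move=> u k un [x [y' e]]; case: x u y' e un => [|? ?] [|? ?].
Qed.

Definition first_arc j := [seq lb h d | d <- traject phi (phi (eps (X j))) (run_len phi sm (phi (eps (X j)))).+1].

(** All patterns of [face_chain] but the first have two boundary runs and fall to [two_ext]. The
    second and third interior arcs are merged into the middle word, below two sixths of the face. *)
Lemma face_zero : exists a z4 a4 y3,
  [/\ t + a < A, zero_arc Γ (first_arc t) (take a.+1 (drop t w)) [seq lb h d | d <- traject phi z4 a4.+1] & ~~ xt d] /\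
  [/\ eps (iter a4.+1 phi z4) = X (t + a), (forall j, j < a4 -> sm (iter j phi z4)), ~~ sm y3, phi y3 = z4 & ~~ sm (iter a4 phi z4)] /\
  (z4 \notin O /\ ~~ xt z4 /\ eps z4 != z4).
Proof.
have n0 : 0 < n by apply/card_gt0P; exists y; exact: porbit_id.
have [l [hr hd ht]] := face_chain.
have sz l' z : size (run_darts phi z l') = sumn [seq a.+1 | a <- l'].
  by elim: l' z => //= a l' IH z; rewrite -[traject _ _ _]/(traject phi (phi z) a) size_cat size_traject IH.
have szl : sumn [seq a.+1 | a <- l] = n by rewrite -(sz l d) hd size_traject.
have mem k z : z \in porbit phi y -> iter k phi z \in porbit phi y by exact: iter_porbit_mem.
have lsz := size_run_types phi xt d l.
have n6 : 6 * 0 < n by [].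
move: ht; rewrite !inE => /or4P[/eqP et|/eqP et|/eqP et|/orP[] /eqP et]; rewrite et in lsz.
- case: l hr hd szl lsz et => [|a1 [|a2 [|a3 [|a4 [|a []]]]]] // hr hd szl _ [x1 x2 x3 x4 x5].
  set z2 := iter a1.+1 phi d in x2 *; set z3 := iter a2.+1 phi z2 in x3 *; set z4 := iter a3.+1 phi z3 in x4 *.
  set z0 := iter a4.+1 phi z4 in x5 *.
  case: hr => r1 n1 [r2 n2 [r3 n3 [r4 n4 [r5 n5 ed]]]]; rewrite -/z2 -/z3 -/z4 -/z0 in r2 n2 r3 n3 r4 n4 r5 n5 ed.
  have szn : a1.+1 + (a2.+1 + (a3.+1 + (a4.+1 + a.+1))) = n by move: szl; rewrite /= addn0.
  have [b1 b2 b3 b4 b5] : [/\ a1 < n, a2 < n, a3 < n, a4 < n & a < n] by move: szn; clear; split; lia.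
  have m2 := mem a1.+1 _ dm; have m3 := mem a2.+1 _ m2; have m4 := mem a3.+1 _ m3; have m0 := mem a4.+1 _ m4.
  rewrite -/z2 in m2 m3; rewrite -/z3 in m3 m4; rewrite -/z4 in m4 m0; rewrite -/z0 in m0.
  have [_ s1] := arc dm (negbT x1) b1 r1; have [_ s2] := arc m2 (negbT x2) b2 r2.
  have [_ s3] := arc m3 (negbT x3) b3 r3; have [_ s4] := arc m4 (negbT x4) b4 r4.
  have [t' [h1 h2 h3]] := face_near m0 x5 b5 r5 far.
  have et' : t' = t.
    have lt' : t' < size O by apply: leq_trans leA; apply: leq_ltn_trans h1; rewrite leq_addr.
    rewrite -(index_outer_nth R lt') h3.
    have -> : iter a phi z0 = eps (X t) by apply: (@perm_inj _ phi); rewrite -iterS ed.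
    by rewrite (dg_epsK D) (index_outer_nth R) //; apply: leq_trans leA.
  subst t'.
  have [dO ld] := inX dm; have [z4O l4] := inX m4; have [z0O l0] := inX m0.
  have ltO : t + a < size O by apply: leq_trans leA.
  have elp := outer_run_label R l0 ltO h2.
  have e1 : run_len phi sm d = a1 by apply: run_len_eq => //; rewrite (ezy dm).
  exists a, z4, a4, (iter a3 phi z3); split; last first.
    split; last by rewrite x4.
    by split=> //; rewrite -/z0; have := h2 0 isT; rewrite subn0.
  split=> //; last by rewrite x1.
  exists ([seq lb h d | d <- traject phi z2 a2.+1] ++ [seq lb h d | d <- traject phi z3 a3.+1]), n; split.
  + rewrite -[take _ _]inv_wordK -elp; apply: occ_inv; rewrite /n -(ezy m0); apply: (face_occ R) => //.
    by rewrite (ezy m0).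
  + rewrite /first_arc -/d e1 -[take _ _]inv_wordK -elp.
    set L1 := [seq lb h d | d <- traject phi d a1.+1]; set L2 := [seq lb h d | d <- traject phi z2 _].
    set L3 := [seq lb h d | d <- traject phi z3 _]; set L4 := [seq lb h d | d <- traject phi z4 _].
    set L0 := [seq lb h d | d <- traject phi z0 _].
    have h4 := dev_walk n ld.
    have e5 : [seq lb h d | d <- traject phi d n] = (L1 ++ (L2 ++ L3) ++ L4) ++ L0.
      by rewrite -hd /L1 /L2 /L3 /L4 /L0 -!catA -!map_cat -[run_darts _ _ _]/(traject phi d a1.+1 ++ traject phi z2 a2.+1 ++ traject phi z3 a3.+1 ++ traject phi z4 a4.+1 ++ traject phi z0 a.+1 ++ [::]) cats0.
    rewrite e5 /n -(ezy dm) iter_porbit in h4.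
    apply: geqC; apply: geq_invP.
    by apply: (geq_cancell (A := dev d)); rewrite cats0; exact: geqC.
  + rewrite /first_arc -/d e1 size_cat !size_map !size_traject size_takel; first by rewrite -szn; clear; lia.
    by rewrite size_drop size_map ltn_subRL.
  + by rewrite size_cat !size_map !size_traject; move: s2 s3; clear; lia.
  + by rewrite /first_arc -/d e1 !size_map !size_traject.
- case: l hr hd szl lsz et => [|a1 [|a2 []]] // hr hd szl _ [x1 x2]; case: hr => r1 n1 [r2 n2 ed].
  by case: (@two_ext d a1 0 (iter a1.+1 phi d) a2 0) => //; move: szl; rewrite /=; clear; lia.
- case: l hr hd szl lsz et => [|a1 [|a2 [|a3 []]]] // hr hd szl _ [x1 x2 x3]; case: hr => r1 n1 [r2 n2 [r3 n3 ed]].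
  have [|q1 s1] := arc dm (negbT x1) _ r1; first by move: szl; rewrite /=; clear; lia.
  case: (@two_ext (iter a1.+1 phi d) a2 0 (iter a2.+1 phi (iter a1.+1 phi d)) a3 a1.+1) => //; try by rewrite ed.
  + exact: mem.
  + by move: szl; rewrite /=; clear; lia.
- case: l hr hd szl lsz et => [|a1 [|a2 [|a3 []]]] // hr hd szl _ [x1 x2 x3]; case: hr => r1 n1 [r2 n2 [r3 n3 ed]].
  have [|q2 s2] := arc (mem a1.+1 _ dm) (negbT x2) _ r2; first by move: szl; rewrite /=; clear; lia.
  by case: (@two_ext d a1 a2.+1 (iter a2.+1 phi (iter a1.+1 phi d)) a3 0) => //; move: szl; rewrite /=; clear; lia.
- case: l hr hd szl lsz et => [|a1 [|a2 [|a3 [|a4 []]]]] // hr hd szl _ [x1 x2 x3 x4]; case: hr => r1 n1 [r2 n2 [r3 n3 [r4 n4 ed]]].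
  have [|q1 s1] := arc dm (negbT x1) _ r1; first by move: szl; rewrite /=; clear; lia.
  have [|q3 s3] := arc (mem a2.+1 _ (mem a1.+1 _ dm)) (negbT x3) _ r3; first by move: szl; rewrite /=; clear; lia.
  case: (@two_ext (iter a1.+1 phi d) a2 a3.+1 (iter a3.+1 phi (iter a2.+1 phi (iter a1.+1 phi d))) a4 a1.+1) => //; try by rewrite ed.
  + exact: mem.
  + by move: szl; rewrite /=; clear; lia.
Qed.
End Position.

Let notQ z : z \notin O -> z \notin Q.
Proof. by move=> zO; rewrite inE (negPf zO). Qed.

Section Link.
Variables (t0 : nat) (z4 y3 : T) (a4 : nat).
Hypothesis ltA : t0.+1 < A.
Let lt0 : t0.+1 < size O. Proof. exact: leq_trans leA. Qed.
Hypothesis e4 : eps (iter a4.+1 phi z4) = X t0.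
Hypothesis r4 : forall j, j < a4 -> sm (iter j phi z4).
Hypothesis n4 : ~~ sm (iter a4 phi z4).
Hypothesis n3 : ~~ sm y3.
Hypothesis e3 : phi y3 = z4.
Hypothesis z4O : z4 \notin O.
Let z0E : phi (iter a4 phi z4) = eps (X t0). Proof. by rewrite -e4 (dg_epsK D). Qed.
Let d' := phi (eps (X t0.+1)).

Lemma next_start : ~~ sm (eps (X t0.+1)).
Proof.
apply/negP => sy; case/andP: (sy) => /eqP e _; case/negP: n4.
rewrite (dg_epsK D) (outer_nthS R) // in e.
suff -> : iter a4 phi z4 = eps (X t0.+1) by [].
by apply: (@perm_inj _ phi); rewrite z0E -(perm_inj e) (dg_epsK D) (outer_nthS R).
Qed.

Hypothesis yO : eps (X t0.+1) \notin O.
Hypothesis xd : ~~ xt d'.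
Hypothesis nb : ~~ branching phi eps o s (X t0.+1).

Let dO : d' \notin O. Proof. by rewrite (fcycle_mem _ (dg_cycle D)). Qed.
Let ld : eps d' != d'.
Proof. by rewrite (rd_iter R (eps (X t0.+1)) 1).2 (rd_eps_live R) (pg_live P). Qed.

(** A boundary vertex that does not branch but has an interior edge has degree three: its corners
    are the boundary and the two consecutive flat faces, which therefore share that edge. *)
Lemma link_base : eps d' = iter a4 phi z4.
Proof.
have xO : X t0.+1 \in O by exact: outer_mem.
have edO : phi (eps d') \notin O by rewrite (fcycle_mem _ (dg_cycle D)) -(xtE R).
have := iter_porbit (eps * phi)%g (X t0.+1).
have : 0 < #|porbit (eps * phi)%g (X t0.+1)| by apply/card_gt0P; exists (X t0.+1); exact: porbit_id.
move: nb; rewrite /branching xO -/d' dO edO !andbT -ltnNge.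
case: #|porbit _ _| => [|[|[|[|k]]]] //= _ _; rewrite !permM -/d' => e.
- by move: dO; rewrite e xO.
- by move: edO; rewrite e xO.
- rewrite (outer_nthS R) // in e; apply: (@perm_inj _ phi); rewrite z0E -(perm_inj e).
  by rewrite (dg_epsK D).
Qed.

(** The two arcs are followed from their common base. Neither ends first, because a vertex where one
    arc stops stops the other as well. *)
Lemma link_arcs : [seq lb h d | d <- traject phi z4 a4.+1] = inv_word (first_arc t0.+1).
Proof.
have [_ n1 r1] := run_lenP (pg_break red gr P ld dO).
rewrite /first_arc -/d'; rewrite /run_end in n1; set a1 := run_len phi sm d' in n1 r1 *.
have step i : i <= a1 -> i <= a4 -> eps (iter i phi d') = iter (a4 - i) phi z4.
  elim: i => [|i IH] l1 l2; first by rewrite subn0 link_base.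
  have /andP[/eqP e _] := r1 i l1; apply: (@perm_inj _ phi).
  by rewrite iterS e (IH (ltnW l1) (ltnW l2)) -iterS subnSK.
have ea : a1 = a4.
  case: (ltngtP a1 a4) => // [lt|gt].
    have e1 := step a1 (leqnn _) (ltnW lt); set v := iter a1 phi d' in n1 e1.
    have lu : a4 - a1.+1 < a4 by move: lt; clear; lia.
    have eu : phi (iter (a4 - a1.+1) phi z4) = eps v by rewrite e1 -iterS subnSK.
    have /andP[/eqP e _] := r4 lu; rewrite eu (dg_epsK D) in e.
    case/negP: n1; apply/andP; split; last by apply: notQ; rewrite e1 inner_iter.
    by rewrite e (dg_epsK D) eu.
  have /andP[/eqP e _] := r1 a4 gt; rewrite (step a4 (ltnW gt) (leqnn _)) subnn /= -e3 in e.
  have e5 : eps z4 = iter a4 phi d' by rewrite -(dg_epsK D (iter a4 phi d')) (step a4 (ltnW gt) (leqnn _)) subnn.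
  have e6 : eps y3 = phi (iter a4 phi d') by rewrite -(perm_inj e) (dg_epsK D).
  case/negP: n3; apply/andP; split; first by rewrite e3 e5 e6.
  by apply: notQ; rewrite e6 -iterS inner_iter.
by rewrite ea; apply: (rd_label_run R) => // i le; rewrite step ?ea.
Qed.
End Link.

Section Window.
Variables (M t0 B : nat).
Hypothesis touch : forall u n, u <> [::] -> factor u al -> occ Γ u n -> size u <= M.
Hypothesis BA : B <= A.

(** A thin face is at most six times as long as some boundary arc ([thin_run_long]), hence at most
    [6 * M]. This replaces [near] by a condition that no longer mentions the face. *)
Definition close i : Prop := exists j e, [/\ A <= j < size O, size e <= 6 * M + 1 & dev (X i) ++ e ≡ dev (X j)].

Definition flat i : Prop := [/\ eps (X i) \notin O, fcost (eps (X i)) <= 12, ~ close i & ~~ branching phi eps o s (X i)].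

Lemma touch_run t a n : t < A -> (forall j, t < j <= t + a -> ~~ m j) -> occ Γ (take a.+1 (drop t w)) n -> a.+1 <= M.
Proof.
move=> lt um oc; have lt2 := run_al lt um.
have sz : size (take a.+1 (drop t w)) = a.+1.
  by rewrite size_takel // size_drop size_map ltn_subRL; exact: leq_trans leA.
rewrite -{1}sz; apply: touch oc => [e|]; first by rewrite e in sz.
by apply: al_factor; rewrite addnS.
Qed.

Lemma run_start_close i : i < A -> eps (X i) \notin O -> i < run_start sides phi eps o s i + M.
Proof.
move=> iA yO; have lti : i < size O by apply: leq_trans leA.
have [ti nst lt eX um] := run_startP red gr P lti yO.
set t := run_start sides phi eps o s i in ti nst lt eX um *.
have tA : t < A by apply: leq_ltn_trans iA.
have tO : t < size O by apply: leq_trans leA.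
have [_ el] := run_start_len red gr P lti yO.
have [l1 _ l3] := run_lenP (pg_break red gr P (pos_live P lti) yO); rewrite el -/t in l1 l3.
have [t' [h1 h2 h3 h4 h5]] := pos_run P lti yO (porbit_id _ _) (pos_ext P lti) l1 l3.
have et : t' = t.
  rewrite -(index_outer_nth R (i := t')); last by apply: leq_ltn_trans h1; rewrite leq_addr.
  by rewrite -h2 eX // subKn // (dg_epsK D) (index_outer_nth R).
rewrite et in h4 h5; have hM := touch_run tA h4 h5.
by move: ti hM; clear; lia.
Qed.

Lemma flat_far i : i < A -> eps (X i) \notin O -> fcost (eps (X i)) <= 12 -> ~ close i -> ~ near i i.
Proof.
move=> iA yO thin nc [j [e [h1 h2 h3]]]; apply: nc; exists j, e; split=> //.
have lti : i < size O by apply: leq_trans leA.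
have [b [g1 g2 g3 g4]] := thin_run_long red gr P lti yO thin.
have [ti _ _ _ _] := run_startP red gr P lti yO.
have hM := touch_run (leq_ltn_trans ti iA) g2 g3.
by apply: leq_trans h2 _; move: g4 hM; clear; lia.
Qed.

Hypothesis flatW : forall i, t0 <= i < B -> flat i.

(** From a position where an arc starts, each flat face hands its last interior arc on to the next
    by [link_arcs]. The last arc may run past [B], but stays on [al]; [f] is the fuel of the
    induction. *)
Lemma chain_from f t : B - t <= f -> t0 <= t < B -> ~~ sm (eps (X t)) ->
  exists ps te, [/\ zero_chain Γ (inv_word (first_arc t)) ps, flatten ps = take (te - t) (drop t w), B <= te <= A & t <= te].
Proof.
elim: f t => [|f IH] t lf tb nst; first by move: lf tb; clear; lia.
have /andP[t0t tB] := tb; have tA : t < A := leq_trans tB BA.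
have [yO thin nc nbr] := flatW tb.
have es : run_start sides phi eps o s t = t by rewrite /run_start run_len0 // subn0.
have [a [z4 [a4 [y3 []]]]] := face_zero tA yO thin (flat_far tA yO thin nc).
rewrite es => -[h1 h2 h3] [[g1 g2 g3 g4 g5] [k1 [k2 k3]]].
have [lt|ge] := ltnP (t + a).+1 B; last first.
  exists [:: take a.+1 (drop t w)], (t + a).+1; split.
  - by apply: zero_chain_cons (zero_chain_nil _ _); rewrite inv_wordK; exact: h2.
  - by rewrite /= cats0 -addnS addKn.
  - by rewrite ge.
  - by rewrite -addnS leq_addr.
have ltA : (t + a).+1 < A by apply: leq_trans BA.
have tb' : t0 <= (t + a).+1 < B by rewrite lt andbT; apply: leq_trans t0t _; rewrite -addnS leq_addr.
have [yO' thin' nc' nbr'] := flatW tb'.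
have ns' := next_start ltA g1 g5.
have [|ps [te [c1 c2 c3 c4]]] := IH (t + a).+1 _ tb' ns'; first by move: lf tB; clear; lia.
have es' : run_start sides phi eps o s (t + a).+1 = (t + a).+1 by rewrite /run_start run_len0 // subn0.
have xd' : ~~ xt (phi (eps (X (t + a).+1))).
  by have [? [? [? [? []]]]] := face_zero ltA yO' thin' (flat_far ltA yO' thin' nc'); rewrite es' => -[].
have el := link_arcs ltA g1 g2 g3 g4 k1 yO' xd' nbr'.
exists (take a.+1 (drop t w) :: ps), te; split=> //.
- by apply: zero_chain_cons; [rewrite inv_wordK; exact: h2|rewrite el].
- rewrite /= c2; have -> : te - t = a.+1 + (te - (t + a).+1) by move: c4; clear; lia.
  by rewrite takeD drop_drop; congr (_ ++ take _ (drop _ _)); rewrite addSn addnC.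
- by apply: leq_trans c4; rewrite -addnS leq_addr.
Qed.

(** Arcs have at most [M] edges, so the arc through position [t0 + M] starts inside the window; from
    there one chain reaches the end of the window. *)
Lemma window_bound Rr : t0 + M < B ->
  (forall u ps, zero_chain Γ u ps -> factor (flatten ps) al -> size (flatten ps) <= Rr) -> B <= t0 + M + Rr.
Proof.
move=> ltB K3; set i := t0 + M.
have ib : t0 <= i < B by rewrite leq_addr.
have iA : i < A by apply: leq_trans BA.
have lti : i < size O by apply: leq_trans leA.
have [yO thin nc _] := flatW ib.
have [ti nst _ _ _] := run_startP red gr P lti yO.
have cl := run_start_close iA yO.
set t := run_start sides phi eps o s i in ti nst cl.
have tb : t0 <= t < B.
  by move: ti cl ib; rewrite /i; clear; lia.
have [ps [te [c1 c2 c3 c4]]] := chain_from (leqnn (B - t)) tb nst.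
have /andP[c5 c6] := c3.
have ft : factor (flatten ps) al by rewrite c2; apply: al_factor; rewrite subnKC.
have := K3 _ _ c1 ft; rewrite c2 size_takel; last first.
  by rewrite size_drop size_map leq_sub2r //; apply: leq_trans leA.
by move: c5 ti; rewrite /i; clear; lia.
Qed.
End Window.
End PolygonSide.

Lemma classical_filter (P : nat -> Prop) n : exists ns, uniq ns /\ forall i, i \in ns <-> i < n /\ P i.
Proof.
elim: n => [|n [ns [un h]]]; first by exists [::]; split=> // i; rewrite in_nil; split=> // -[].
case: (classic (P n)) => pn.
  exists (n :: ns); split; first by rewrite /= un andbT; apply/negP => /h[]; rewrite ltnn.
  move=> i; rewrite inE; split; first by case/orP => [/eqP ->//|/h[lt pi]]; split=> //; exact: ltnW.
  by case; rewrite ltnS leq_eqVlt => /orP[->//|lt pi]; apply/orP; right; apply/h.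
exists ns; split=> // i; rewrite h; split; first by case=> lt pi; split=> //; exact: ltnW.
by case; rewrite ltnS leq_eqVlt => /orP[/eqP ->|].
Qed.

(** * Polygons with a long side *)

Section Thin.
Variables (S : Type) (Γ : LGraph S).
Hypothesis red : reduced Γ.
Hypothesis gr : Gr'16 Γ.
Notation "u ≡ v" := (geq Γ u v) (at level 70).

(** The side is cut into [K + 61] blocks of length [L]. At most [K] positions are close to the other
    sides, and with at most four sides curvature leaves at most 48 thick runs and branching
    vertices, less than the 60 allowed for. Some block contains none of these, and its flat part is
    longer than [window_bound] permits. *)
Theorem thin_polygon al bt (rest : seq (word S)) M Rr K : size rest <= 2 ->
  flatten [:: al, bt & rest] ≡ [::] -> (forall v, In v [:: al, bt & rest] -> good Γ v) ->
  (forall u n, u <> [::] -> factor u al -> occ Γ u n -> size u <= M) ->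
  (forall u ps, zero_chain Γ u ps -> factor (flatten ps) al -> size (flatten ps) <= Rr) ->
  (forall ns, uniq ns -> (forall i, i \in ns -> i < size al /\ exists j e,
     [/\ size al <= j < size (flatten [:: al, bt & rest]), size e <= 6 * M + 1 &
         take i (flatten [:: al, bt & rest]) ++ e ≡ take j (flatten [:: al, bt & rest])]) -> size ns <= K) ->
  size al <= (K + 61) * (Rr + 2 * M + 1).
Proof.
move=> r2 w1 gs touch K3 nearK; set L := Rr + 2 * M + 1; rewrite leqNgt; apply/negP => big.
have ne : flatten [:: al, bt & rest] <> [::] by move/(congr1 size); rewrite /= size_cat; move: big; clear; lia.
have [T [phi [eps [h [dev [o [s P]]]]]]] := polygon_exists ne w1 gs.
have lw := pg_label P; have R := pg_reduced P.
have szO : size (o :: s) = size (flatten [:: al, bt & rest]) by rewrite -lw size_map.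
have leA : size al <= size (o :: s) by rewrite szO /= size_cat leq_addr.
have := pg_bound red gr P; set TH := [set y | _]; set BR := [set x | _] => bnd.
have [ns [uns hns]] := classical_filter (close Γ al dev o s M) (size al).
have szns : size ns <= K.
  apply: nearK => // i /hns[lt [j [e [h1 h2 h3]]]]; split=> //; exists j, e; rewrite -szO; split=> //.
  apply: (geq_cancell (A := dev o)); rewrite -lw.
  have /andP[_ ltj] := h1; have lti : i < size (o :: s) by apply: leq_trans leA.
  rewrite catA; apply: geqT (pg_dev P _); last by rewrite -ltnS.
  by apply: geqT h3; apply/geq_catr/geqC; apply: (pg_dev P); rewrite -ltnS.
pose X := outer_nth o s.
have Xinj i j : i < size al -> j < size al -> X i = X j -> i = j.
  move=> li lj e; rewrite -(index_outer_nth R (leq_trans li leA)) -(index_outer_nth R (leq_trans lj leA)).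
  by rewrite -/(X i) e.
have cnt (F : nat -> T) (Z : {set T}) : (forall i j, i < size al -> j < size al -> F i = F j -> i = j) ->
    size [seq i <- iota 0 (size al) | F i \in Z] <= #|Z|.
  move=> Finj; rewrite cardE -(size_map F); apply: uniq_leq_size.
    rewrite map_inj_in_uniq ?filter_uniq ?iota_uniq // => i j; rewrite !mem_filter !mem_iota !add0n.
    by move=> /andP[_ /andP[_ li]] /andP[_ /andP[_ lj]]; exact: Finj.
  by move=> z /mapP[i]; rewrite mem_filter => /andP[iz _] ->; rewrite mem_enum.
set bt1 := [seq i <- iota 0 (size al) | eps (X i) \in TH].
set bt2 := [seq i <- iota 0 (size al) | X i \in BR].
have s1 : size bt1 <= #|TH| by apply: cnt => i j li lj /perm_inj; exact: Xinj.
have s2 : size bt2 <= #|BR| by apply: cnt.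
have szbad : size (ns ++ bt1 ++ bt2) <= K + 60.
  rewrite !size_cat; move: s1 s2 szns bnd r2; rewrite /=; move: (size ns) (size bt1) (size bt2) (#|TH|) (#|BR|) (size rest).
  by clear; lia.
have [k kN free] : exists2 k, k < K + 61 & forall i, k * L <= i < k * L + L -> i \notin ns ++ bt1 ++ bt2.
  apply: NNPP => nex.
  have sub : {subset iota 0 (K + 61) <= [seq i %/ L | i <- ns ++ bt1 ++ bt2]}.
    move=> k; rewrite mem_iota add0n /= => lt; apply: contraT => nk; case: nex; exists k => // i ib.
    apply: contra nk => ibad; apply/mapP; exists i => //; have /andP[ib1 ib2] := ib.
    have L0 : 0 < L by rewrite /L addn1.
    by rewrite -(subnKC ib1) divnMDl // divn_small ?addn0 // ltn_subLR.
  have := uniq_leq_size (iota_uniq 0 _) sub; rewrite size_iota size_map.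
  by move=> le; have := leq_trans le szbad; rewrite leq_add2l.
have kL : k * L + L <= size al.
  by apply: leq_trans (ltnW big); rewrite -mulSnr leq_mul2r kN orbT.
(* A thick run is recorded at its lowest position, fewer than [M] positions before [i]; hence the
   first [M] positions of the block are given up. *)
have flatW i : k * L + M <= i < k * L + L -> flat Γ al bt rest phi eps dev o s M i.
  move=> /andP[ib1 ib2]; have iA : i < size al by apply: leq_trans kL.
  have lti : i < size (o :: s) by apply: leq_trans leA.
  have := free i; rewrite ib2 (leq_trans (leq_addr _ _) ib1) !mem_cat !negb_or => /(_ isT)/and3P[f1 f2 f3].
  have ncl : ~ close Γ al dev o s M i by move=> c; case/negP: f1; apply/hns.
  have yO : eps (X i) \notin o :: s.
    apply/negP => yO; set j := index (eps (X i)) (o :: s).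
    have lj : j < size (o :: s) by rewrite index_mem.
    have ej : eps (X i) = X j by rewrite /X outer_nth_index.
    have ej' : eps (X j) = X i by rewrite -ej (dg_epsK (rd_diagram R)).
    have [jA|Aj] := ltnP j (size al).
      case: (ltngtP i j) => [lt|gt|e].
      - exact: (unglued_al red gr P lt jA ej).
      - exact: (unglued_al red gr P gt iA ej').
      - by have := pg_live P lti; rewrite -/(X i) ej e eqxx.
    apply: ncl; exists j, [:: lb h (X i)]; rewrite Aj lj; split=> //; first by rewrite addn1.
    by rewrite -/(X j) -ej; apply/geqC/(dg_eps (rd_diagram R)); exact: (pg_live P).
  split=> //.
    rewrite leqNgt; apply/negP => /(thick_start red gr P lti yO) th.
    have [ti _ _ _ _] := run_startP red gr P lti yO.
    have cl := run_start_close red gr P touch iA yO.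
    set t := run_start _ _ _ _ _ i in th ti cl.
    have tb : k * L <= t < k * L + L by move: ti cl ib1 ib2; clear; lia.
    have := free t tb; rewrite !mem_cat !negb_or => /and3P[_ /negP nb _]; apply: nb.
    by rewrite mem_filter mem_iota add0n (leq_ltn_trans ti iA) leq0n !andbT; exact: th.
  apply/negP => br; case/negP: f3; rewrite mem_filter mem_iota add0n iA leq0n !andbT inE; exact: br.
have lt2 : k * L + M + M < k * L + L by rewrite /L; clear; lia.
have := window_bound red gr P touch kL flatW lt2 K3.
by rewrite /L; clear; lia.
Qed.
End Thin.

(** * Strong contraction *)

Section Powers.
Variables (S : Type) (Γ : LGraph S).
Implicit Types (g u v : word S).
Notation "u ≡ v" := (geq Γ u v) (at level 70).

Definition pw g n : word S := flatten (nseq n g).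

Lemma pwS g n : pw g n.+1 = g ++ pw g n. Proof. by []. Qed.

Lemma pwD g m n : pw g (m + n) = pw g m ++ pw g n.
Proof. by rewrite /pw nseqD flatten_cat. Qed.

Lemma pwSr g n : pw g n.+1 = pw g n ++ g.
Proof. by rewrite -addn1 pwD /pw /= cats0. Qed.

Lemma size_pw g n : size (pw g n) = n * size g.
Proof. by elim: n => // n IH; rewrite pwS size_cat IH mulSn. Qed.

Lemma pw_inv g n : pw (inv_word g) n = inv_word (pw g n).
Proof.
by elim: n => // n IH; rewrite pwS IH -inv_cat -pwSr.
Qed.

Lemma concat_repeat g n : concat (repeat g n) = pw g n.
Proof. by elim: n => //= n ->. Qed.

Lemma gpow_nat g n : gpow g (Z.of_nat n) = pw g n.
Proof. by case: n => // n; rewrite /= SuccNat2Pos.id_succ -concat_repeat. Qed.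

Lemma gpow_opp g n : gpow g (- Z.of_nat n) = inv_word (pw g n).
Proof. by case: n => // n; rewrite /= SuccNat2Pos.id_succ -pw_inv -concat_repeat. Qed.

Lemma Z_nat_opp (k : Z) : (exists n, k = Z.of_nat n) \/ (exists n, k = (- Z.of_nat n.+1)%Z).
Proof.
case: (Z.le_gt_cases 0 k) => h; [left|right]; first by exists (Z.to_nat k); rewrite Z2Nat.id.
have n0 : 0 < Z.to_nat (- k) by apply/ltP; move: h; clear; Lia.lia.
by exists (Z.to_nat (- k)).-1; rewrite prednK //; move: h; clear; Lia.lia.
Qed.

Lemma gpowS g k : gpow g (k + 1) ≡ gpow g k ++ g.
Proof.
have [[n ->]|[n ->]] := Z_nat_opp k.
  have -> : (Z.of_nat n + 1)%Z = Z.of_nat n.+1 by rewrite Nat2Z.inj_succ.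
  by rewrite !gpow_nat pwSr; exact: geqxx.
have -> : (- Z.of_nat n.+1 + 1)%Z = (- Z.of_nat n)%Z by rewrite Nat2Z.inj_succ; clear; Lia.lia.
rewrite !gpow_opp pwS inv_cat -catA.
by apply: geqC; have := geq_catl (inv_word (pw g n)) (geq_Vmul Γ g); rewrite cats0.
Qed.

Lemma gpowD g k n : gpow g (k + Z.of_nat n) ≡ gpow g k ++ pw g n.
Proof.
elim: n => [|n IH]; first by rewrite Z.add_0_r cats0; exact: geqxx.
have -> : (k + Z.of_nat n.+1)%Z = (k + Z.of_nat n + 1)%Z by rewrite Nat2Z.inj_succ; clear; Lia.lia.
apply: geqT (gpowS g _) _; apply: geqT (geq_catr g IH) _.
by rewrite -catA -pwSr; exact: geqxx.
Qed.

(** A point inside a period is at most [size g] from a true power of [g], where minimality of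
    distances to the axis applies. *)
Lemma pw_complete g n i : i <= size (pw g n) -> exists f k, size f <= size g /\ take i (pw g n) ++ f = pw g k.
Proof.
elim: n i => [|n IH] i; first by rewrite leqn0 => /eqP ->; exists [::], 0.
rewrite pwS size_cat take_cat; case: ltnP => [lt _|ge le].
  exists (drop i g), 1; rewrite size_drop leq_subr cat_take_drop /pw /= cats0; split=> //.
have [|f [k [h1 h2]]] := IH (i - size g); first by rewrite leq_subLR.
by exists f, k.+1; rewrite -catA h2.
Qed.
End Powers.

Section Contraction.
Variables (S : Type) (Γ : LGraph S).
Hypothesis red : reduced Γ.
Hypothesis gr : Gr'16 Γ.
Hypothesis fin : exists l : list S, forall s, In s l.
Implicit Types (g u v : word S).
Notation "u ≡ v" := (geq Γ u v) (at level 70).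

Definition geodesic u : Prop := forall v, u ≡ v -> size u <= size v.

Lemma geodesic_factor u v : factor u v -> geodesic v -> geodesic u.
Proof.
move=> [x [y ->]] h z /(geq_ctx x y) /h; rewrite !size_cat; lia.
Qed.

Lemma geodesic_inv u : geodesic u -> geodesic (inv_word u).
Proof. by move=> h v /geq_inv; rewrite inv_wordK => /h; rewrite !size_inv. Qed.

Lemma geodesic_good u : geodesic u -> good Γ u.
Proof.
move=> gu; split.
  move=> x a y e; have := gu (x ++ y); rewrite e => /(_ (geq_free Γ x a y)).
  by rewrite !size_cat /=; lia.
move=> v n vn fv /occ_geq[z e <-]; have := geodesic_factor fv gu e; lia.
Qed.

Lemma words_upto n : exists W : list (word S), forall u, size u <= n -> In u W.
Proof.
have [l hl] := fin; elim: n => [|n [W hW]].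
  by exists [:: [::]] => u; rewrite leqn0 => /eqP; case: u => //; left.
pose L := [seq (s, true) | s <- l] ++ [seq (s, false) | s <- l].
exists ([::] :: flat_map (fun a => [seq a :: u | u <- W]) L) => -[|a u] lt; [by left|right].
apply/in_flat_map; exists a; split; last by apply: (in_map (cons a)); exact: hW.
by case: a {lt} => a [] ; apply/in_or_app; [left|right]; apply: (in_map (fun s => (s, _))); exact: hl.
Qed.

(** A relation replaces the labelling function because labels are only known to exist. *)
Lemma pigeon (A : Type) (W : list A) (Rl : nat -> A -> Prop) (ns : seq nat) : uniq ns ->
  (forall i, i \in ns -> exists2 c, In c W & Rl i c) ->
  (forall i j c, i \in ns -> j \in ns -> Rl i c -> Rl j c -> i = j) -> size ns <= size W.
Proof.
move=> un ex inj; suff [cs [nd sz mem]] : exists cs, [/\ NoDup cs, size cs = size ns & forall c, In c cs -> In c W /\ exists2 i, i \in ns & Rl i c].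
  by rewrite -sz; apply/leP; apply: NoDup_incl_length => // c /mem[].
elim: ns un ex inj => [|i ns IH] /=; first by exists [::]; split=> //; constructor.
case/andP=> ni un ex inj.
have [||cs [nd sz mem]] := IH un; first by move=> j jn; apply: ex; rewrite inE jn orbT.
  by move=> j k c jn kn; apply: inj; rewrite inE ?jn ?kn orbT.
have [c cW ic] := ex i (mem_head _ _).
exists (c :: cs); split; rewrite /= ?sz //.
  constructor=> // /mem[_ [j jn jc]]; case/negP: ni; rewrite (inj i j c) ?mem_head // inE jn orbT //.
move=> c' [<-|/mem[h [j jn jc]]]; first by split=> //; exists i; rewrite ?mem_head.
by split=> //; exists j; rewrite ?inE ?jn ?orbT.
Qed.

(** What the powers of [g] need in order to serve as the side [al], with constants that do not
    depend on the exponent. *)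
Record axis g M Rr : Prop := Axis {
  ax_nil : g <> [::];
  ax_good : forall n, good Γ (pw g n);
  ax_touch : forall k u n, u <> [::] -> factor u (pw g k) -> occ Γ u n -> size u <= M;
  ax_chain : forall k u ps, zero_chain Γ u ps -> factor (flatten ps) (pw g k) -> size (flatten ps) <= Rr }.

Variables (g : word S) (M Rr : nat).
Hypothesis ax : axis g M Rr.

Lemma pw_nontrivial u n : factor u (pw g n) -> u ≡ [::] -> u = [::].
Proof. by move=> fu; apply: (good_nontrivial red gr); exact: good_factor fu (ax_good ax n). Qed.

Section Quadrangle.
Variables (n : nat) (b1 c b2 : word S).
Notation al := (pw g n).
Notation w := (al ++ b1 ++ c ++ b2).
Hypothesis closed : w ≡ [::].
Hypothesis far1 : forall u k, al ++ b1 ++ u ≡ pw g k -> size b1 <= size u.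
Hypothesis far2 : forall u k, inv_word b2 ++ u ≡ pw g k -> size b2 <= size u.
Hypothesis short : size c <= size b1 \/ size c <= size b2.

(** A bridge from [al] to another side is completed to a power of [g]. Since [b1] and [b2] realize
    distances to the axis, a landing point on them is near their end on [al]; on [c], the shortness
    of [c] forces one of the two ways back to be short. *)
Lemma close_end K i j e : i <= size al -> size al <= j <= size w -> size e <= K -> take i w ++ e ≡ take j w ->
  exists2 f, size f <= 4 * (K + size g) & take i al ≡ f \/ drop i al ≡ f.
Proof.
move=> iA /andP[Aj jw] eK eij; rewrite takel_cat // in eij.
have [f [k [fg fk]]] := pw_complete iA.
have eji : take j w ++ inv_word e ++ f ≡ pw g k.
  rewrite -fk catA; apply: geq_catr; apply: geqC; apply: (geq_cancelr (B := e)).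
  apply: geqT eij _; rewrite -catA; apply: geqC.
  by have := geq_catl (take j w) (geq_Vmul Γ e); rewrite cats0.
have drop_i v : take i al ++ e ≡ al ++ v -> drop i al ≡ e ++ inv_word v.
  move=> h; apply: (geq_cancell (A := take i al)); apply: (geq_cancelr (B := v)).
  rewrite cat_take_drop; apply: geqC.
  have -> : (take i al ++ e ++ inv_word v) ++ v = (take i al ++ e) ++ inv_word v ++ v by rewrite -!catA.
  by apply: geqT (geq_catl _ (geq_Vmul Γ v)) _; rewrite cats0.
have take_i v : take j w ++ v ≡ [::] -> take i al ≡ inv_word v ++ inv_word e.
  move=> h; rewrite -inv_cat; apply: geq_invP; rewrite catA.
  by apply: geqT (geq_catr v eij) h.
have split_j : take j w ++ drop j w ≡ [::] by rewrite cat_take_drop.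
set j1 := j - size al; have ej : j = size al + j1 by rewrite subnKC.
have tE : take j w = al ++ take j1 (b1 ++ c ++ b2) by rewrite ej takeD take_size_cat // drop_size_cat.
have dE : drop j w = drop j1 (b1 ++ c ++ b2) by rewrite ej [size al + _]addnC -drop_drop drop_size_cat.
rewrite tE -catA in eji; rewrite dE in split_j.
have sV v : size (inv_word v ++ inv_word e ++ f) <= size v + K + size g.
  by rewrite !size_cat !size_inv; move: eK fg; clear; lia.
have {}sV v N : N <= size (inv_word v ++ inv_word e ++ f) -> N <= size v + K + size g by move/leq_trans; apply.
have sT v N : N <= size (v ++ inv_word e ++ f) -> N <= size v + K + size g.
  by rewrite !size_cat size_inv; move: eK fg; clear; lia.
have Vd (u v : word S) N : u ++ inv_word (drop N u) ++ v ≡ take N u ++ v.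
  rewrite -{1}(cat_take_drop N u) -catA; apply: geq_catl; rewrite catA.
  exact: (geq_catr v (geq_mulV Γ (drop N u))).
have [le1|gt1] := leqP j1 (size b1).
  have e1 : take j1 (b1 ++ c ++ b2) = take j1 b1 by rewrite takel_cat.
  rewrite e1 in eji tE.
  have h1 : size b1 <= size (drop j1 b1) + K + size g.
    apply/sV/(far1 (k := k)); apply: geqT _ eji; apply: geq_catl; exact: Vd.
  exists (e ++ inv_word (take j1 b1)); last by right; apply: drop_i; rewrite -tE.
  by rewrite size_cat size_inv size_takel //; move: h1 eK; rewrite size_drop; move: le1; clear; lia.
set j2 := j1 - size b1; have ej1 : j1 = size b1 + j2 by rewrite subnKC // ltnW.
have [le2|gt2] := leqP j2 (size c).
  have e1 : take j1 (b1 ++ c ++ b2) = b1 ++ take j2 c by rewrite ej1 takeD take_size_cat // drop_size_cat // takel_cat.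
  have e2 : drop j1 (b1 ++ c ++ b2) = drop j2 c ++ b2.
    rewrite ej1 [size b1 + _]addnC -drop_drop drop_size_cat // drop_cat.
    case: ltnP => // ge; have -> : j2 = size c by apply/eqP; rewrite eqn_leq le2.
    by rewrite subnn drop0 drop_size.
  rewrite e1 in eji tE; rewrite e2 in split_j.
  have h1 : size b1 <= size (take j2 c) + K + size g.
    by apply/sT/(far1 (k := k)); move: eji; rewrite -!catA.
  have h2 : size b2 <= size (drop j2 c) + K + size g.
    have hh : inv_word b2 ++ inv_word (drop j2 c) ≡ al ++ b1 ++ take j2 c.
      by rewrite -inv_cat; apply: geqC; apply: geq_invP; rewrite -tE.
    apply/sV/(far2 (k := k)); apply: geqT _ eji.
    by have := geq_catr (inv_word e ++ f) hh; rewrite -!catA.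
  rewrite size_takel // in h1; rewrite size_drop in h2.
  (* If [c] is no longer than [b1], its part beyond the landing point has length at most
     [K + size g] and [b2] at most twice that; with the bridge [e] this gives the factor 4. The
     other case is symmetric. *)
  case: short => sh.
    exists (inv_word (drop j2 c ++ b2) ++ inv_word e); last by left; apply: take_i; move: split_j; rewrite tE.
    by rewrite !size_cat !size_inv size_cat size_drop; move: h1 h2 sh eK le2; clear; lia.
  exists (e ++ inv_word (b1 ++ take j2 c)); last by right; apply: drop_i; rewrite -tE.
  by rewrite !size_cat !size_inv size_cat size_takel //; move: h1 h2 sh eK le2; clear; lia.
set j3 := j2 - size c; have ej2 : j2 = size c + j3 by rewrite subnKC // ltnW.
have e2 : drop j1 (b1 ++ c ++ b2) = drop j3 b2.
  by rewrite ej1 [size b1 + _]addnC -drop_drop drop_size_cat // ej2 [size c + _]addnC -drop_drop drop_size_cat.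
rewrite e2 in split_j.
have le3 : j3 <= size b2 by move: jw; rewrite !size_cat ej ej1 ej2; clear; lia.
have h2 : size b2 <= size (take j3 b2) + K + size g.
  apply/sT/(far2 (k := k)); apply: geqT _ eji.
  have -> : al ++ take j1 (b1 ++ c ++ b2) ++ inv_word e ++ f = take j w ++ inv_word e ++ f by rewrite tE -catA.
  rewrite catA; apply: geq_catr; apply: (geq_cancelr (B := drop j3 b2)).
  rewrite -catA cat_take_drop; apply: geqT (geq_Vmul Γ _) _; exact: geqC.
exists (inv_word (drop j3 b2) ++ inv_word e); last by left; apply: take_i.
rewrite size_takel // in h2.
by rewrite size_cat !size_inv size_drop; move: h2 eK le3; clear; lia.
Qed.

Hypothesis geo1 : geodesic b1.
Hypothesis geoc : geodesic c.
Hypothesis geo2 : geodesic b2.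

(** Positions close to other sides lie in a fixed ball around one of the two ends of [al]. Distinct
    positions are distinct in the group, as a nonempty factor of a power of [g] is never trivial; so
    there are at most [2 * size W] of them. *)
Lemma quadrangle_bound W : (forall u, size u <= 4 * (6 * M + 1 + size g) -> In u W) ->
  size al <= (2 * size W + 61) * (Rr + 2 * M + 1).
Proof.
move=> hW; have ew : flatten [:: al; b1; c; b2] = w by rewrite /= cats0.
apply: (@thin_polygon _ Γ red gr al b1 [:: c; b2]) => //.
- by rewrite ew.
- by move=> v [<-|[<-|[<-|[<-//|[]]]]]; rewrite -?/al; [exact: (ax_good ax n)|exact: geodesic_good|exact: geodesic_good|exact: geodesic_good].
- by move=> u k; apply: (ax_touch ax (k := n)).
- by move=> u ps; apply: (ax_chain ax (k := n)).
move=> ns un hns; rewrite ew in hns.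
pose W2 := [seq (u, true) | u <- W] ++ [seq (u, false) | u <- W].
have -> : 2 * size W = size W2 by rewrite size_cat !size_map mul2n addnn.
apply: (@pigeon _ W2 (fun i x => i < size al /\ if x.2 then take i al ≡ x.1 else drop i al ≡ x.1)) => //.
  move=> i /hns[iA [j [e [h1 h2 h3]]]]; have /andP[h4 h5] := h1.
  have h1' : size al <= j <= size w by rewrite h4 ltnW.
  have [f fs [hf|hf]] := close_end (ltnW iA) h1' h2 h3.
    exists (f, true); last by split.
    by apply/in_or_app; left; apply: (in_map (fun u => (u, true))); exact: hW.
  exists (f, false); last by split.
  by apply/in_or_app; right; apply: (in_map (fun u => (u, false))); exact: hW.
have dist i j : i < j -> j < size al -> take (j - i) (drop i al) ≡ [::] -> False.
  move=> ij jA h; have := pw_nontrivial (factor_sub al i (j - i)) h => /(congr1 size).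
  by rewrite size_takel ?size_drop ?leq_sub2r 1?ltnW //; move/eqP; rewrite subn_eq0 leqNgt ij.
have distT i j f : i < j -> j < size al -> take i al ≡ f -> take j al ≡ f -> False.
  move=> ij jA h1 h2; apply: (dist i j ij jA); apply: (geq_cancell (A := take i al)).
  by rewrite -takeD subnKC 1?ltnW // cats0; exact: geqT h2 (geqC h1).
have distD i j f : i < j -> j < size al -> drop i al ≡ f -> drop j al ≡ f -> False.
  move=> ij jA h1 h2; apply: (dist i j ij jA); apply: (geq_cancelr (B := drop j al)).
  have -> : take (j - i) (drop i al) ++ drop j al = drop i al.
    by rewrite -[RHS](cat_take_drop (j - i)) drop_drop subnK 1?ltnW.
  exact: geqT h1 (geqC h2).
by move=> i j [f []] _ _ /= [iA h1] [jA h2]; case: (ltngtP i j) => // lt; exfalso;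
  [exact: distT lt jA h1 h2|exact: distT lt iA h2 h1|exact: distD lt jA h1 h2|exact: distD lt iA h2 h1].
Qed.
End Quadrangle.

Lemma is_dist_word x y n : is_dist Γ x y n -> exists u, [/\ size u = n, x ++ u ≡ y & geodesic u].
Proof.
case=> [[u [su eu]] mn]; exists u; split=> // v e; rewrite [size u]su; apply/leP/mn.
by apply: geqT (geq_catl x (geqC e)) eu.
Qed.

Lemma axis_infinite_order : infinite_order Γ g.
Proof.
have pos n : ~ pw g n.+1 ≡ [::].
  move=> e; have := pw_nontrivial (factor_refl _) e; rewrite pwS.
  by case: (g) (ax_nil ax).
move=> k k0 e; have [[[|n] ek]|[n ek]] := Z_nat_opp k; first by rewrite ek in k0.
  by apply: (pos n); rewrite ek gpow_nat in e.
apply: (pos n); rewrite ek gpow_opp in e.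
by have := geq_inv e; rewrite inv_wordK.
Qed.

Lemma is_dist_exists x y u : x ++ u ≡ y -> exists2 n, n <= size u & is_dist Γ x y n.
Proof.
have [m] := ubnP (size u); elim: m u => // m IH u ltm eu.
case: (classic (exists2 v, x ++ v ≡ y & size v < size u)) => [[v ev lt]|nex].
  have [n le dn] := IH v (leq_trans lt ltm) ev.
  by exists n => //; apply: leq_trans le (ltnW lt).
exists (size u) => //; split; first by exists u.
by move=> v ev; apply/leP; rewrite leqNgt; apply/negP => lt; apply: nex; exists v.
Qed.

Lemma in_proj_far x y n : in_proj Γ g x y -> is_dist Γ x y n ->
  (exists k, y ≡ gpow g k) /\ forall u k, x ++ u ≡ gpow g k -> n <= size u.
Proof.
case=> k [m [ey [[_ mn] dm]]] dn; split; first by exists k.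
have enm : n = m.
  have [[u [<- eu]] mu] := dn; have [[v [<- ev]] mv] := dm.
  by apply/eqP; rewrite eqn_leq; apply/andP; split; apply/leP; [exact: mu|exact: mv].
move=> u l eu; rewrite enm; have [p le dp] := is_dist_exists eu.
by apply: leq_trans le; apply/leP; exact: mn dp.
Qed.

(** The quadrangle goes along the axis from [y] to [y'], out to [x'], across to [x] and back to
    [y]. *)
Lemma projections_close_oriented (W : seq (word S)) x x' y y' p p' c k m :
  (forall u, size u <= 4 * (6 * M + 1 + size g) -> In u W) ->
  x ++ p ≡ y -> x' ++ p' ≡ y' -> x ++ c ≡ x' -> y ≡ gpow g k -> y ++ pw g m ≡ y' ->
  (forall u l, x ++ u ≡ gpow g l -> size p <= size u) -> (forall u l, x' ++ u ≡ gpow g l -> size p' <= size u) ->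
  size c <= size p \/ size c <= size p' -> geodesic p -> geodesic p' -> geodesic c ->
  size (pw g m) <= (2 * size W + 61) * (Rr + 2 * M + 1).
Proof.
move=> hW ep ep' ec ek em far far' short gp gp' gc.
have back q z z' : z ++ q ≡ z' -> z' ++ inv_word q ≡ z.
  move=> h; apply: geqT (geq_catr _ (geqC h)) _; rewrite -catA.
  by have := geq_catl z (geq_mulV Γ q); rewrite cats0.
apply: (@quadrangle_bound m (inv_word p') (inv_word c) p _ _ _ _ _ _ _ W hW).
- apply: (geq_cancell (A := y)); rewrite cats0 catA.
  apply: geqT (geq_catr _ em) _; rewrite catA; apply: geqT (geq_catr _ (back _ _ _ ep')) _.
  by rewrite catA; apply: geqT (geq_catr _ (back _ _ _ ec)) _.
- move=> u l e; rewrite size_inv; apply: (far' u (k + Z.of_nat l)%Z).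
  apply: geqT (geqC (gpowD Γ g k l)); apply: geqT _ (geq_catr _ ek).
  apply: geqT _ (geq_catl y e); rewrite catA; apply: geqT _ (geq_catr _ (geqC em)).
  by rewrite catA; apply: geq_catr; apply: geqC; exact: back.
- move=> u l e; apply: (far u (k + Z.of_nat l)%Z).
  apply: geqT (geqC (gpowD Γ g k l)); apply: geqT _ (geq_catr _ ek).
  apply: geqT _ (geq_catl y e); rewrite catA; apply: geq_catr; apply: geqC; exact: back.
- by rewrite !size_inv; case: short; [right|left].
- exact: geodesic_inv.
- exact: geodesic_inv.
- by [].
Qed.

Lemma is_dist_geq x y y' n : y ≡ y' -> is_dist Γ x y n -> is_dist Γ x y' n.
Proof.
move=> e [[u [su eu]] mn]; split; first by exists u; split=> //; exact: geqT eu e.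
by move=> v ev; apply: mn; exact: geqT ev (geqC e).
Qed.

Lemma projections_close (W : seq (word S)) : (forall u, size u <= 4 * (6 * M + 1 + size g) -> In u W) ->
  forall x x' y y' dY dx, is_dist_cyc Γ g x dY -> is_dist Γ x x' dx -> (dx <= dY)%coq_nat ->
  in_proj Γ g x y -> in_proj Γ g x' y' ->
  exists2 u, y ++ u ≡ y' & size u <= (2 * size W + 61) * (Rr + 2 * M + 1).
Proof.
move=> hW x x' y y' dY dx dcx dxx /leP le py py'.
have [_ [n [_ [[_ mn] dn]]]] := py; have [_ [n' [_ [_ dn']]]] := py'.
have [[k ek] far] := in_proj_far py dn; have [[k' ek'] far'] := in_proj_far py' dn'.
have leY : dx <= n.
  by apply: leq_trans le _; apply/leP; case: dcx => _ ml; apply: (ml k); exact: is_dist_geq ek dn.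
have [p [sp ep gp]] := is_dist_word dn; have [p' [sp' ep' gp']] := is_dist_word dn'.
have [c [sc ec gc]] := is_dist_word dxx.
have step z z' l l' : z ≡ gpow g l -> z' ≡ gpow g l' -> (l <= l')%Z -> z ++ pw g (Z.to_nat (l' - l)) ≡ z'.
  move=> e e' ll; apply: geqT (geq_catr _ e) _; apply: geqT (geqC (gpowD Γ g l _)) _.
  by rewrite Z2Nat.id; [rewrite Zplus_minus; exact: geqC|move: ll; clear; Lia.lia].
rewrite -sp in far; rewrite -sp' in far'.
case: (Z.le_ge_cases k k') => kk.
  exists (pw g (Z.to_nat (k' - k))); first exact: step.
  apply: (projections_close_oriented hW ep ep' ec ek (step _ _ _ _ ek ek' kk) far far') => //.
  by left; rewrite sc sp.
have es := step _ _ _ _ ek' ek kk.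
exists (inv_word (pw g (Z.to_nat (k - k')))).
  apply: geqT (geq_catr _ (geqC es)) _; rewrite -catA.
  by have := geq_catl y' (geq_mulV Γ (pw g (Z.to_nat (k - k')))); rewrite cats0.
rewrite size_inv.
apply: (projections_close_oriented hW ep' ep _ ek' es far' far (c := inv_word c)) => //.
- apply: geqT (geq_catr _ (geqC ec)) _; rewrite -catA.
  by have := geq_catl x (geq_mulV Γ c); rewrite cats0.
- by right; rewrite size_inv sc sp.
- exact: geodesic_inv.
Qed.

Theorem axis_contracting : strongly_contracting Γ g.
Proof.
have [W hW] := words_upto (4 * (6 * M + 1 + size g)).
exists ((2 * size W + 61) * (Rr + 2 * M + 1)) => x x' dY dx dcx dxx le y y' hy hy' n dn.
have bound z z' : is_dist Γ z z' n -> (exists2 u, z ++ u ≡ z' & size u <= (2 * size W + 61) * (Rr + 2 * M + 1)) ->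
    n <= (2 * size W + 61) * (Rr + 2 * M + 1).
  by move=> [_ mn] [u eu su]; apply: leq_trans su; apply/leP; exact: mn.
have dist0 z : is_dist Γ z z 0.
  by split; [exists [::]; split=> //; rewrite -[X in _ X _]/(z ++ [::]) cats0; exact: geqxx|move=> v _; apply/leP].
have le0 d : (0 <= d)%coq_nat by apply/leP.
suff [u eu su] : exists2 u, y ++ u ≡ y' & size u <= (2 * size W + 61) * (Rr + 2 * M + 1).
  by apply/leP; apply: (bound y y') => //; exists u.
(* Two projections of the same point are covered by the degenerate quadrangle whose side [c] is
   empty. *)
case: hy hy' => py [] py'.
- exact: projections_close hW _ _ _ _ _ _ dcx (dist0 x) (le0 _) py py'.
- exact: projections_close hW _ _ _ _ _ _ dcx dxx le py py'.
- have [u eu su] := projections_close hW dcx dxx le py' py.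
  exists (inv_word u); last by rewrite size_inv.
  apply: geqT (geq_catr _ (geqC eu)) _; rewrite -catA.
  by have := geq_catl y' (geq_mulV Γ u); rewrite cats0.
- have [l [m [_ [dcx' _]]]] := py.
  exact: projections_close hW _ _ _ _ _ _ dcx' (dist0 x') (le0 _) py py'.
Qed.
End Contraction.

(** * Bounded cycles *)

Section BoundedCycles.
Variables (S : Type) (Γ : LGraph S).
Hypothesis fin : exists l : list S, forall s, In s l.
Hypothesis inf : group_infinite Γ.
Implicit Types (g u v : word S).
Notation "u ≡ v" := (geq Γ u v) (at level 70).

Lemma geodesic_rep u : exists2 v, u ≡ v & geodesic Γ v.
Proof.
have [m] := ubnP (size u); elim: m u => // m IH u ltm.
case: (classic (geodesic Γ u)) => [gu|]; first by exists u => //; exact: geqxx.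
move=> /not_all_ex_not[v ngu]; have [e lt] : u ≡ v /\ size v < size u.
  by split; [apply: NNPP => ne; apply: ngu => /ne|rewrite ltnNge; apply/negP => le; apply: ngu].
have [v' e' gv'] := IH v (leq_trans lt ltm).
by exists v' => //; exact: geqT e e'.
Qed.

Lemma long_geodesic n : exists2 u, geodesic Γ u & size u = n.
Proof.
apply: NNPP => nex; apply: inf; have [W hW] := words_upto fin n; exists W => u.
have [v e gv] := geodesic_rep u; exists v; split=> //; apply: hW.
rewrite leqNgt; apply/negP => lt; apply: nex; exists (take n v); last by rewrite size_takel // ltnW.
by apply: geodesic_factor gv; exists [::], (drop n v); rewrite cat_take_drop.
Qed.

Lemma overlap_periodic g n v : v = take (size v) (g ++ v) -> size v <= n * size g -> v = take (size v) (pw g n).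
Proof.
elim: n v => [|n IH] v; first by case: v.
move=> ev; rewrite mulSn pwS => le; case: (leqP (size v) (size g)) => [lg|gg].
  by rewrite takel_cat // {1}ev takel_cat.
have e1 : take (size g) v = g by rewrite ev take_takel ?take_size_cat // ltnW.
have e2 : v = g ++ drop (size g) v by rewrite -{1}(cat_take_drop (size g) v) e1.
have ev2 : drop (size g) v = take (size (drop (size g) v)) (g ++ drop (size g) v).
  by rewrite -e2 {1}ev take_cat ltnNge (ltnW gg) /= drop_size_cat // size_drop.
have := IH _ ev2; rewrite size_drop leq_subLR => /(_ le) e3.
by rewrite {1}e2 e3 take_cat ltnNge (ltnW gg).
Qed.

Lemma power_offset g k u : g <> [::] -> factor u (pw g k) ->
  exists t k' y, [/\ t < size g, t + size u <= k' * size g & pw g k' = take t (pw g k') ++ u ++ y].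
Proof.
move=> gn [x [y e]]; have g0 : 0 < size g by case: (g) gn.
elim: k x e => [|k IH] x e.
  exists 0, 0, [::]; case: x u e => [|? ?] [|? ?] // _; split=> //.
have [lt|ge] := ltnP (size x) (size g).
  exists (size x), k.+1, y; rewrite {2}e take_size_cat //; split=> //.
  by rewrite -size_pw e !size_cat; lia.
apply: (IH (drop (size g) x)); rewrite -(drop_size_cat (pw g k) (erefl (size g))) -pwS e.
by rewrite drop_cat; case: ltnP => // le; have -> : size g = size x by [lia]; rewrite subnn drop0 drop_size.
Qed.

(** A factor of a power may be shifted so as to start within the first period, where it fits into
    [v]. *)
Lemma factor_periodic g v n u : g <> [::] -> v = take (size v) (pw g n) -> size v <= n * size g ->
  forall k, factor u (pw g k) -> size u + size g <= size v -> factor u v.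
Proof.
move=> gn ev lev k fu lu.
have [t [k' [y' [tg le2 e2]]]] := power_offset gn fu.
have pre a : a <= n * size g -> a <= k' * size g -> take a (pw g n) = take a (pw g k').
  move=> l1 l2; have [le|lt] := leqP n k'.
    by rewrite -(subnKC le) pwD takel_cat // size_pw.
  by rewrite -(subnKC (ltnW lt)) pwD takel_cat // size_pw.
have lt : t + size u <= size v by lia.
have eu : u = take (size u) (drop t (pw g k')).
  rewrite e2 drop_size_cat ?take_size_cat // size_takel // size_pw; lia.
have -> : u = take (size u) (drop t v).
  rewrite {1}eu ev !take_drop take_takel; last by rewrite addnC.
  by rewrite addnC pre //; apply: leq_trans lev.
exact: factor_sub.
Qed.

Variable M : nat.
Hypothesis cyc : forall (x : V Γ) (c : seq (step Γ)), simple_cycle x c -> size c <= M.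

Lemma occ_bounded u n : occ Γ u n -> n <= M.
Proof. by case=> x [c1 [c2 [sc _ <-]]]; exact: cyc sc. Qed.

(** The interior arc shared by neighbouring faces cancels. In each face [t] is below a third of the
    perimeter and [p] above it, so every face saves at least one letter. *)
Lemma zero_chain_shortcut u ps : zero_chain Γ u ps -> 6 * size u <= M ->
  exists T v, [/\ flatten ps ≡ inv_word u ++ T ++ v, size T + size ps <= size (flatten ps) & 6 * size v <= M].
Proof.
elim=> {u ps} [u|u v p ps [t [n [oc ep sz st [s1 s4]]]] _ IH] lu.
  by exists [::], u; split=> //; apply: geqC; exact: geq_Vmul.
have leM := occ_bounded oc; have lv : 6 * size v <= M by lia.
have [T [v' [e le lv']]] := IH lv.
exists (t ++ T), v'; split=> //; last by rewrite /= !size_cat; lia.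
apply: geqT (geq_cat ep e) _; rewrite -!catA; do 2!apply: geq_catl.
by rewrite catA; apply: geqT (geq_catr _ (geq_mulV Γ v)) _; exact: geqxx.
Qed.

Lemma zero_chain_take u ps n : zero_chain Γ u ps -> zero_chain Γ u (take n ps).
Proof.
move=> h; elim: h n => [v|v v' p qs za _ IH] [|n] /=; try exact: zero_chain_nil.
exact: zero_chain_cons za (IH n).
Qed.

Lemma zero_chain_bounded u ps : zero_chain Γ u ps -> size (flatten ps) <= size ps * M.
Proof.
elim=> {u ps} // u v p ps [t [n [oc _ _ _ _]]] _ IH; rewrite /= size_cat mulSn leq_add //.
exact: leq_trans (occ_size oc) (occ_bounded oc).
Qed.

(** A window of the geodesic that occurs twice makes it periodic in between: short factors of powers
    of [g] are then factors of the geodesic [v], and every condition on an axis concerns short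
    factors only. *)
Theorem bounded_axis : exists g M' Rr, axis Γ g M' Rr.
Proof.
(* A chain of [M.+1] arcs saves at least [M.+1] letters, more than its two end arcs cost, and has
   length at most [Rr]. A window of size [Rw] has room for such a chain, for any word on a cycle and
   for a cancelling pair. *)
set Rr := M.+1 * M; set Rw := Rr + M + 2.
have [W hW] := words_upto fin Rw.
have [u gu su] := long_geodesic (size W + Rw).
have [i [j [ij jW eij]]] : exists i j, [/\ i < j, j <= size W & take Rw (drop i u) = take Rw (drop j u)].
  apply: NNPP => nex.
  suff : (size W).+1 <= size W by rewrite ltnn.
  rewrite -{1}(size_iota 0 (size W).+1).
  apply: (@pigeon _ W (fun i c => take Rw (drop i u) = c)) => [|i _|i j c]; first exact: iota_uniq.
    by exists (take Rw (drop i u)) => //; apply: hW; rewrite size_take; case: ltnP.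
  rewrite !mem_iota !add0n !ltnS /= => iW jW e1 e2; case: (ltngtP i j) => // lt; case: nex.
    by exists i, j; split=> //; rewrite e1 e2.
  by exists j, i; split=> //; rewrite e1 e2.
set d := j - i; set g := take d (drop i u); set v := take (d + Rw) (drop i u).
have d0 : 0 < d by rewrite subn_gt0.
have sd : size (drop i u) >= d + Rw by rewrite size_drop su /d; lia.
have sg : size g = d by rewrite size_takel //; apply: leq_trans sd; rewrite leq_addr.
have sv : size v = d + Rw by rewrite size_takel.
have gn : g <> [::] by move=> e; rewrite e in sg; rewrite -sg in d0.
have ev0 : v = g ++ take Rw (drop j u).
  by rewrite /v takeD -/g drop_drop /d subnK // ltnW.
have ev : v = take (size v) (g ++ v).
  by rewrite sv takeD take_size_cat ?sg // drop_size_cat ?sg // /v take_takel ?leq_addl // eij.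
have gv : geodesic Γ v by apply: geodesic_factor gu; apply: factor_sub.
have evp := overlap_periodic (n := size v) ev (leq_pmulr _ _); rewrite sg d0 in evp.
have {}evp := evp isT.
have window w k : factor w (pw g k) -> size w <= Rw -> geodesic Γ w.
  move=> fw sw; apply: geodesic_factor gv.
  by apply: (factor_periodic gn evp _ fw); rewrite ?sg ?sv ?leq_pmulr // addnC leq_add2l.
exists g, M, Rr; split=> //.
- move=> k; split.
    move=> x a y e; have f2 : factor [:: a; inv_letter a] (pw g k) by exists x, y.
    have := window _ _ f2; rewrite /Rw addn2 /= => /(_ isT [::] (geq_free Γ [::] a [::])); by [].
  move=> w n wn fw oc; have le := leq_trans (occ_size oc) (occ_bounded oc).
  have [|_ tw] := geodesic_good (window w k fw _); first by rewrite /Rw; lia.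
  exact: tw (factor_refl w) oc.
- by move=> k w n _ _ oc; exact: leq_trans (occ_size oc) (occ_bounded oc).
move=> k w ps zc fp; rewrite leqNgt; apply/negP => big.
have szp : M < size ps.
  rewrite ltnNge; apply/negP => le; move: big; rewrite ltnNge; case/negP.
  by apply: leq_trans (zero_chain_bounded zc) _; rewrite leq_mul2r; apply/orP; right; apply: leqW.
set qs := take M.+1 ps; have zq : zero_chain Γ w qs := zero_chain_take M.+1 zc.
have sq : size qs = M.+1 by rewrite size_takel.
have fq : factor (flatten qs) (pw g k).
  by apply: factor_trans fp; exists [::], (flatten (drop M.+1 ps)); rewrite -flatten_cat cat_take_drop.
have gq : geodesic Γ (flatten qs).
  by apply: window fq _; apply: leq_trans (zero_chain_bounded zq) _; rewrite sq /Rw -addnA leq_addr.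
have lw : 6 * size w <= M.
  case: zq sq => // w' v' p' ps' [t [n [oc _ _ _ [s1 _]]]] _ _.
  by rewrite -(size_inv w'); apply: ltnW; apply: leq_trans s1 (occ_bounded oc).
have [T [v' [e le lv]]] := zero_chain_shortcut zq lw.
have := gq _ e; rewrite !size_cat size_inv sq in le *; move: le lw lv; clear; lia.
Qed.
End BoundedCycles.

Lemma NoDup_nth_inj (A : Type) (d : A) (l : seq A) i j : NoDup l -> i < size l -> j < size l ->
  nth d l i = nth d l j -> i = j.
Proof.
have mem (l' : seq A) k : k < size l' -> In (nth d l' k) l'.
  by elim: l' k => // b l' IH [|k] lt; [left|right; apply: IH].
elim: l i j => [|a l IH] [|i] [|j] //= /NoDup_cons_iff[na nd] li lj e.
- by case: na; rewrite e; apply: mem.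
- by case: na; rewrite -e; apply: mem.
- by rewrite (IH i j).
Qed.

(** * Unbounded cycles *)

Section Components.
Variables (S : Type) (Γ : LGraph S).
Hypothesis red : reduced Γ.
Hypothesis gr : Gr'16 Γ.
Hypothesis fin : exists l : list S, forall s, In s l.
Hypothesis fc : finite_components Γ.
Implicit Types (u w : word S) (v x : V Γ) (p c : seq (step Γ)).

Definition aut_step (fE : E Γ -> E Γ) (st : step Γ) : step Γ := (fE st.1, st.2).

Lemma aut_path fV fE v p : lp_aut Γ fV fE -> valid v p ->
  valid (fV v) [seq aut_step fE st | st <- p] /\ path_end (fV v) [seq aut_step fE st | st <- p] = fV (path_end v p).
Proof.
case=> _ [_ h]; elim: p v => [|[e b] p IH] v //= [es vp].
have [h1 [h2 _]] := h e.
have tE : step_tgt (aut_step fE (e, b)) = fV (step_tgt (e, b)) by rewrite /step_tgt /=; case: b {es vp}.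
have sE : step_src (aut_step fE (e, b)) = fV v by rewrite -es /step_src /=; case: b {es vp tE}.
by have [h3 h4] := IH _ vp; rewrite tE sE.
Qed.

Lemma aut_cycle fV fE v c : lp_aut Γ fV fE -> simple_cycle v c -> simple_cycle (fV v) [seq aut_step fE st | st <- c].
Proof.
move=> au [ne [vc [ce [n1 n2]]]]; have [h1 h2] := aut_path au vc.
have [[fV' [k1 _]] [[fE' [k3 _]] h]] := au.
split; first by case: (c) ne.
split=> //; split; first by rewrite h2 ce.
have inj (A : Type) (f f' : A -> A) (l : list A) : (forall a, f' (f a) = a) -> NoDup l -> NoDup (List.map f l).
  by move=> k; apply: FinFun.Injective_map_NoDup => a b e; rewrite -(k a) e k.
split.
  have -> : List.map (@step_tgt S Γ) [seq aut_step fE st | st <- c] = List.map fV (List.map (@step_tgt S Γ) c).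
    rewrite -[LHS]/[seq step_tgt st | st <- [seq aut_step fE st | st <- c]] -[RHS]/[seq fV y | y <- [seq step_tgt st | st <- c]].
    by rewrite -!map_comp; apply: eq_map => -[e b] /=; have [a1 [a2 _]] := h e; rewrite /step_tgt /=; case: b.
  exact: inj k1 n1.
have -> : List.map fst [seq aut_step fE st | st <- c] = List.map fE (List.map fst c).
  by rewrite -[LHS]/[seq st.1 | st <- [seq aut_step fE st | st <- c]] -[RHS]/[seq fE y | y <- [seq st.1 | st <- c]] -!map_comp.
exact: inj k3 n2.
Qed.

Lemma connected_refl v : connected Γ v v. Proof. by exists [::]. Qed.

Lemma connected_sym v x : connected Γ v x -> connected Γ x v.
Proof. by case=> p [vp <-]; have [h1 h2] := rpath_valid vp; exists (rpath p). Qed.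

Lemma connected_trans v x (z : V Γ) : connected Γ v x -> connected Γ x z -> connected Γ v z.
Proof. by move=> [p [h1 <-]] [q [h2 <-]]; exists (p ++ q); rewrite valid_cat path_end_cat. Qed.

Lemma component_bound v : exists B, forall x c, connected Γ v x -> simple_cycle x c -> size c <= B.
Proof.
have [L hL] := fc v; exists (size L) => x c vx [_ [vc [_ [nd _]]]].
rewrite -(size_map (@step_tgt S Γ)); apply/leP; apply: NoDup_incl_length nd _ => z zc; apply: hL.
apply: connected_trans vx _; elim: c x vc zc => //= st c IH x [es vc] [<-|/(IH _ vc) h].
  by exists [:: st].
by apply: connected_trans h; exists [:: st].
Qed.

(** Any two readings of a rigid word differ by an automorphism, which carries the cycles of one
    component into the other; so a single finite component gives the bound. *)
Lemma rigid_bound u : rigid Γ u -> exists B, forall v p, valid v p -> label_of p = u ->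
  forall x c, connected Γ v x -> simple_cycle x c -> size c <= B.
Proof.
move=> rg; case: (classic (exists v p, valid v p /\ label_of p = u)) => [[v0 [p0 [v0p l0]]]|nex]; last first.
  by exists 0 => v p vp lp; case: nex; exists v, p.
have [B hB] := component_bound v0; exists B => v p vp lp x c [q [vq eq]] sc.
have [fV [fE [au ev _]]] := rg _ _ _ _ vp v0p lp l0.
have [h1 h2] := aut_path au vq; rewrite ev eq in h1 h2.
have := hB (fV x) [seq aut_step fE st | st <- c]; rewrite size_map; apply; last exact: aut_cycle.
by exists [seq aut_step fE st | st <- q].
Qed.

Lemma list_bound (A : Type) (W : list A) (P : A -> nat -> Prop) :
  (forall a, exists B, forall n, P a n -> n <= B) -> exists B, forall a n, In a W -> P a n -> n <= B.
Proof.
move=> h; elim: W => [|a W [B hB]]; first by exists 0.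
have [B' hB'] := h a; exists (maxn B B') => b n [<-|bW] pn; rewrite leq_max.
  by rewrite (hB' n pn) orbT.
by rewrite (hB b n bW pn).
Qed.

Lemma uniform_bound m : exists B, forall u, size u <= m -> rigid Γ u -> forall v p, valid v p -> label_of p = u ->
  forall x c, connected Γ v x -> simple_cycle x c -> size c <= B.
Proof.
have [W hW] := words_upto fin m.
pose P u n := rigid Γ u /\ exists v p, [/\ valid v p, label_of p = u & exists x c, [/\ connected Γ v x, simple_cycle x c & size c = n]].
have [u|B hB] := @list_bound _ W P.
  case: (classic (rigid Γ u)) => [/rigid_bound[B hB]|nr]; last by exists 0 => n [].
  by exists B => n [_ [v [p [h1 h2 [x [c [h3 h4 <-]]]]]]]; exact: hB h1 h2 _ _ h3 h4.
exists B => u su rg v p h1 h2 x c h3 h4; apply: (hB u); first exact: hW.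
by split=> //; exists v, p; split=> //; exists x, c.
Qed.

(** A full cycle is too long to be a piece. *)
Lemma cycle_rigid v c : simple_cycle v c -> rigid Γ (label_of c).
Proof.
move=> sc; apply: NNPP => nr.
have oc : occ Γ (label_of c) (size c) by exists v, c, [::]; rewrite cats0.
by have := occ_piece gr oc nr; rewrite size_label; lia.
Qed.

(** If the component also had a cycle of length at most [N], the label of that cycle, a short rigid
    word, would bound the long one. *)
Lemma long_component : (forall N, exists v c, simple_cycle v c /\ N < size c) ->
  forall N, exists v c, [/\ simple_cycle v c, N < size c & forall x c', connected Γ v x -> simple_cycle x c' -> N < size c'].
Proof.
move=> unb N; have [B hB] := uniform_bound N; have [v [c [sc lt]]] := unb (maxn B N).
move: lt; rewrite gtn_max => /andP[ltB ltN].
exists v, c; split=> // x c' vx sc'; rewrite ltnNge; apply/negP => le.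
have [_ [vc' _]] := sc'.
have := hB (label_of c') _ (cycle_rigid sc') _ _ vc' erefl _ _ (connected_sym vx) sc.
by rewrite size_label => /(_ le); rewrite leqNgt ltB.
Qed.

Lemma valid_pow v c k : valid v c -> path_end v c = v -> valid v (flatten (nseq k c)).
Proof. by move=> vc ce; elim: k => //= k IH; rewrite valid_cat ce. Qed.

(** The label of the longer cycle can also be read by winding around the shorter one. By rigidity an
    automorphism relates the two readings, but only one of them repeats an edge. *)
Lemma constant_cycle a v c x c' : simple_cycle v c -> simple_cycle x c' ->
  label_of c = nseq (size c) a -> label_of c' = nseq (size c') a -> size c' <= size c.
Proof.
move=> sc sc' lc lc'; rewrite leqNgt; apply/negP => lt.
have [ne [vc [ce _]]] := sc; have [ne' [vc' [_ [_ nd]]]] := sc'.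
set n := size c' in lt lc' *; set r := take n (flatten (nseq n c)).
have c0 : 0 < size c by case: (c) ne.
have szf k : size (flatten (nseq k c)) = k * size c by elim: k => //= k IH; rewrite size_cat IH mulSn.
have szr : size r = n by rewrite size_takel // szf leq_pmulr.
have vr : valid v r by have := valid_pow n vc ce; rewrite -[flatten _](cat_take_drop n) valid_cat => -[].
have lf k : label_of (flatten (nseq k c)) = nseq (k * size c) a by elim: k => //= k IH; rewrite label_cat IH lc mulSn nseqD.
have lr : label_of r = label_of c'.
  rewrite /r label_ofE map_take -label_ofE lf lc'.
  by rewrite -(subnKC (leq_pmulr n c0)) nseqD take_size_cat // size_nseq.
have [fV [fE [[_ [[fE' [k3 _]] _]] _ ef]]] := cycle_rigid sc' vc' vr erefl lr.
have st0 : step Γ by case: (c) c0.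
have n2 : 1 < n by lia.
have e2 : nth st0.1 [seq y.1 | y <- r] (size c) = nth st0.1 [seq y.1 | y <- r] 0.
  have [n' en] : exists n', n = n'.+2 by exists n.-2; lia.
  rewrite !(nth_map st0) ?szr //; last by lia.
  rewrite !nth_take //; last by lia.
  by rewrite en /= !nth_cat ltnn subnn c0.
have l1 : size c < size c' := lt; have l2 : 0 < size c' := ltnW n2.
rewrite -ef !(nth_map st0.1) ?size_map // in e2.
have e3 : nth st0.1 [seq y.1 | y <- c'] (size c) = nth st0.1 [seq y.1 | y <- c'] 0.
  by have := congr1 fE' e2; rewrite !k3.
have := NoDup_nth_inj nd _ _ e3; rewrite -[List.map _ _]/[seq y.1 | y <- c'] size_map => /(_ lt (ltnW n2)) e0.
by rewrite e0 in c0.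
Qed.

(** The threshold [N] is imposed on all cycles of the component, so that a rigid factor of [z],
    wherever it is read, meets long cycles only. *)
Definition long_word N n0 z : Prop := exists v c,
  [/\ simple_cycle v c, label_of c = z, n0 <= size c & forall x c', connected Γ v x -> simple_cycle x c' -> N < size c'].

Lemma long_word_rot N n0 y z : long_word N n0 (y ++ z) -> long_word N n0 (z ++ y).
Proof.
case=> v [c [sc lc le hc]].
set c1 := take (size y) c; set c2 := drop (size y) c.
have ec : c = c1 ++ c2 by rewrite cat_take_drop.
have l1 : label_of c1 = y by rewrite label_ofE map_take -label_ofE lc take_size_cat.
have l2 : label_of c2 = z by rewrite label_ofE map_drop -label_ofE lc drop_size_cat.
have vc1 : valid v c1 by case: sc => _ [+ _]; rewrite ec valid_cat => -[].
exists (path_end v c1), (c2 ++ c1); split.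
- by apply: simple_cycle_rot; rewrite -ec.
- by rewrite label_cat l1 l2.
- by rewrite size_cat addnC -size_cat -ec.
- move=> x c' vx; apply: hc; apply: connected_trans vx; by exists c1.
Qed.

Lemma long_word_inv N n0 z : long_word N n0 z -> long_word N n0 (inv_word z).
Proof.
case=> v [c [sc lc le hc]]; exists v, (rpath c); split=> //; last by rewrite size_rpath.
  exact: simple_cycle_rev.
by rewrite label_rpath lc.
Qed.

Lemma long_word_occ N n0 z u : long_word N n0 z -> factor u z -> exists2 n, n0 <= n & occ Γ u n.
Proof.
case=> v [c [sc lc le _]] [x [y e]]; exists (size c) => //.
apply: (@occ_factor _ _ u x y); rewrite -e; exists v, c, [::]; rewrite cats0; split=> //.
Qed.

(* A factor of a long word is a piece, unless it is read in the long component itself. *)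
Lemma long_word_piece N n0 z u n : long_word N n0 z -> factor u z -> occ Γ u n -> 6 * size u < n \/ N < n.
Proof.
case=> v [c [sc lc le hc]] [x [y e]] oc; case: (classic (rigid Γ u)) => [rg|nr]; last by left; exact: occ_piece oc nr.
right; have [v' [c1 [c2 [sc' l1 <-]]]] := oc.
set p := take (size u) (drop (size x) c).
have lp : label_of p = u by rewrite label_ofE map_take map_drop -label_ofE lc e drop_size_cat // take_size_cat.
have ec : c = take (size x) c ++ p ++ drop (size u) (drop (size x) c) by rewrite !cat_take_drop.
have vc : valid v c by case: sc => _ [].
have vp : valid (path_end v (take (size x) c)) p by move: vc; rewrite ec !valid_cat -ec => -[_ []].
have vc1 : valid v' c1 by case: sc' => _ [+ _]; rewrite valid_cat => -[].
have [fV [fE [au ev _]]] := rg _ _ _ _ vc1 vp l1 lp.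
have := aut_cycle au sc'; rewrite ev => sc2.
have := hc _ _ _ sc2; rewrite size_map; apply.
exists (take (size x) c); split=> //; by move: vc; rewrite {1}ec valid_cat => -[].
Qed.

Lemma long_word_reduced N n0 z : long_word N n0 z -> freely_reduced z.
Proof. by move=> lz; have [n _ oc] := long_word_occ lz (factor_refl z); exact: occ_reduced red oc. Qed.

(** Nonconstancy lets a run of equal letters come to an end later on. It holds once the threshold
    exceeds the lengths of the constant cycles, bounded for each of the finitely many letters. *)
Lemma long_words_exist : (forall N, exists v c, simple_cycle v c /\ N < size c) ->
  forall N, exists N', [/\ N <= N', exists z, long_word N' N' z & forall z a, long_word N' N' z -> z <> nseq (size z) a].
Proof.
move=> unb N; have [l hl] := fin.
pose P (a : letter S) n := exists v c, [/\ simple_cycle v c, label_of c = nseq (size c) a & size c = n].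
have [a|B hB] := @list_bound _ ([seq (s, true) | s <- l] ++ [seq (s, false) | s <- l]) P.
  case: (classic (exists v c, simple_cycle v c /\ label_of c = nseq (size c) a)) => [[v [c [sc lc]]]|nex].
    by exists (size c) => n [x [c' [sc' lc' <-]]]; exact: constant_cycle sc sc' lc lc'.
  by exists 0 => n [x [c' [sc' lc' _]]]; case: nex; exists x, c'.
exists (maxn B N).+1; split; first by apply: leqW; rewrite leq_max leqnn orbT.
  by have [v [c [sc lt hc]]] := long_component unb (maxn B N).+1; exists (label_of c), v, c; split=> //; exact: ltnW.
move=> z a [v [c [sc <- lt _]]]; rewrite size_label => e.
have : size c <= B.
  apply: (hB a); last by exists v, c.
  by case: a {e} => a []; apply/in_or_app; [left|right]; apply: (in_map (fun s => (s, _))); exact: hl.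
by rewrite leqNgt (leq_ltn_trans (leq_maxl B N) lt).
Qed.
End Components.

Lemma classical_min (P : nat -> Prop) : (exists n, P n) -> exists2 n, P n & forall m, P m -> n <= m.
Proof.
case=> n; elim/ltn_ind: n => n IH pn; case: (classic (exists2 m, P m & m < n)) => [[m pm lt]|nex].
  exact: IH lt pm.
by exists n => // m pm; rewrite leqNgt; apply/negP => lt; apply: nex; exists m.
Qed.

Lemma classical_max (P : nat -> Prop) B : (exists n, P n) -> (forall n, P n -> n <= B) ->
  exists2 n, P n & forall m, P m -> m <= n.
Proof.
move=> [n pn] bnd; have [|k [m pm ek] hk] := @classical_min (fun k => exists2 m, P m & k = B - m).
  by exists (B - n), n.
exists m => // j pj; have := hk _ (ex_intro2 _ _ j pj erefl); have := bnd _ pj; have := bnd _ pm; lia.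
Qed.

Lemma constant_or_break (A : Type) (a : A) s : s = nseq (size s) a \/ exists j d s', d <> a /\ s = nseq j a ++ d :: s'.
Proof.
elim: s => [|b s IH]; first by left.
case: (classic (b = a)) => [->|nab]; last by right; exists 0, b, s.
case: IH => [e|[j [d [s' [nd ->]]]]]; first by left; rewrite /= -e.
by right; exists j.+1, d, s'.
Qed.

(** * Choice of the two factors of the axis *)

Section Junction.
Variables (S : Type) (Γ : LGraph S).
Hypothesis red : reduced Γ.
Hypothesis gr : Gr'16 Γ.
Implicit Types (q r u w y z : word S) (a b d : letter S).

(** [1 < n] keeps loops out: a letter covers a loop completely, so no tame side may contain it. *)
Definition min_word l q : Prop := [/\ size q = l.+1, rigid Γ q & exists2 n, 1 < n & occ Γ q n].

Lemma min_word_exists : (exists v (c : seq (step Γ)), simple_cycle v c /\ 1 < size c) ->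
  exists l, (exists q, min_word l q) /\ forall u n, 1 < n -> occ Γ u n -> size u <= l -> 6 * size u < n.
Proof.
case=> v [c [sc lt]].
have [|l hl mn] := @classical_min (fun l => exists q, min_word l q).
  exists (size c).-1, (label_of c); split; first by rewrite size_label prednK // ltnW.
    exact: cycle_rigid sc.
  by exists (size c) => //; exists v, c, [::]; rewrite cats0.
exists l; split=> // u n n1 oc lu; case: (classic (rigid Γ u)) => [rg|]; last exact: occ_piece.
case: u oc lu rg => [|a u] oc lu rg; first by rewrite muln0; apply: leq_trans n1.
have nl : ~~ (l <= size u) by rewrite -ltnNge.
case/negP: nl; apply: mn.
by exists (a :: u); split=> //; exists n.
Qed.

Lemma inv_nseq k a : inv_word (nseq k a) = nseq k (inv_letter a).
Proof. by rewrite inv_wordE map_nseq rev_nseq. Qed.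

Variables (l N V K : nat).
Notation long := (long_word Γ N N).
Hypothesis l0 : exists q, min_word l q.
Hypothesis hV : forall q n, min_word l q -> occ Γ q n -> n <= V.
Hypothesis VN : V < N.
Hypothesis KN : 2 * K + l + 1 <= N.
Hypothesis lK : l < K.
Hypothesis nonconst : forall z a, long z -> z <> nseq (size z) a.

Lemma min_not_long q z : min_word l q -> long z -> ~ factor q z.
Proof.
move=> mq lz fq; have [n le oc] := long_word_occ lz fq.
by have := leq_trans VN (leq_trans le (hV mq oc)); rewrite ltnn.
Qed.

Lemma long_size z : long z -> N <= size z.
Proof. by case=> v [c [_ <- le _]]; rewrite size_label. Qed.

(** The first two clauses make powers of [q ++ r] freely reduced. By the third, a relator that
    contains [q] and continues into [r] is longer than [6 * l.+1], which keeps its contact below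
    half. *)
Definition junction q r : Prop :=
  [/\ forall x a y, q = rcons x a -> r <> inv_letter a :: y,
      forall x a y, r = rcons x a -> q <> inv_letter a :: y &
      forall a q' b r', q = a :: q' -> r = b :: r' -> ~ min_word l (rcons q' b)].

Definition stretch a : Prop := exists z, long (nseq K a ++ z).

Lemma stretch_inv a : stretch a -> stretch (inv_letter a).
Proof.
case=> z /long_word_inv; rewrite inv_cat inv_nseq => /long_word_rot h.
by exists (inv_word z).
Qed.

Lemma stretch_end a : stretch a -> exists d z, d <> a /\ long (nseq K a ++ d :: z).
Proof.
case=> z lz; have [e|[j [d [z' [nd e]]]]] := constant_or_break a z.
  by case: (nonconst (a := a) lz); rewrite size_cat size_nseq nseqD -e.
exists d, (z' ++ nseq j a); split=> //.
rewrite -cat_cons catA; apply: long_word_rot; rewrite catA -nseqD addnC nseqD -catA -e; exact: lz.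
Qed.

(** [q] ends with as many letters [a] as possible, and shifting it by one letter would add another.
    [r] is the stretch of letters [a], extended by the different letter [d] when it would otherwise
    cancel with the start of [q]. *)
Lemma junction_stretch : (exists a, stretch a) ->
  exists q r z, [/\ min_word l q, long z, factor r z, K <= size r <= 2 * K & junction q r].
Proof.
case=> a0 sa0; have [q0 mq0] := l0.
pose P k := exists q a x, [/\ min_word l q, stretch a & q = x ++ nseq k a].
have [||k [q [a [x [mq sa eq]]]] mx] := @classical_max P l.+1.
- by exists 0, q0, a0, q0; rewrite cats0.
- by move=> k [q [a [x [[<- _ _] _ ->]]]]; rewrite size_cat size_nseq leq_addl.
have [d [z [nd lz]]] := stretch_end sa.
have [sq _ _] := mq.
have kl : k <= l.
  rewrite -ltnS ltn_neqAle; apply/andP; split; last by rewrite -sq eq size_cat size_nseq leq_addl.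
  apply/eqP => ek; have x0 : size x = 0 by move: sq; rewrite eq size_cat size_nseq ek; clear; lia.
  apply: (min_not_long mq lz); exists [::], (nseq (K - k) a ++ d :: z); rewrite eq; case: (x) x0 => // _.
  by rewrite /= catA -nseqD subnKC // ek.
have K0 : 0 < K by apply: leq_ltn_trans lK.
have j1 r x0 b y : r = a :: y -> q = rcons x0 b -> r <> inv_letter b :: y.
  move=> -> e [eb].
  (* The inverse of [a] has a stretch as well, so if [q] ended with it the maximum would be
     positive, and [q] would end with [a] after all. *)
  have k1 : 0 < k.
    apply: mx; exists q, (inv_letter a), x0; split=> //; first exact: stretch_inv.
    by rewrite e eb inv_letterK cats1.
  move: e; rewrite eq -(prednK k1) -[k.-1.+1]addn1 nseqD catA cats1 => /rcons_inj[_ e].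
  by apply: (@inv_letter_neq _ b); rewrite -eb e.
have j3 b q' : q = b :: q' -> ~ min_word l (rcons q' a).
  move=> e m2; suff : k.+1 <= k by rewrite ltnn.
  apply: mx; case: x eq => [|b' x'] eq.
    by move: sq; rewrite eq /= size_nseq => ek; rewrite ek ltnn in kl.
  exists (rcons q' a), a, x'; split=> //; move: e; rewrite eq => -[_ <-].
  by rewrite -addn1 nseqD catA cats1.
have eK y : nseq K a ++ y = a :: (nseq K.-1 a ++ y) by rewrite -{1}(prednK K0).
case: (classic (exists y, q = inv_letter a :: y)) => [[y ey]|nfa].
  exists q, (nseq K a ++ [:: d]), (nseq K a ++ d :: z); split=> //.
  - by exists [::], z; rewrite -catA.
  - by rewrite size_cat size_nseq /= addn1 leqnSn /=; lia.
  - split; [|move=> x0 b y'|by rewrite eK => b q' b' r' e [<- _]; exact: j3 e].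
      move=> x0 b y' e; rewrite eK => -[e1 e2]; apply: (j1 (a :: y') x0 b y' erefl e); by rewrite e1.
    rewrite cats1 => /rcons_inj[_ <-]; rewrite ey => /(congr1 (head d)) e; apply: nd; rewrite /= in e.
    by rewrite -[d]inv_letterK -e inv_letterK.
exists q, (nseq K a), (nseq K a ++ d :: z); split=> //.
- by exists [::], (d :: z).
- by rewrite size_nseq leqnn /=; lia.
- split.
  + move=> x0 b y' e; rewrite -[nseq K a]cats0 eK => -[e1 e2]; apply: (j1 (a :: y') x0 b y' erefl e); by rewrite e1.
  + move=> x0 b y'; rewrite -(prednK K0) -[K.-1.+1]addn1 nseqD cats1 => /rcons_inj[_ <-] e.
    by apply: nfa; exists y'.
  + by rewrite -[nseq K a]cats0 eK => b q' b' r' e [<- _]; exact: j3 e.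
Qed.

(** [q] has the longest suffix [y] that begins a long word, continued by [z]; the shifted word would
    have a longer one. The prefix [r] of [z] has a length between [K] and [2 * K] for which its last
    letter does not cancel with the first of [q]; if there were none, these last letters would form
    a stretch. *)
Lemma junction_nostretch z0 : long z0 -> ~ (exists a, stretch a) ->
  exists q r z, [/\ min_word l q, long z, factor r z, K <= size r <= 2 * K & junction q r].
Proof.
move=> lz0 ns; have [q0 mq0] := l0.
pose P k := exists q x y z, [/\ min_word l q, q = x ++ y, size y = k & long (y ++ z)].
have [||k [q [x [y [z [mq eq sy lz]]]]] mx] := @classical_max P l.+1.
- by exists 0, q0, q0, [::], z0; rewrite cats0.
- by move=> k [q [x [y [z [[<- _ _] -> <- _]]]]]; rewrite size_cat leq_addl.
have [sq _ _] := mq.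
have kl : k <= l.
  rewrite -ltnS ltn_neqAle; apply/andP; split; last by rewrite -sq -sy eq size_cat leq_addl.
  apply/eqP => ek; have x0 : size x = 0 by move: sq; rewrite eq size_cat sy ek; clear; lia.
  by apply: (min_not_long mq lz); exists [::], z; rewrite eq; case: (x) x0.
have sz : 2 * K <= size z by have := long_size lz; rewrite size_cat sy; move: KN kl; clear; lia.
have K0 : 0 < K by apply: leq_ltn_trans lK.
case: q mq eq sq => [|f q1] mq eq sq //.
have [L /andP[LK L2K] hL] : exists2 L, K <= L <= 2 * K & nth f z L.-1 <> inv_letter f.
  apply: NNPP => nex; apply: ns; exists (inv_letter f).
  have al j : K <= j <= 2 * K -> nth f z j.-1 = inv_letter f by move=> jb; apply: NNPP => h; apply: nex; exists j.
  have ez : take K (drop K.-1 z) = nseq K (inv_letter f).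
    apply: (@eq_from_nth _ f); rewrite size_takel ?size_nseq ?size_drop //; try by move: sz K0; clear; lia.
    move=> i lt; rewrite nth_take // nth_drop nth_nseq lt -(al (K + i)); last by move: lt; clear; lia.
    by congr nth; move: K0; clear; lia.
  exists (drop K (drop K.-1 z) ++ (y ++ take K.-1 z)).
  rewrite -ez catA cat_take_drop; apply: long_word_rot; rewrite -catA cat_take_drop; exact: lz.
have Lz : L <= size z by apply: leq_trans sz.
have L0 : 0 < L by apply: leq_trans LK.
exists (f :: q1), (take L z), (y ++ z); split=> //.
- by exists y, (drop L z); rewrite cat_take_drop.
- by rewrite size_takel // LK.
split.
- move=> x0 b y' e e2; have ez : z = inv_letter b :: behead z.
    by case: z {lz sz hL Lz} e2 => [|c z'] /=; case: (L) L0 => // L' _ [<-].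
  case/lastP: y eq sy lz => [|y b'] eq sy lz.
    suff : 1 <= k by rewrite -sy.
    apply: mx; exists (f :: q1), x0, [:: b], (inv_word (behead z)); split=> //; first by rewrite cats1.
    have := long_word_inv lz; rewrite /= ez inv_cons inv_letterK => /long_word_rot; exact.
  have eb : b' = b by move: e; rewrite eq -rcons_cat => /rcons_inj[_ ->].
  apply: (long_word_reduced red lz (x := y) (a := b) (y := behead z)).
  by rewrite eb cat_rcons {1}ez.
- move=> x0 b y' e [ef _]; apply: hL; rewrite ef inv_letterK.
  have := congr1 (fun s => nth f s L.-1) e; rewrite nth_take; last by rewrite prednK.
  have sx : size x0 = L.-1 by have := congr1 size e; rewrite size_rcons size_takel // => ->.
  by rewrite nth_rcons sx ltnn eqxx ef.
- move=> b q' c r' [_ eq'] e m2; subst q'; suff : k.+1 <= k by rewrite ltnn.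
  apply: mx; case: x eq => [|b' x'] eq.
    by move: sq; rewrite eq /= sy => ek; rewrite ek ltnn in kl.
  exists (rcons q1 c), x', (rcons y c), (behead z); split=> //.
  + by move: eq => -[_ ->]; rewrite rcons_cat.
  + by rewrite size_rcons sy.
  + have ez : z = c :: behead z by case: z {lz sz hL Lz} e => [|c' z'] /=; case: (L) L0 => // L' _ [-> _].
    by rewrite cat_rcons -ez.
Qed.

Lemma junction_exists z0 : long z0 ->
  exists q r z, [/\ min_word l q, long z, factor r z, K <= size r <= 2 * K & junction q r].
Proof.
move=> lz; case: (classic (exists a, stretch a)); first exact: junction_stretch.
exact: junction_nostretch lz.
Qed.
End Junction.

Section Prefixes.
Variable T : Type.
Implicit Types s t u v : seq T.

Lemma cat_prefix_ge s t u v : s ++ t = u ++ v -> size u <= size s -> s = u ++ drop (size u) s /\ drop (size u) s ++ t = v.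
Proof.
move=> e le; have e1 : take (size u) s = u by rewrite -(takel_cat t le) e take_size_cat.
split; first by rewrite -{1}(cat_take_drop (size u) s) e1.
have e2 : drop (size u) (s ++ t) = v by rewrite e drop_size_cat.
rewrite -e2 drop_cat; case: ltnP => // ge; have -> : size u = size s by lia.
by rewrite subnn drop0 drop_size.
Qed.

Lemma cat_prefix_le s t u v : s ++ t = u ++ v -> size s <= size u -> s = take (size s) u.
Proof. by move=> e le; rewrite -(takel_cat v le) -e take_size_cat. Qed.

Lemma drop_catE n s t : drop n (s ++ t) = drop n s ++ drop (n - size s) t.
Proof.
rewrite drop_cat; case: ltnP => [lt|ge]; last by rewrite [drop n s]drop_oversize.
by have -> : n - size s = 0 by [lia]; rewrite drop0.
Qed.

Lemma take_catE n s t : take n (s ++ t) = take n s ++ take (n - size s) t.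
Proof.
rewrite take_cat; case: ltnP => [lt|ge]; last by rewrite [take n s]take_oversize.
by have -> : n - size s = 0 by [lia]; rewrite take0 cats0.
Qed.
End Prefixes.

Lemma split_factor (S : Type) (p s r s' : word S) : factor p (s ++ r ++ s') ->
  exists a b c, [/\ p = a ++ b ++ c, factor a s, factor b r, factor c s' & a <> [::] -> c <> [::] -> b = r].
Proof.
case=> x [y e]; have ep : p = take (size p) (drop (size x) (s ++ r ++ s')).
  by rewrite e drop_size_cat // take_size_cat.
set n := size p in ep; set k := size x in ep.
set n1 := n - size (drop k s); set k1 := k - size s.
exists (take n (drop k s)), (take n1 (drop k1 r)), (take (n1 - size (drop k1 r)) (drop (k1 - size r) s')).
split; try exact: factor_sub.
  by rewrite ep !drop_catE take_catE -/n1 -/k1 take_catE.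
move=> an cn; have lk : k < size s by rewrite ltnNge; apply/negP => ge; apply: an; rewrite drop_oversize.
have ek : k1 = 0 by rewrite /k1; lia.
rewrite ek drop0 in cn *; apply: take_oversize; rewrite leqNgt; apply/negP => lt; apply: cn.
by have -> : n1 - size r = 0 by [lia]; rewrite take0.
Qed.

Lemma freely_reduced_cat (S : Type) (u v : word S) : freely_reduced u -> freely_reduced v ->
  (forall x a y, u = rcons x a -> v <> inv_letter a :: y) -> freely_reduced (u ++ v).
Proof.
move=> ru rv j x a y e; have [le|lt] := leqP (size x + 2) (size u).
  have := congr1 (take (size u)) e; rewrite take_size_cat // => eu.
  apply: (ru x a (take (size u - (size x + 2)) y)); rewrite {1}eu take_catE take_oversize; last by lia.
  congr (_ ++ _); have -> : size u - size x = (size u - (size x + 2)).+2 by lia.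
  by [].
have [le2|lt2] := leqP (size u) (size x).
  have [_ ev] := cat_prefix_ge (esym e) le2; apply: (rv (drop (size u) x) a y); by rewrite -ev.
have su : size u = (size x).+1 by lia.
have e2 : rcons x a ++ inv_letter a :: y = u ++ v by rewrite cat_rcons -e.
have le3 : size u <= size (rcons x a) by rewrite size_rcons su.
have [e3 e4] := cat_prefix_ge e2 le3.
have e5 : drop (size u) (rcons x a) = [::] by rewrite drop_oversize // size_rcons su.
by rewrite e5 cats0 in e3; rewrite e5 in e4; apply: (j x a y).
Qed.

(** * Contacts of powers with long and short relators *)

Section UnboundedCycles.
Variables (S : Type) (Γ : LGraph S).
Hypothesis red : reduced Γ.
Hypothesis gr : Gr'16 Γ.
Implicit Types (p q r u z : word S).

(** Either [p] contains a full copy of [q] at a period, the first of which is singled out, or it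
    lies around a single [r] and misses a letter of the copy of [q] on each side. *)
Lemma power_factor q r p k : 0 < size q -> factor p (pw (q ++ r) k) ->
  (exists t u y k', p = drop t (q ++ r) ++ q ++ u /\ u ++ y = r ++ pw (q ++ r) k') \/
  factor p (behead q ++ r ++ take (size q).-1 q).
Proof.
move=> q0; set g := q ++ r => fp; have gn : g <> [::] by rewrite /g; case: (q) q0.
have [t [k' [y [tg _ e]]]] := power_offset gn fp.
case: k' e => [|k1] e.
  right; have sp : size p = 0 by have := congr1 size e; rewrite !size_cat /=; clear; lia.
  by case: (p) sp => // _; exists [::], (behead q ++ r ++ take (size q).-1 q).
rewrite pwS takel_cat ?(ltnW tg) // in e.
have {}e : p ++ y = drop t g ++ pw g k1.
  have := congr1 (drop t) e; rewrite drop_catE (drop_size_cat _ (size_takel (ltnW tg))) => <-.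
  by have -> : t - size g = 0 by [lia]; rewrite drop0.
have [t0|t0] := posnP t.
  subst t; rewrite drop0 -catA in e; have [le|lt] := leqP (size q) (size p).
    have [e1 e2] := cat_prefix_ge e le; left; exists (size g), (drop (size q) p), y, k1.
    by rewrite drop_size e2.
  right; have -> : p = take (size p) q by apply: cat_prefix_le e (ltnW lt).
  do 2!apply: factor_catl; exists [::], (drop (size p) (take (size q).-1 q)) => /=.
  have -> : take (size p) q = take (size p) (take (size q).-1 q) by rewrite take_takel // -ltnS prednK.
  by rewrite cat_take_drop.
have [A eA] : exists A, behead q ++ r = A ++ drop t g.
  have -> : behead q ++ r = behead g by rewrite /g; case: (q) q0.
  exists (take t.-1 (behead g)); rewrite -{2}(prednK t0).
  by case: (g) => //= ? ?; rewrite cat_take_drop.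
have [le|lt] := leqP (size (drop t g) + size q) (size p).
  have [e1 e2] := cat_prefix_ge e (leq_trans (leq_addr _ _) le).
  case: k1 e e2 => [|k2] e e2.
    by have := congr1 size e2; rewrite !size_cat size_drop /=; move: le q0; clear; lia.
  rewrite pwS -catA in e2; have [|e3 e4] := cat_prefix_ge e2; first by rewrite size_drop; move: le; clear; lia.
  left; exists t, (drop (size q) (drop (size (drop t g)) p)), y, k2; split; last exact: e4.
  by rewrite {1}e1 {1}e3.
right; rewrite catA eA -catA; apply: factor_catl.
have pre : factor p (drop t g ++ take (size q).-1 q).
  have sp : size p <= size (drop t g ++ take (size q).-1 q).
    by rewrite size_cat size_takel ?leq_pred //; move: lt q0; clear; lia.
  case: k1 e => [|k1] e.
    exists [::], (drop (size p) (drop t g) ++ take (size q).-1 q) => /=.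
    have le : size p <= size (drop t g) by have := congr1 size e; rewrite !size_cat /= addn0 => <-; rewrite leq_addr.
    by rewrite catA -{1}[drop t g](cat_take_drop (size p)) -(cat_prefix_le e le).
  have e' : p ++ y = (drop t g ++ take (size q).-1 q) ++ (drop (size q).-1 q ++ r ++ pw g k1).
    by rewrite e pwS -[RHS]catA; congr (_ ++ _); rewrite [RHS]catA cat_take_drop -catA.
  exists [::], (drop (size p) (drop t g ++ take (size q).-1 q)).
  by rewrite /= -[LHS](cat_take_drop (size p)) -(cat_prefix_le e' sp).
exact: pre.
Qed.

(** If the letter is rigid, an automorphism carries the loop to an edge of the longer simple cycle,
    whose end points would coincide; if it is a piece, it is below a sixth of every cycle. *)
Lemma no_loop a n0 n : 1 < n0 -> occ Γ [:: a] n0 -> occ Γ [:: a] n -> 1 < n.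
Proof.
move=> n01 oc0 oc; case: (classic (rigid Γ [:: a])) => [rg|nr]; last first.
  by have h := occ_piece gr oc nr; apply: leq_trans h.
rewrite ltnNge; apply/negP => n1.
have [v [c1 [c2 [sc la sz]]]] := oc; have [v' [d1 [d2 [sc' la' sz']]]] := oc0.
case: c1 la sc sz => [|st [|? ?]] // la sc sz; case: d1 la' sc' sz' => [|st' [|? ?]] // la' sc' sz'.
case: c2 sc sz => [|? ?] sc sz; last by move: n1; rewrite -sz.
case: d2 sc' sz' => [|st2 d2] sc' sz'; first by move: n01; rewrite -sz'.
have [_ [[e1 _] [/= e2 _]]] := sc; have [_ [[e1' vd] [/= e2' [nd _]]]] := sc'.
have v1 : valid v [:: st] by [].
have v1' : valid v' [:: st'] by [].
have [fV [fE [au ev [ef]]]] := rg _ _ _ _ v1 v1' la la'.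
have [_] := aut_path au v1; rewrite /= e2 ev => e3.
have est : aut_step fE st = st'.
  have eb : st.2 = st'.2 := congr1 (fun s => (head a s).2) (etrans la (esym la')).
  by rewrite /aut_step ef eb -surjective_pairing.
rewrite est in e3; move: nd => /= /NoDup_cons_iff[ni _]; apply: ni; rewrite e3 -{1}e2'.
elim: d2 st2 {sc' sz' vd e2'} => [|b d IH] st2 /=; first by left.
by right; apply: IH.
Qed.

Lemma In_pw (b : letter S) q r k : In b (pw (q ++ r) k) -> In b q \/ In b r.
Proof.
elim: k => [//|k IH]; rewrite pwS => h; case: (in_app_or _ _ _ h) => [h2|/IH //].
exact: in_app_or h2.
Qed.

Variables (l N V K : nat) (q r z : word S).
Hypothesis mq : min_word Γ l q.
Hypothesis short_piece : forall u n, 1 < n -> occ Γ u n -> size u <= l -> 6 * size u < n.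
Hypothesis hV : forall n, occ Γ q n -> n <= V.
Hypothesis lz : long_word Γ N N z.
Hypothesis fr : factor r z.
Hypothesis Kr : K <= size r <= 2 * K.
Hypothesis VK : 2 * V + 4 * l < K.
Hypothesis KN : 6 * K + 6 * l < N.
Hypothesis jn : junction Γ l q r.
Notation g := (q ++ r).

Let sq : size q = l.+1. Proof. by case: mq. Qed.

Let rpiece u n : factor u r -> occ Γ u n -> 6 * size u < n \/ N < n.
Proof. by move=> fu; apply: (long_word_piece gr lz); apply: factor_trans fu fr. Qed.

Let pw_reduced k : freely_reduced (pw g k).
Proof.
have [_ _ [n _ oc]] := mq; have rq : freely_reduced q := occ_reduced red oc.
have rr : freely_reduced r := freely_reduced_factor fr (long_word_reduced red lz).
have [j1 j2 _] := jn; have rg : freely_reduced g by apply: freely_reduced_cat.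
elim: k => [|k IH]; first by case.
rewrite pwS; apply: freely_reduced_cat => // x a y eg.
case: k IH => [|k] IH //; rewrite pwS.
have r0 : 0 < size r by have /andP[le _] := Kr; apply: leq_trans le; apply: leq_ltn_trans VK.
have [r' [b er]] : exists r' b, r = rcons r' b by case/lastP: (r) r0 => // r' b _; exists r', b.
have eb : b = a by move: eg; rewrite er -rcons_cat => /rcons_inj[_ ->].
have [c [q' eq]] : exists c q', q = c :: q' by case: (q) sq => // c q' _; exists c, q'.
rewrite eq /= => -[ec _]; apply: (j2 r' b q'); first exact: er.
by rewrite eq ec eb.
Qed.

Let pw_long p k n : p <> [::] -> factor p (pw g k) -> occ Γ p n -> 1 < n.
Proof.
case: p => // a p _ [x [y e]] oc; have oca : occ Γ [:: a] n by apply: (@occ_prefix _ _ _ p).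
have [_ _ [n0 n01 oc0]] := mq.
have h : In a (pw g k) by rewrite e; apply/in_or_app; right; left.
have fa w : In a w -> factor [:: a] w.
  by move=> aw; have [w1 [w2 ->]] := in_split a w aw; exists w1, w2.
case: (In_pw h) => [/fa[x1 [y1 e1]]|/fa fra].
  by apply: no_loop n01 _ oca; rewrite e1 in oc0; exact: occ_factor oc0.
have [n2 le oc2] := long_word_occ lz (factor_trans fra fr).
by apply: no_loop (leq_trans _ le) oc2 oca; move: KN VK; clear; lia.
Qed.

(** The partial copies of [q] have at most [l] letters and stay below a sixth; so does the part in
    [r], unless the cycle is longer than [N] and outweighs everything. Both partial copies occur
    only together with the whole of [r], which is long enough to absorb them. *)
Let touch_away p n : factor p (behead q ++ r ++ take l q) -> p <> [::] -> 1 < n -> occ Γ p n -> 3 * size p < n.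
Proof.
move=> fp pn n1 oc; have [a [b [c [ep fa fb fc br]]]] := split_factor fp.
have la : size a <= l by have := factor_size fa; rewrite size_behead sq.
have lc : size c <= l by apply: leq_trans (factor_size fc) _; rewrite size_takel // sq.
have lb : size b <= 2 * K by have /andP[_ le] := Kr; apply: leq_trans (factor_size fb) le.
have oa : 6 * size a < n by apply: short_piece n1 _ la; apply: (@occ_factor _ _ a [::] (b ++ c)); rewrite -ep.
have ocb : occ Γ b n by apply: (@occ_factor _ _ b a c); rewrite -ep.
have occ_ : 6 * size c < n by apply: short_piece n1 _ lc; apply: (@occ_factor _ _ c (a ++ b) [::]); rewrite cats0 -catA -ep.
rewrite ep !size_cat; case: (rpiece fb ocb) => [ob|nN]; last by move: la lb lc KN nN; clear; lia.
case: (classic (a = [::])) => [->|an]; first by move: ob occ_ => /=; clear; lia.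
case: (classic (c = [::])) => [->|cn]; first by move: ob oa => /=; clear; lia.
have /andP[Kr1 _] := Kr; rewrite (br an cn) in ob *.
by move: la lc ob Kr1 VK; clear; lia.
Qed.

(** Containing [q] bounds the cycle by [V], so by [long_word_piece] the parts in [r] are below a
    sixth. As [q] has one letter more than the sixth known for [l], three sixths would not do: for
    nonempty [u] the junction yields that letter, and for empty [u] only two parts remain. *)
Let touch_aligned p n t u y k : p = drop t g ++ q ++ u -> u ++ y = r ++ pw g k -> 1 < n -> occ Γ p n ->
  [/\ size p <= V, 2 * size p <= n, factor (drop t g) r & factor u r].
Proof.
move=> ep eu n1 oc; have nV : n <= V by apply: hV; apply: (@occ_factor _ _ q (drop t g) u); rewrite -ep.
have pV : size p <= V := leq_trans (occ_size oc) nV.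
have /andP[Kr1 _] := Kr; have nN : n < N by move: nV VK KN; clear; lia.
have szp : size p = size (drop t g) + l.+1 + size u by rewrite ep !size_cat sq addnA.
have f1 : factor (drop t g) r.
  have -> : drop t g = drop (t - size q) r.
    rewrite drop_catE drop_oversize // leqNgt; apply/negP => lt.
    by move: pV; rewrite szp drop_catE size_cat; have -> : t - size q = 0 by [lia]; rewrite drop0; move: Kr1 VK; clear; lia.
  by exists (take (t - size q) r), [::]; rewrite cats0 cat_take_drop.
have f2 : factor u r.
  have -> : u = take (size u) r by apply: cat_prefix_le eu _; move: pV szp Kr1 VK; clear; lia.
  by exists [::], (drop (size u) r); rewrite cat_take_drop.
have o1 : 6 * size (drop t g) < n.
  have oc1 : occ Γ (drop t g) n by apply: (@occ_factor _ _ _ [::] (q ++ u)); rewrite -ep.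
  by case: (rpiece f1 oc1) => //; move: nN; clear; lia.
have o2 : 6 * size u < n.
  have oc2 : occ Γ u n by apply: (@occ_factor _ _ _ (drop t g ++ q) [::]); rewrite cats0 -catA -ep.
  by case: (rpiece f2 oc2) => //; move: nN; clear; lia.
have o3 : 6 * l < n.
  have oc3 : occ Γ (take l q) n.
    by apply: (@occ_factor _ _ _ (drop t g) (drop l q ++ u)); rewrite [take l q ++ _]catA cat_take_drop -ep.
  by have := short_piece n1 oc3; rewrite size_takel ?sq // => /(_ (leqnn _)).
split=> //; case eu0 : u => [|b u'].
  by move: szp o1 o3 n1; rewrite eu0 => -> /=; clear; lia.
have [a [q' eq]] : exists a q', q = a :: q' by case: (q) sq => // a q' _; exists a, q'.
have er : r = b :: behead r.
  by move: eu; rewrite eu0; case: (r) Kr1 => [|c r'] /=; [move: VK; clear; lia|move=> _ [-> _]].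
have [_ _ j3] := jn; have nm := j3 _ _ _ _ eq er.
have sw : size (rcons q' b) = l.+1 by rewrite size_rcons; move: sq; rewrite eq.
have ow : occ Γ (rcons q' b) n.
  by apply: (@occ_factor _ _ _ (drop t g ++ [:: a]) u'); rewrite -catA /= cat_rcons -cat_cons -eq -eu0 -ep.
have nr : ~ rigid Γ (rcons q' b) by move=> rg; apply: nm; split=> //; exists n.
have := occ_piece gr ow nr; rewrite sw; move: szp o1 o2 n1; clear.
by move: (size p) (size (drop t g)) (size u) => *; lia.
Qed.

(** An arc of a zero chain exceeds a third of its cycle, so it contains a full [q] and has length at
    most [V], less than half of [r]. Two consecutive arcs would contain copies of [q] with [r]
    between them; hence chains along the axis have a single arc. *)
Theorem unbounded_axis_of_junction : axis Γ g (V + 2 * K + 2 * l) V.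
Proof.
have q0 : 0 < size q by rewrite sq.
have el : (size q).-1 = l by rewrite sq.
have cases p k n : p <> [::] -> factor p (pw g k) -> occ Γ p n ->
    3 * size p < n \/ [/\ size p <= V & 2 * size p <= n].
  move=> pn fp oc; have n1 := pw_long pn fp oc.
  case: (power_factor q0 fp) => [[t [u [y [k' [ep eu]]]]]|]; last by rewrite el => fp'; left; exact: touch_away oc.
  by have [h1 h2 _ _] := touch_aligned ep eu n1 oc; right.
split.
- by case: (q) q0.
- move=> k; split=> // u n un fu oc.
  by case: (cases u k n un fu oc) => [|[_ //]]; clear; lia.
- move=> k u n un fu oc; case: (power_factor q0 fu) => [[t [u' [y [k' [ep eu]]]]]|].
    by have [h1 _ _ _] := touch_aligned ep eu (pw_long un fu oc) oc; apply: leq_trans h1 _; rewrite -addnA leq_addr.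
  move=> /factor_size; rewrite !size_cat size_behead el size_takel; last by rewrite sq.
  by have /andP[_ le] := Kr; move: le; clear; lia.
move=> k u ps zc fp.
have arc u' p v : zero_arc Γ u' p v -> exists n, [/\ occ Γ p n, n < 3 * size p & p <> [::]].
  case=> t [n [oc _ sz st [s1 s4]]]; exists n; split=> //; first by move: sz st s1 s4; clear; lia.
  by move=> e; move: sz st s1 s4; rewrite e /=; clear; lia.
case: zc fp => [//|u1 v1 p1 [|p2 ps'] za zc fp].
  rewrite /= cats0 in fp *; have [n [oc lt pn]] := arc _ _ _ za.
  by case: (cases p1 k n pn fp oc) => [|[]//]; move: lt; clear; lia.
exfalso; have [n1 [oc1 lt1 pn1]] := arc _ _ _ za.
have [v2 za2] : exists v2, zero_arc Γ (inv_word v1) p2 v2 by inversion zc; exists v.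
have [n2 [oc2 lt2 pn2]] := arc _ _ _ za2.
have fP : factor (p1 ++ p2) (pw g k) by apply: factor_trans fp; exists [::], (flatten ps'); rewrite /= catA.
have fp1 : factor p1 (pw g k) by apply: factor_trans fP; exists [::], p2.
have fp2 : factor p2 (pw g k) by apply: factor_trans fP; exists p1, [::]; rewrite cats0.
have away p n : factor p (behead q ++ r ++ take l q) -> p <> [::] -> factor p (pw g k) -> occ Γ p n -> n < 3 * size p -> False.
  by move=> h1 h2 h3 oc; have := touch_away h1 h2 (pw_long h2 h3 oc) oc; clear; lia.
have s1 : size p1 <= V by case: (cases p1 k n1 pn1 fp1 oc1) => [|[]//]; move: lt1; clear; lia.
have s2 : size p2 <= V by case: (cases p2 k n2 pn2 fp2 oc2) => [|[]//]; move: lt2; clear; lia.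
case: (power_factor q0 fP) => [[t [w [y [k' [ep eu]]]]]|]; rewrite ?el; last first.
  by move=> h; apply: (away p1 n1) => //; apply: factor_trans h; exists [::], p2.
have /andP[Kr1 _] := Kr.
have szP := congr1 size ep; rewrite !size_cat in szP.
have fw : factor w r.
  have -> : w = take (size w) r by apply: cat_prefix_le eu _; move: szP s1 s2 Kr1 VK; clear; lia.
  by exists [::], (drop (size w) r); rewrite cat_take_drop.
have fd : factor (drop t g) r.
  have -> : drop t g = drop (t - size q) r.
    rewrite drop_catE drop_oversize // leqNgt; apply/negP => lt.
    move: szP; rewrite drop_catE size_cat; have -> : t - size q = 0 by [lia].
    by rewrite drop0; move: s1 s2 Kr1 VK; clear; lia.
  by exists (take (t - size q) r), [::]; rewrite cats0 cat_take_drop.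
have [le|lt] := leqP (size (drop t g ++ q)) (size p1).
  rewrite catA in ep; have [_ e2] := cat_prefix_ge ep le.
  apply: (away p2 n2) => //; apply: factor_catl; apply: factor_catr; apply: factor_trans fw.
  by exists (drop (size (drop t g ++ q)) p1), [::]; rewrite cats0.
apply: (away p1 n1) => //.
have ep' : p1 ++ p2 = (drop t g ++ take l q) ++ (drop l q ++ w).
  by rewrite ep -[RHS]catA; congr (_ ++ _); rewrite [RHS]catA cat_take_drop.
have -> : p1 = take (size p1) (drop t g ++ take l q).
  apply: cat_prefix_le ep' _; rewrite size_cat size_takel ?sq //.
  by move: lt; rewrite size_cat sq; clear; lia.
apply: factor_trans (_ : factor (drop t g ++ take l q) _).
  by exists [::], (drop (size p1) (drop t g ++ take l q)); rewrite cat_take_drop.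
apply: factor_catl.
have -> : drop t g = drop (t - size q) r.
  rewrite drop_catE drop_oversize // leqNgt; apply/negP => lt'.
  move: szP; rewrite drop_catE size_cat; have -> : t - size q = 0 by [lia].
  by rewrite drop0; move: s1 s2 Kr1 VK; clear; lia.
by exists (take (t - size q) r), [::]; rewrite cats0 catA cat_take_drop.
Qed.
End UnboundedCycles.

Theorem unbounded_axis (S : Type) (Γ : LGraph S) : reduced Γ -> Gr'16 Γ ->
  (exists l : list S, forall s, In s l) -> finite_components Γ ->
  (forall N, exists v (c : seq (step Γ)), simple_cycle v c /\ N < size c) ->
  exists g M Rr, axis Γ g M Rr.
Proof.
move=> red gr fin fc unb.
have [l [l0 short]] := min_word_exists gr (unb 1).
have [V hV] := uniform_bound fin fc l.+1.
have hV' q n : min_word Γ l q -> occ Γ q n -> n <= V.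
  case=> sq rg _ [v [c1 [c2 [sc lc <-]]]]; have vc1 : valid v c1 by case: sc => _ [+ _]; rewrite valid_cat => -[].
  by apply: (hV q _ rg v c1 vc1 lc v) => //; [rewrite sq|exact: connected_refl].
(* [K] lets [r] outweigh two arcs of length [V] and the partial copies of [q]. [N] exceeds three
   times the length of the longest [r] with a partial copy of [q] on each side. *)
pose K := 2 * V + 4 * l + 1.
have [N [leN [z0 lz0] nc]] := long_words_exist gr fin fc unb (6 * K + 6 * l + 1).
have VN : V < N by move: leN; rewrite /K; clear; lia.
have KN : 2 * K + l + 1 <= N by move: leN; clear; lia.
have lK : l < K by rewrite /K; clear; lia.
have [q [r [z [mq lz fr Kr jn]]]] := junction_exists red l0 hV' VN KN lK nc lz0.
exists (q ++ r); do 2!eexists; apply: (unbounded_axis_of_junction red gr mq short (hV' q ^~ mq) lz fr Kr _ _ jn).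
- by rewrite /K addn1.
- by move: leN; clear; lia.
Qed.

Theorem theorem5p1 (S : Type) (Γ : LGraph S) :
  (exists l : list S, forall s, In s l) ->
  reduced Γ ->
  Gr'16 Γ ->
  finite_components Γ ->
  group_infinite Γ ->
  exists g : word S, infinite_order Γ g /\ strongly_contracting Γ g.
Proof.
move=> fin red gr fc inf.
have [g [M [Rr ax]]] : exists g M Rr, axis Γ g M Rr.
  case: (classic (exists M, forall v (c : seq (step Γ)), simple_cycle v c -> size c <= M)) => [[M cyc]|unb].
    exact: (bounded_axis fin inf cyc).
  apply: unbounded_axis => // N; apply: NNPP => nex; apply: unb; exists N => v c sc.
  by rewrite leqNgt; apply/negP => lt; apply: nex; exists v, c.
by exists g; split; [exact: (axis_infinite_order red gr ax)|exact: (axis_contracting red gr fin ax)].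
Qed.
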